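(* Let $\mathbf{C}$ be a category. If $\Sigma$ is a polygraphic resolution of $\mathbf{C}$, then the Reidemeister-Fox-Squier complex $F_{\mathbf{C}}[\Sigma]$ is a free resolution of the constant natural system $\mathbb{Z}$ on $\mathbf{C}$. Likewise, if $\Sigma$ is a partial polygraphic resolution of length $n$ of $\mathbf{C}$, then $F_{\mathbf{C}}[\Sigma]$ is a free partial resolution of length $n$ of $\mathbb{Z}$, i.e. the sequence $$F_{\mathbf{C}}[\Sigma_n]\xrightarrow{\delta_n}F_{\mathbf{C}}[\Sigma_{n-1}]\xrightarrow{\delta_{n-1}}\cdots\xrightarrow{\delta_1}F_{\mathbf{C}}[\Sigma_0]\xrightarrow{\varepsilon}\mathbb{Z}\to0$$ of natural systems on $\mathbf{C}$ is exact.
   Context: Polygraphs. All higher categories are strict and globular; $f\star_i g$ is the $i$-composite, $\star_0$ is concatenation. A $k$-sphere is a pair of parallel $k$-cells. A cellular extension of a $k$-category $\mathcal{C}$ is a set $\Gamma$ with a map to the $k$-spheres of $\mathcal{C}$; $\mathcal{C}(\Gamma)$ is obtained by freely adjoining the elements of $\Gamma$ as invertible $(k+1)$-cells. For $2\le n\le\infty$, an $(n,1)$-polygraph $\Sigma$ consists of a set $\Sigma_0$, a graph $\Sigma_1$ over $\Sigma_0$ with free category $\Sigma_1^*$, and, for $1\le k<n$, a cellular extension $\Sigma_{k+1}$ of $\Sigma^{\top}_k=\Sigma_1^*(\Sigma_2)\cdots(\Sigma_k)$. It presents the category $\overline{\Sigma}=\Sigma_1^*/\Sigma_2$; for a cell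 $f$ of dimension $\geq 1$ of the free $(n,1)$-category $\Sigma^{\top}$, $\overline{f}$ is the $1$-cell of $\overline{\Sigma}$ which is the common image of its $1$-source and $1$-target. $\Sigma$ is acyclic when, for every $1<k<n$, every $k$-sphere of $\Sigma_k^{\top}$ is the boundary of some $(k+1)$-cell of $\Sigma_k^{\top}(\Sigma_{k+1})$. A polygraphic resolution (resp. partial polygraphic resolution of length $n<\infty$) of $\mathbf{C}$ is an acyclic $(\infty,1)$-polygraph (resp. $(n,1)$-polygraph) with $\overline{\Sigma}\simeq\mathbf{C}$. Natural systems. The category of factorisations $F\mathbf{C}$ has the $1$-cells of $\mathbf{C}$ as objects, and as morphisms $w\to w'$ the pairs $(u,v)$ of $1$-cells with $uwv=w'$; composition is $(u,v)(u',v')=(u'u,vv')$. A natural system on $\mathbf{C}$ is a functor $D:F\mathbf{C}\to\mathbf{Ab}$; $D_w$ is its value at $w$ and $uav$ is $D(u,v)(a)$. $\mathbb{Z}$ is the constant natural system. Free natural systems are coproducts of the functors $\mathbb{Z}F\mathbf{C}(w,-)$. For $\overline{\Sigma}\simeq\mathbf{C}$: $F_{\mathbf{C}}[\Sigma_0]_w$ is the free abelian group on pairs $(u,v)$ with $uv=w$; for $k\ge1$, $F_{\mathbf{C}}[\Sigma_k]_w$ is the free abelian group on the $u[\varphi]v$ with $\varphi\in\Sigma_k$ and $u,v$ $1$-cells of $\mathbf{C}$ with $u\overline{\varphi}v=w$. Reidemeister-Fox-Squier complex. The assignment $\varphi\mapsto[\varphi]$ extends to all $k$-cells of $\Sigma_k^{\top}$,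 $k\geq 1$, with values in $F_{\mathbf{C}}[\Sigma_k]$: on $1$-cells by $[1_x]=0$, $[uv]=[u]\overline{v}+\overline{u}[v]$; for $k>1$ by $[1_u]=0$, $[f^-]=-[f]$, $[fg]=[f]\overline{g}+\overline{f}[g]$ and $[f\star_i g]=[f]+[g]$ for $i\ge1$. The boundary maps $\delta_k:F_{\mathbf{C}}[\Sigma_k]\to F_{\mathbf{C}}[\Sigma_{k-1}]$ are the morphisms of natural systems with $\delta_1[\alpha]=(\overline{\alpha},1)-(1,\overline{\alpha})$ and $\delta_k[\alpha]=[s(\alpha)]-[t(\alpha)]$ for $k>1$ and $\alpha\in\Sigma_k$; the augmentation $\varepsilon:F_{\mathbf{C}}[\Sigma_0]\to\mathbb{Z}$ is $\varepsilon(u,v)=1$. The complex $F_{\mathbf{C}}[\Sigma]$ consists of the $F_{\mathbf{C}}[\Sigma_k]$ with these maps, augmented over $\mathbb{Z}$. *)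

(* Defs.v *)
From HB Require Import structures.
From mathcomp Require Import all_boot all_order all_algebra.
From mathcomp Require Import generic_quotient boolp.
From mathcomp Require Import freeg.

Set Implicit Arguments.
Unset Strict Implicit.
Unset Printing Implicit Defensive.

Import GRing.Theory.
Local Open Scope ring_scope.
Local Open Scope quotient_scope.

#[local] Obligation Tactic := idtac.

(* Composition is written in diagrammatic order: [cmp u v] is "u, then v",
   the concatenation uv. *)
Record category := Category {
  ob :> Type;
  hom : ob -> ob -> Type;
  idm : forall x, hom x x;
  cmp : forall x y z, hom x y -> hom y z -> hom x z;
  cmp1m : forall x y (f : hom x y), cmp (idm x) f = f;
  cmpm1 : forall x y (f : hom x y), cmp f (idm y) = f;
  cmpA : forall x y z t (f : hom x y) (g : hom y z) (h : hom z t),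
    cmp (cmp f g) h = cmp f (cmp g h) }.

Arguments idm {c} x.

Declare Scope cat_scope.
Delimit Scope cat_scope with cat.
Notation "f \; g" := (cmp f g) : cat_scope.
Local Open Scope cat_scope.

Record functor (A B : category) := Functor {
  fob :> A -> B;
  fmap : forall x y, hom x y -> hom (fob x) (fob y);
  fmap1 : forall x, fmap (idm x) = idm (fob x);
  fmapM : forall x y z (f : hom x y) (g : hom y z),
    fmap (f \; g) = fmap f \; fmap g }.

Definition is_iso (A B : category) (F : functor A B) : Prop :=
  bijective F /\ forall x y, bijective (@fmap A B F x y).

Record arrow (C : category) := Arrow {
  adom : C; acod : C; amap : hom adom acod }.
Arguments Arrow {C adom acod} amap.

Record fact_hom (C : category) (w w' : arrow C) := FactHom {
  fleft : hom (adom w') (adom w);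
  fright : hom (acod w) (acod w');
  factE : fleft \; amap w \; fright = amap w' }.

Lemma fact_homP (C : category) (w w' : arrow C) (m m' : fact_hom w w') :
  fleft m = fleft m' -> fright m = fright m' -> m = m'.
Proof.
case: m m' => [u v E] [u' v' E'] /= eu ev.
by move: E E'; rewrite eu ev => E E'; congr FactHom.
Qed.

Lemma fact_id_subproof (C : category) (w : arrow C) :
  idm (adom w) \; amap w \; idm (acod w) = amap w.
Proof. by rewrite cmpm1 cmp1m. Qed.

Definition fact_id C (w : arrow C) := FactHom (fact_id_subproof w).

Lemma fact_cmp_subproof (C : category) (w1 w2 w3 : arrow C)
    (m : fact_hom w1 w2) (m' : fact_hom w2 w3) :
  (fleft m' \; fleft m) \; amap w1 \; (fright m \; fright m') = amap w3.
Proof. by rewrite -(factE m') -(factE m) !cmpA. Qed.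

Definition fact_cmp C (w1 w2 w3 : arrow C)
  (m : fact_hom w1 w2) (m' : fact_hom w2 w3) :=
  FactHom (fact_cmp_subproof m m').

Program Definition fact (C : category) : category :=
  @Category (arrow C) (@fact_hom C) (@fact_id C) (@fact_cmp C) _ _ _.
Next Obligation. by move=> *; apply: fact_homP; rewrite /= ?cmp1m ?cmpm1. Qed.
Next Obligation. by move=> *; apply: fact_homP; rewrite /= ?cmp1m ?cmpm1. Qed.
Next Obligation. by move=> *; apply: fact_homP; rewrite /= ?cmpA. Qed.

(* Functors from [fact C] to abelian groups. *)
Record natsys (C : category) := NatSys {
  nval :> fact C -> zmodType;
  nact : forall w w' : fact C, hom w w' -> {additive nval w -> nval w'};
  nact1 : forall w a, nact (idm w) a = a;
  nactM : forall w w' w'' (m : hom w w') (m' : hom w' w'') a,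
    nact (m \; m') a = nact m' (nact m a) }.
Arguments nact {C} n {w w'}.

Record nmor (C : category) (D E : natsys C) := NMor {
  nmap :> forall w, {additive D w -> E w};
  nmap_nat : forall w w' (m : hom w w') a,
    nmap w' (nact D m a) = nact E m (nmap w a) }.

Program Definition const_int (C : category) : natsys C :=
  @NatSys C (fun=> int) (fun _ _ _ => idfun) _ _.
Next Obligation. by []. Qed.
Next Obligation. by []. Qed.

Definition is_coproduct (C : category) (I : Type) (D : I -> natsys C)
    (S : natsys C) (inj : forall i, nmor (D i) S) : Prop :=
  forall (E : natsys C) (f : forall i, nmor (D i) E),
    exists g : nmor S E,
      (forall i w a, g w (inj i w a) = f i w a) /\
      forall g' : nmor S E, (forall i w a, g' w (inj i w a) = f i w a) ->
        forall w a, g' w a = g w a.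

Definition freeab (T : Type) : zmodType := {freeg {classic T} / int}.

Definition fgen (T : Type) (t : T) : freeab T := << (t : {classic T}) >>.

Lemma freeab_ext (T : Type) (A : zmodType) (f g : {additive freeab T -> A}) :
  (forall t, f (fgen t) = g (fgen t)) -> forall a, f a = g a.
Proof.
move=> fg a; rewrite -(freeg_sumE a) !raddf_sum; apply: eq_bigr => x _.
by rewrite -[coeff x a]intz -freegU_mulz !raddfMz fg.
Qed.

Section Lift.
Variables (T : Type) (A : zmodType) (f : T -> A).

Definition flift (a : freeab T) : A :=
  fglift (f : {classic T} -> zmodule A) a.

Lemma flift_is_additive : {morph flift : a b / a - b}.
Proof.
exact: (@lift_is_additive int {classic T} (zmodule A)).
Qed.

HB.instance Definition _ :=
  GRing.isZmodMorphism.Build (freeab T) A flift flift_is_additive.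

Lemma flift_gen t : flift (fgen t) = f t.
Proof. by rewrite /flift liftU scale1r. Qed.
End Lift.

(* A functor from [fact C] to sets, and the natural system whose value at [w]
   is the free abelian group on the value of this functor at [w]. *)
Record setsys (C : category) := SetSys {
  sval :> fact C -> Type;
  sact : forall w w' : fact C, hom w w' -> sval w -> sval w';
  sact1 : forall w s, sact (idm w) s = s;
  sactM : forall w w' w'' (m : hom w w') (m' : hom w' w'') s,
    sact (m \; m') s = sact m' (sact m s) }.

Section FreeSys.
Variables (C : category) (S : setsys C).

Definition free_act (w w' : fact C) (m : hom w w') :
    {additive freeab (S w) -> freeab (S w')} :=
  flift (fun s => fgen (sact m s)).

Lemma free_act1 w a : free_act (idm w) a = a.
Proof.
apply: (freeab_ext (f := free_act (idm w)) (g := idfun)) => t.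
by rewrite /= flift_gen sact1.
Qed.

Lemma free_actM w w' w'' (m : hom w w') (m' : hom w' w'') a :
  free_act (m \; m') a = free_act m' (free_act m a).
Proof.
apply: (freeab_ext (f := free_act (m \; m'))
                   (g := free_act m' \o free_act m)) => t.
by rewrite /= !flift_gen sactM.
Qed.

Definition free_sys : natsys C := NatSys free_act1 free_actM.

Lemma free_nmor_subproof (E : natsys C) (e : forall w, S w -> E w) :
  (forall w w' (m : hom w w') s, e w' (sact m s) = nact E m (e w s)) ->
  forall w w' (m : hom w w') a,
    flift (@e w') (nact free_sys m a) = nact E m (flift (@e w) a).
Proof.
move=> eN w w' m a.
apply: (freeab_ext (f := flift (@e w') \o free_act m)
                   (g := nact E m \o flift (@e w))) => t.
by rewrite /= !flift_gen eN.
Qed.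

Definition free_nmor (E : natsys C) (e : forall w, S w -> E w)
    (eN : forall w w' (m : hom w w') s,
            e w' (sact m s) = nact E m (e w s)) : nmor free_sys E :=
  @NMor C free_sys E (fun w => flift (@e w)) (free_nmor_subproof eN).
End FreeSys.

(* The set-valued functor represented by a family [a] of objects: at [w], the
   pairs of an index [i] and a morphism from [a i] to [w]. *)
Section FamSys.
Variables (C : category) (I : Type) (a : I -> fact C).

Program Definition fam_sys : setsys C :=
  @SetSys C (fun w => {i : I & hom (a i) w})
    (fun w w' m s => existT _ (projT1 s) (projT2 s \; m)) _ _.
Next Obligation. move=> w [i m]; congr existT; exact: (@cmpm1 (fact C)). Qed.
Next Obligation.
by move=> w w' w'' m m' [i n]; congr existT; rewrite (@cmpA (fact C)).
Qed.

Lemma fam_nmor_subproof (E : natsys C) (e : forall i, E (a i))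
    (w w' : fact C) (m : hom w w') (s : fam_sys w) :
  nact E (projT2 (sact m s)) (e (projT1 (sact m s))) =
  nact E m (nact E (projT2 s) (e (projT1 s))).
Proof. by rewrite /= (@nactM _ E). Qed.

Definition fam_nmor (E : natsys C) (e : forall i, E (a i)) :
    nmor (free_sys fam_sys) E :=
  free_nmor (@fam_nmor_subproof E e).

Definition fam_gen (i : I) : free_sys fam_sys (a i) :=
  fgen (existT (fun j => hom (a j) (a i)) i (idm (a i))).
End FamSys.

(* The natural system Z FC(w, -). *)
Definition repr_sys (C : category) (w : fact C) : natsys C :=
  free_sys (@SetSys C (fun w' => hom w w') (fun _ _ m s => s \; m)
              (fun _ s => cmpm1 s) (fun _ _ _ m m' s => esym (cmpA s m m'))).

Definition is_free (C : category) (D : natsys C) : Prop :=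
  exists (I : Type) (w : I -> fact C) (inj : forall i, nmor (repr_sys (w i)) D),
    is_coproduct inj.

(* The set-valued functor of the pairs (u, v) with uv = w. *)
Record fact_pair (C : category) (w : arrow C) := FactPair {
  pmid : C;
  pleft : hom (adom w) pmid;
  pright : hom pmid (acod w);
  pairE : pleft \; pright = amap w }.
Arguments FactPair {C w pmid} pleft pright pairE.

Lemma fact_pairP (C : category) (w : arrow C) z (u u' : hom (adom w) z)
    (v v' : hom z (acod w)) E E' :
  u = u' -> v = v' -> FactPair u v E = FactPair u' v' E'.
Proof.
by move=> eu ev; move: E E'; rewrite eu ev => E E'; congr FactPair.
Qed.

Lemma pair_act_subproof (C : category) (w w' : arrow C) (m : fact_hom w w')
    (p : fact_pair w) :
  (fleft m \; pleft p) \; (pright p \; fright m) = amap w'.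
Proof. by rewrite -(factE m) -(pairE p) !cmpA. Qed.

Program Definition pair_sys (C : category) : setsys C :=
  @SetSys C (@fact_pair C)
    (fun _ _ m p => FactPair _ _ (pair_act_subproof m p)) _ _.
Next Obligation.
by move=> C w [z u v E]; apply: fact_pairP; rewrite /= ?cmp1m ?cmpm1.
Qed.
Next Obligation. by move=> *; apply: fact_pairP; rewrite /= ?cmpA. Qed.

Variant side := Src | Tgt.
Definition flip e := if e is Src then Tgt else Src.

(* Formal composites of generators, sorted by 0-source and 0-target.
   [G n x y] stands for the generators of dimension n + 1, and [fcell G n x y]
   for the formal cells of dimension n + 1, going from [x] to [y].  [Hcomp] is
   the 0-composition, and [Vcomp i] the (i + 1)-composition.  Only cells of
   dimension at least 2 have a formal inverse. *)
Inductive fcell (O : Type) (G : nat -> O -> O -> Type) :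
    nat -> O -> O -> Type :=
| Gen n x y : G n x y -> fcell G n x y
| One x : fcell G 0 x x
| Idc n x y : fcell G n x y -> fcell G n.+1 x y
| Inv n x y : fcell G n.+1 x y -> fcell G n.+1 x y
| Hcomp n x y z : fcell G n x y -> fcell G n y z -> fcell G n x z
| Vcomp n (i : nat) x y :
    fcell G n.+1 x y -> fcell G n.+1 x y -> fcell G n.+1 x y.

Arguments Gen {O G n x y} _.
Arguments One {O G} x.
Arguments Idc {O G n x y} _.
Arguments Inv {O G n x y} _.
Arguments Hcomp {O G n x y z} _ _.
Arguments Vcomp {O G n} i {x y} _ _.

(* Raw data: the generators of dimension n + 2 are attached to formal cells of
   dimension n + 1. *)
Record pre_polygraph := PrePolygraph {
  pob : Type;
  gen : nat -> pob -> pob -> Type;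
  att : side -> forall n x y, gen n.+1 x y -> fcell gen n x y }.
Arguments att {p} e {n x y} _.

Section Cells.
Variable P : pre_polygraph.
Local Notation cell := (fcell (@gen P)).

Definition low_cell n x y : Type := if n is k.+1 then cell k x y else unit.

(* Source and target of a formal cell; those of a 1-cell are its indices. *)
Fixpoint bd (e : side) n x y (f : cell n x y) : low_cell n x y :=
  match f in fcell _ n x y return low_cell n x y with
  | @Gen _ _ n x y a =>
      match n return gen n x y -> low_cell n x y with
      | 0 => fun _ => tt
      | k.+1 => fun a => att e a
      end a
  | @One _ _ _ => tt
  | @Idc _ _ _ _ _ f => f
  | @Inv _ _ _ _ _ f => bd (flip e) f
  | @Hcomp _ _ n x y z f g =>
      match n return low_cell n x y -> low_cell n y z -> low_cell n x z with
      | 0 => fun _ _ => tt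
      | k.+1 => fun f' g' => Hcomp f' g'
      end (bd e f) (bd e g)
  | @Vcomp _ _ n i x y f g =>
      match n return cell n x y -> cell n x y -> cell n x y with
      | 0 => fun f' g' => if e is Src then f' else g'
      | k.+1 => fun f' g' =>
          if (i <= k)%N then Vcomp i f' g' else if e is Src then f' else g'
      end (bd e f) (bd e g)
  end.

Definition bdS (e : side) n x y (f : cell n.+1 x y) : cell n x y := bd e f.

(* Iterated sources and targets: m steps down, stopping at 1-cells. *)
Fixpoint bd_iter (e : side) (m : nat) n x y (f : cell n x y) :
    cell (iter m predn n) x y :=
  if m is m'.+1 return cell (iter m predn n) x y then
    match iter m' predn n as k return cell k x y -> cell k.-1 x y with
    | 0 => id
    | k.+1 => @bdS e k x y
    end (bd_iter e m' f)
  else f.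

(* The source and target of dimension i + 1 (those of [f] if this exceeds the
   dimension of [f]), seen as identity cells of the dimension of [f]. *)
Fixpoint bd_id (e : side) (i n : nat) x y : cell n x y -> cell n x y :=
  match n return cell n x y -> cell n x y with
  | 0 => id
  | k.+1 => fun f => if (k < i)%N then f else Idc (bd_id e i (bdS e f))
  end.

Fixpoint one_iter (n : nat) x : cell n x x :=
  if n is k.+1 return cell n x x then Idc (one_iter k x) else One x.

(* [valid] holds when every composition occurring in a formal cell matches up
   to [eqc], and [eqc] is the congruence on valid cells generated by the axioms
   of strict higher categories, together with the invertibility of the cells of
   dimension at least 2.  The (n + 1)-cells of the free (n + 1, 1)-category are
   thus the classes of valid elements of [cell n x y] modulo [eqc]. *)
Inductive valid : forall n x y, cell n x y -> Prop :=
| valid_gen n x y (a : gen n x y) : valid (Gen a)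
| valid_one x : valid (One x)
| valid_idc n x y (f : cell n x y) : valid f -> valid (Idc f)
| valid_inv n x y (f : cell n.+1 x y) : valid f -> valid (Inv f)
| valid_hcomp n x y z (f : cell n x y) (g : cell n y z) :
    valid f -> valid g -> valid (Hcomp f g)
| valid_vcomp n i x y (f g : cell n.+1 x y) : (i <= n)%N ->
    valid f -> valid g ->
    eqc (bd_iter Tgt (n.+1 - i) f) (bd_iter Src (n.+1 - i) g) ->
    valid (Vcomp i f g)

with eqc : forall n x y, cell n x y -> cell n x y -> Prop :=
| eqc_refl n x y (f : cell n x y) : valid f -> eqc f f
| eqc_sym n x y (f g : cell n x y) : eqc f g -> eqc g f
| eqc_trans n x y (f g h : cell n x y) : eqc f g -> eqc g h -> eqc f h
| eqc_idc n x y (f f' : cell n x y) : eqc f f' -> eqc (Idc f) (Idc f')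
| eqc_inv n x y (f f' : cell n.+1 x y) : eqc f f' -> eqc (Inv f) (Inv f')
| eqc_hcomp n x y z (f f' : cell n x y) (g g' : cell n y z) :
    eqc f f' -> eqc g g' -> eqc (Hcomp f g) (Hcomp f' g')
| eqc_vcomp n i x y (f f' g g' : cell n.+1 x y) :
    valid (Vcomp i f g) -> eqc f f' -> eqc g g' ->
    eqc (Vcomp i f g) (Vcomp i f' g')
| eqc_hcompA n x y z t (f : cell n x y) (g : cell n y z) (h : cell n z t) :
    valid f -> valid g -> valid h ->
    eqc (Hcomp (Hcomp f g) h) (Hcomp f (Hcomp g h))
| eqc_hcomp1l n x y (f : cell n x y) :
    valid f -> eqc (Hcomp (one_iter n x) f) f
| eqc_hcomp1r n x y (f : cell n x y) :
    valid f -> eqc (Hcomp f (one_iter n y)) f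
| eqc_vcompA n i x y (f g h : cell n.+1 x y) :
    valid (Vcomp i (Vcomp i f g) h) ->
    eqc (Vcomp i (Vcomp i f g) h) (Vcomp i f (Vcomp i g h))
| eqc_vcomp1l n i x y (f : cell n.+1 x y) : (i <= n)%N ->
    valid f -> eqc (Vcomp i (bd_id Src i f) f) f
| eqc_vcomp1r n i x y (f : cell n.+1 x y) : (i <= n)%N ->
    valid f -> eqc (Vcomp i f (bd_id Tgt i f)) f
| eqc_hv n i x y z (f f' : cell n.+1 x y) (g g' : cell n.+1 y z) :
    valid (Vcomp i f f') -> valid (Vcomp i g g') ->
    eqc (Hcomp (Vcomp i f f') (Vcomp i g g'))
        (Vcomp i (Hcomp f g) (Hcomp f' g'))
| eqc_vv n i j x y (f f' g g' : cell n.+1 x y) : (i < j)%N ->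
    valid (Vcomp i (Vcomp j f f') (Vcomp j g g')) ->
    eqc (Vcomp i (Vcomp j f f') (Vcomp j g g'))
        (Vcomp j (Vcomp i f g) (Vcomp i f' g'))
| eqc_idc_hcomp n x y z (f : cell n x y) (g : cell n y z) :
    valid f -> valid g -> eqc (Idc (Hcomp f g)) (Hcomp (Idc f) (Idc g))
| eqc_idc_vcomp n i x y (f g : cell n.+1 x y) :
    valid (Vcomp i f g) -> eqc (Idc (Vcomp i f g)) (Vcomp i (Idc f) (Idc g))
| eqc_invr n x y (f : cell n.+1 x y) :
    valid f -> eqc (Vcomp n f (Inv f)) (Idc (bdS Src f))
| eqc_invl n x y (f : cell n.+1 x y) :
    valid f -> eqc (Vcomp n (Inv f) f) (Idc (bdS Tgt f)).

(* Two elements of [cell 0 x y] have the same 0-source and 0-target. *)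
Definition parallel n x y : cell n x y -> cell n x y -> Prop :=
  match n with
  | 0 => fun _ _ => True
  | k.+1 => fun f g => forall e, eqc (bdS e f) (bdS e g)
  end.

Definition is_sphere n x y (f g : cell n x y) : Prop :=
  [/\ valid f, valid g & parallel f g].

Fixpoint src1 n x y : cell n x y -> cell 0 x y :=
  match n with 0 => id | k.+1 => fun f => src1 (bdS Src f) end.

(* The congruence on the free category generated by the 2-generators. *)
Inductive cong2 : forall x y, cell 0 x y -> cell 0 x y -> Prop :=
| cong2_gen x y (a : gen 1 x y) : cong2 (att Src a) (att Tgt a)
| cong2_eqc x y (f g : cell 0 x y) : eqc f g -> cong2 f g
| cong2_refl x y (f : cell 0 x y) : cong2 f f
| cong2_sym x y (f g : cell 0 x y) : cong2 f g -> cong2 g f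
| cong2_trans x y (f g h : cell 0 x y) : cong2 f g -> cong2 g h -> cong2 f h
| cong2_hcomp x y z (f f' : cell 0 x y) (g g' : cell 0 y z) :
    cong2 f f' -> cong2 g g' -> cong2 (Hcomp f g) (Hcomp f' g').

Lemma valid1 x y (f : cell 0 x y) : valid f.
Proof.
suff H n x' y' (h : cell n x' y') : n = 0%N -> valid h by exact: (H _ _ _ f).
elim: n x' y' / h => //.
- by move=> *; exact: valid_gen.
- by move=> *; exact: valid_one.
- by move=> n x1 y1 z1 h1 IH1 h2 IH2 n0; apply: valid_hcomp; auto.
Qed.

Definition cong2_rel x y : rel {classic cell 0 x y} :=
  fun f g => `[< cong2 f g >].

Lemma cong2_rel_refl x y : reflexive (@cong2_rel x y).
Proof. by move=> f; apply/asboolP; exact: cong2_refl. Qed.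

Lemma cong2_rel_sym x y : symmetric (@cong2_rel x y).
Proof. by move=> f g; apply/asboolP/asboolP => ?; exact: cong2_sym. Qed.

Lemma cong2_rel_trans x y : transitive (@cong2_rel x y).
Proof.
move=> g f h /asboolP fg /asboolP gh; apply/asboolP; exact: cong2_trans gh.
Qed.

Canonical cong2_equiv x y := EquivRel (@cong2_rel x y)
  (@cong2_rel_refl x y) (@cong2_rel_sym x y) (@cong2_rel_trans x y).
Canonical cong2_equiv_direct x y := defaultEncModRel (@cong2_rel x y).

Definition pres_hom x y : Type := {eq_quot (@cong2_rel x y)}.

Definition pres_class x y (f : cell 0 x y) : pres_hom x y :=
  (\pi_{eq_quot (@cong2_rel x y)} (f : {classic cell 0 x y}))%qT.

Definition pres_repr x y (c : pres_hom x y) : cell 0 x y :=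
  repr (c : {eq_quot (@cong2_rel x y)}).

Lemma pres_reprK x y (c : pres_hom x y) : pres_class (pres_repr c) = c.
Proof. exact: reprK. Qed.

Lemma pres_classP x y (f g : cell 0 x y) :
  pres_class f = pres_class g <-> cong2 f g.
Proof.
split=> [/eqmodP/asboolP//|fg]; exact/eqmodP/asboolP.
Qed.

Definition pres_cmp x y z (c : pres_hom x y) (d : pres_hom y z) :
    pres_hom x z :=
  pres_class (Hcomp (pres_repr c) (pres_repr d)).

Lemma pres_cmpE x y z (f : cell 0 x y) (g : cell 0 y z) :
  pres_cmp (pres_class f) (pres_class g) = pres_class (Hcomp f g).
Proof.
by apply/pres_classP/cong2_hcomp; apply/pres_classP; rewrite pres_reprK.
Qed.

Program Definition pres : category :=
  @Category (pob P) pres_hom (fun x => pres_class (One x)) pres_cmp _ _ _.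
Next Obligation.
move=> x y f; rewrite -[f in LHS]pres_reprK pres_cmpE -[RHS]pres_reprK.
apply/pres_classP/cong2_eqc; exact: (eqc_hcomp1l (valid1 _)).
Qed.
Next Obligation.
move=> x y f; rewrite -[f in LHS]pres_reprK pres_cmpE -[RHS]pres_reprK.
apply/pres_classP/cong2_eqc; exact: (eqc_hcomp1r (valid1 _)).
Qed.
Next Obligation.
move=> x y z t f g h.
rewrite -[f]pres_reprK -[g]pres_reprK -[h]pres_reprK !pres_cmpE.
by apply/pres_classP/cong2_eqc/eqc_hcompA; exact: valid1.
Qed.

End Cells.

(* Dimensions range over the natural numbers, with [None] for infinity. *)
Definition dim_le (m : nat) (n : option nat) : bool :=
  if n is Some k then (m <= k)%N else true.

(* (n, 1)-polygraphs; there are no generators of dimension greater than [n]. *)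
Record polygraph (n : option nat) := Polygraph {
  poly_data :> pre_polygraph;
  poly_att : forall k x y (a : @gen poly_data k.+1 x y),
    is_sphere (att Src a) (att Tgt a);
  poly_dim : forall k x y, @gen poly_data k x y -> dim_le k.+1 n }.

(* Spheres of dimension k + 2, with 1 < k + 2 < n, are boundaries of cells of
   dimension k + 3. *)
Definition acyclic n (P : polygraph n) : Prop :=
  forall k x y (f g : fcell (@gen P) k.+1 x y), dim_le k.+3 n ->
    is_sphere f g ->
    exists A : fcell (@gen P) k.+2 x y,
      [/\ valid A, eqc (bdS Src A) f & eqc (bdS Tgt A) g].

(* Polygraphic resolution of C if n is infinite, partial polygraphic
   resolution of length n otherwise. *)
Record poly_resolution (n : option nat) (C : category) := PolyResolution {
  res_poly :> polygraph n;
  res_acyclic : acyclic res_poly;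
  res_functor : functor (pres res_poly) C;
  res_iso : is_iso res_functor }.

(* The element uav of D_w', if uwv = w', and 0 otherwise. *)
Definition biact (C : category) (D : natsys C) (w : arrow C) (a : D w)
    (w' : arrow C)
    (u : hom (adom w') (adom w)) (v : hom (acod w) (acod w')) : D w' :=
  if pselect (u \; amap w \; v = amap w') is left E
  then nact D (FactHom E : @hom (fact C) w w') a else 0.
Arguments biact {C D w} a w' u v.

Section Fox.
Variables (P : pre_polygraph) (C : category) (F : functor (pres P) C).
Local Notation cell := (fcell (@gen P)).

(* The 1-cell of C denoted by an overlined f in the literature. *)
Definition bar n (x y : pob P) (f : cell n x y) : hom (F x) (F y) :=
  fmap F (pres_class (src1 f) : @hom (pres P) x y).

Definition obar n x y (f : cell n x y) : fact C := Arrow (bar f).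

Record tgen n := TGen { tsrc : pob P; ttgt : pob P; tval : gen n tsrc ttgt }.
Arguments TGen {n tsrc ttgt} _.

(* F_C[Sigma_0] and F_C[Sigma_(n + 1)].  A basis element u[a]v of the latter
   is the pair of a generator a and of the morphism (u, v) of [fact C]. *)
Definition RFS0 : natsys C := free_sys (pair_sys C).

Definition RFSgen n : natsys C :=
  free_sys (fam_sys (fun a : tgen n => obar (Gen (tval a)))).

(* The equalities of 1-cells tested by [biact] below hold on valid cells, and
   the bracket is compatible with [eqc]: see [valid_bar_bd], [valid_bar_vcomp]
   and [bracket_eqc]. *)
Fixpoint bracket n x y (f : cell n x y) : RFSgen n (obar f) :=
  match f in fcell _ n x y return RFSgen n (obar f) with
  | @Gen _ _ n x y a => fam_gen (fun a : tgen n => obar (Gen (tval a))) (TGen a)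
  | @One _ _ _ => 0
  | @Idc _ _ _ _ _ _ => 0
  | @Inv _ _ _ _ _ f => - biact (bracket f) (obar (Inv f)) (idm _) (idm _)
  | @Hcomp _ _ _ _ _ _ f g =>
      biact (bracket f) (obar (Hcomp f g)) (idm _) (bar g) +
      biact (bracket g) (obar (Hcomp f g)) (bar f) (idm _)
  | @Vcomp _ _ _ i _ _ f g =>
      biact (bracket f) (obar (Vcomp i f g)) (idm _) (idm _) +
      biact (bracket g) (obar (Vcomp i f g)) (idm _) (idm _)
  end.

Definition RFS n : natsys C := if n is k.+1 then RFSgen k else RFS0.

Definition delta1_gen (a : tgen 0) : RFS0 (obar (Gen (tval a))) :=
  let abar := bar (Gen (tval a)) in
  fgen (FactPair (w := obar (Gen (tval a))) abar (idm _) (cmpm1 _)) -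
  fgen (FactPair (w := obar (Gen (tval a))) (idm _) abar (cmp1m _)).

Definition delta_gen n (a : tgen n.+1) : RFSgen n (obar (Gen (tval a))) :=
  biact (bracket (att Src (tval a))) (obar (Gen (tval a))) (idm _) (idm _) -
  biact (bracket (att Tgt (tval a))) (obar (Gen (tval a))) (idm _) (idm _).

Definition delta n : nmor (RFS n.+1) (RFS n) :=
  match n return nmor (RFS n.+1) (RFS n) with
  | 0 => fam_nmor delta1_gen
  | k.+1 => fam_nmor (@delta_gen k)
  end.

Definition augmentation : nmor RFS0 (const_int C) :=
  @free_nmor C (pair_sys C) (const_int C) (fun _ _ => 1)
    (fun _ _ _ _ => erefl).
End Fox.

Definition exact_at (C : category) (D E G : natsys C)
    (f : nmor D E) (g : nmor E G) : Prop :=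
  forall (w : fact C) (b : E w), g w b = 0 <-> exists a : D w, f w a = b.

Definition epi (C : category) (D E : natsys C) (f : nmor D E) : Prop :=
  forall (w : fact C) (b : E w), exists a : D w, f w a = b.

(* Free resolution of D if n is infinite, free partial resolution of length n
   otherwise: the terms of degree greater than n then play no role. *)
Definition free_resolution (n : option nat) (C : category) (D : natsys C)
    (K : nat -> natsys C) (d : forall k, nmor (K k.+1) (K k))
    (eps : nmor (K 0%N) D) : Prop :=
  [/\ forall k, dim_le k n -> is_free (K k),
      epi eps,
      dim_le 1 n -> exact_at (d 0%N) eps &
      forall k, dim_le k.+2 n -> exact_at (d k.+1) (d k)].

Scheme valid_mind := Minimality for valid Sort Prop
  with eqc_mind := Minimality for eqc Sort Prop.
Combined Scheme valid_eqc_ind from valid_mind, eqc_mind.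

Section WellDefined.
Variables (N : option nat) (P : polygraph N).
Local Notation cell := (fcell (@gen P)).

(* Every iterated boundary of dimension 1 of [f] has class [c]. *)
Fixpoint one_bd n x y : cell n x y -> pres_hom x y -> Prop :=
  match n return cell n x y -> pres_hom x y -> Prop with
  | 0 => fun f c => pres_class f = c
  | k.+1 => fun f c => forall e, one_bd (bdS e f) c
  end.

Definition class1 n x y (f : cell n x y) := pres_class (src1 f).

Lemma one_bd_class1 n x y (f : cell n x y) c : one_bd f c -> class1 f = c.
Proof. elim: n f => [|k IH] f; [exact: id|move=> /(_ Src)/IH; exact: id]. Qed.

Lemma one_bd_hcomp n x y z (f : cell n x y) (g : cell n y z) c d :
  one_bd f c -> one_bd g d -> one_bd (Hcomp f g) (pres_cmp c d).
Proof.
elim: n f g => [|k IH] f g /=; first by move=> <- <-; rewrite pres_cmpE.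
move=> Hf Hg e; exact: (IH _ _ (Hf e) (Hg e)).
Qed.

Lemma one_bd_vcomp n i x y (f g : cell n.+1 x y) c :
  one_bd f c -> one_bd g c -> one_bd (Vcomp i f g) c.
Proof.
elim: n i f g => [|k IH] i f g Hf Hg e.
  by case: e; [apply: (Hf Src)|apply: (Hg Tgt)].
have Ef := Hf e; have Eg := Hg e.
rewrite /bdS /=; case: ifP => _; first exact: IH.
by case: e Ef Eg.
Qed.

Lemma one_bd_id n i e x y (f : cell n x y) c :
  one_bd f c -> one_bd (bd_id e i f) c.
Proof.
elim: n f => [|k IH] f //= Hf; case: ifP => // _ e'.
exact: IH (Hf e).
Qed.

Lemma one_bd_one n (x : pob P) : one_bd (one_iter n x) (pres_class (One x)).
Proof. by elim: n => [|k IH] //= e. Qed.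

Lemma one_bd_iter n e m x y (f : cell n x y) c :
  one_bd f c -> one_bd (bd_iter e m f) c.
Proof.
elim: m => [|m IH] //= /IH.
by case: (iter m predn n) (bd_iter e m f) => [|k] h //= /(_ e).
Qed.

Lemma class1_hcomp n x y z (f : cell n x y) (g : cell n y z) :
  class1 (Hcomp f g) = pres_cmp (class1 f) (class1 g).
Proof.
rewrite /class1 pres_cmpE; congr pres_class.
by elim: n f g => [|k IH] f g //=; rewrite -IH.
Qed.

Lemma class1_idc n x y (f : cell n x y) : class1 (Idc f) = class1 f.
Proof. by []. Qed.

Lemma class1_vcomp n i x y (f g : cell n.+1 x y) :
  class1 (Vcomp i f g) = class1 f.
Proof.
rewrite /class1 /=; congr pres_class; elim: n i f g => [|k IH] i f g //=.
by rewrite {2}/bdS /=; case: ifP => // _; rewrite -IH.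
Qed.

Fixpoint coherent n x y (f : cell n x y) : Prop :=
  match f with
  | @Gen _ _ _ _ _ a => one_bd (Gen a : cell _ _ _) (class1 (Gen a))
  | @One _ _ _ => True
  | @Idc _ _ _ _ _ f => coherent f
  | @Inv _ _ _ _ _ f => coherent f
  | @Hcomp _ _ _ _ _ _ f g => coherent f /\ coherent g
  | @Vcomp _ _ _ _ _ _ f g => [/\ coherent f, coherent g & class1 f = class1 g]
  end.

Lemma one_bd_inv n x y (f : cell n.+1 x y) c : one_bd f c -> one_bd (Inv f) c.
Proof. by move=> H e; apply: (H (flip e)). Qed.

Lemma coherent_one_bd n x y (f : cell n x y) :
  coherent f -> one_bd f (class1 f).
Proof.
elim: n x y / f => //=.
- by move=> n x y f IH /IH H e.
- move=> n x y f IH /IH H; have E : one_bd (Inv f) (class1 f) by apply: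
    one_bd_inv.
  by rewrite (one_bd_class1 E); apply: E.
- by move=> n x y z f IHf g IHg [/IHf Hf /IHg Hg]; rewrite class1_hcomp;
    apply: one_bd_hcomp.
- move=> n i x y f IHf g IHg [/IHf Hf /IHg Hg E].
  by rewrite class1_vcomp; apply: one_bd_vcomp => //; rewrite E.
Qed.

Lemma class1_inv n x y (f : cell n.+1 x y) :
  coherent f -> class1 (Inv f) = class1 f.
Proof. by move=> /coherent_one_bd/one_bd_inv/one_bd_class1. Qed.

Lemma class1_bd n e x y (f : cell n.+1 x y) :
  coherent f -> class1 (bdS e f) = class1 f.
Proof. by move=> /coherent_one_bd /(_ e)/one_bd_class1. Qed.

Lemma coherent_one n (x : pob P) : coherent (one_iter n x : cell n x x).
Proof. by elim: n. Qed.

Section Step.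
Variable n : nat.
Hypothesis gatt : forall k x y (a : @gen P k.+1 x y) e, (k < n)%N -> coherent
  (att e a).

Definition coherent_low m x y : low_cell m x y -> Prop :=
  match m with 0 => fun _ => True | k.+1 => fun f => coherent f end.

Lemma coherent_bd' e m x y (f : cell m x y) : (m <= n)%N -> coherent f ->
  coherent_low (bd e f).
Proof.
elim: m x y / f e.
- by case=> [|k] x y a e //= kn _; apply: gatt.
- by [].
- by [].
- by move=> m x y f IH e mn gf; apply: IH.
- move=> m x y z f IHf g IHg e mn /= [gf gg].
  have := IHf e mn gf; have := IHg e mn gg.
  by move: (bd e f) (bd e g); case: m {IHf IHg f g gf gg mn}.
- move=> m i x y f IHf g IHg e mn /= [gf gg E].
  have := IHf e mn gf; have := IHg e mn gg.
  have : class1 (bdS e f) = class1 (bdS e g) by rewrite !class1_bd.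
  rewrite /bdS; move: (bd e f) (bd e g); case: m {IHf IHg f g gf gg mn E} =>
    [|m] f g /= E; case: e => //=.
    by case: ifP.
  by case: ifP.
Qed.

Lemma coherent_bdS e m x y (f : cell m.+1 x y) : (m < n)%N -> coherent f ->
  coherent (bdS e f).
Proof. exact: coherent_bd'. Qed.

Lemma coherent_bd_id m i e x y (f : cell m x y) : (m <= n)%N -> coherent f ->
  coherent (bd_id e i f) /\ class1 (bd_id e i f) = class1 f.
Proof.
move=> mn gf; split; last exact: one_bd_class1 (one_bd_id _ _ (coherent_one_bd
  gf)).
elim: m f mn gf => [|k IH] f mn gf //=; case: ifP => // _.
by apply: IH; [exact: ltnW|exact: coherent_bdS].
Qed.
End Step.

Lemma coherent_main n :
  (forall m x y (f : cell m x y), valid f -> (m <= n)%N -> coherent f) /\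
  (forall m x y (f g : cell m x y), eqc f g -> (m <= n)%N ->
     [/\ coherent f, coherent g & class1 f = class1 g]).
Proof.
elim: n => [|n [IHv IHe]].
  have H x y (f : cell 0 x y) : coherent f.
    suff: forall n x y (h : cell n x y), n = 0%N -> coherent h by move/(_ 0%N);
      apply.
    move=> n x' y' h; elim: n x' y' / h => //.
    - by move=> [].
    - by move=> n x1 y1 z1 h1 IH1 h2 IH2 n0; split; auto.
  split; first by move=> [].
  by move=> [|//] x y f g fg _; split=> //; apply/pres_classP/cong2_eqc.
have gatt k x y (a : @gen P k.+1 x y) e : (k < n.+1)%N -> coherent (att e a).
  by case: (poly_att a) => vS vT _ kn; apply: (IHv) => //; case: e.
apply: valid_eqc_ind.
- move=> [|k] x y a //= kn e; rewrite /bdS /=.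
  have [vS vT par] := poly_att a.
  have H := coherent_one_bd (gatt _ _ _ a e kn).
  suff E : class1 (att Tgt a) = class1 (att Src a) by case: e H => //;
    rewrite E.
  case: k => [|k] in a kn vS vT par H *.
    by apply/esym/pres_classP/cong2_gen.
  rewrite -(class1_bd Src (gatt _ _ _ a Tgt kn)) -(class1_bd Src (gatt _ _ _ a
    Src kn)).
  by have [_ _ ->] := IHe _ _ _ _ _ (par Src) (ltnW kn).
- by [].
- by move=> m x y f _ IH mn; apply: IH; apply: ltnW.
- by move=> m x y f _ IH mn; apply: IH.
- by move=> m x y z f g _ IHf _ IHg mn; split; auto.
- move=> m i x y f g im _ IHf _ IHg _ IH mn.
  have gf := IHf mn; have gg := IHg mn; split=> //.
  have := IH; rewrite (one_bd_class1 (one_bd_iter _ _ (coherent_one_bd gf))).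
  rewrite (one_bd_class1 (one_bd_iter _ _ (coherent_one_bd gg))) => -[] //.
  apply: leq_trans mn; elim: (m.+1 - i)%N => //= k;
    exact: leq_trans (leq_pred _).
- by move=> m x y f _ IH mn; have := IH mn.
- by move=> m x y f g _ IH mn; have [? ? ->] := IH mn.
- by move=> m x y f g h _ IH _ IH' mn; have [? ? ->] := IH mn;
    have [? ? ->] := IH' mn.
- by move=> m x y f g _ IH mn; have [? ? ?] := IH (ltnW mn).
- by move=> m x y f g fg IH mn; have [gf gg E] := IH mn; rewrite !class1_inv.
- move=> m x y z f f' g g' _ IH _ IH' mn; have [? ? E] := IH mn.
  by have [? ? E'] := IH' mn; rewrite !class1_hcomp E E'.
- move=> m i x y f f' g g' _ IHv' _ IH _ IH' mn; have [? ? E] := IH mn.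
  have [? ? E'] := IH' mn; have /= [_ _ E2] := IHv' mn.
  by rewrite !class1_vcomp /=; split=> //; split=> //; rewrite -E -E'.
- move=> m x y z t f g h _ IH1 _ IH2 _ IH3 mn /=.
  have ? := IH1 mn; have ? := IH2 mn; have ? := IH3 mn; split=> //.
  by rewrite !class1_hcomp; apply: (@cmpA (pres P)).
- move=> m x y f _ IH mn /=; have ? := IH mn; split=> //.
    by split=> //; apply: coherent_one.
  by rewrite class1_hcomp (one_bd_class1 (one_bd_one m x));
    apply: (@cmp1m (pres P)).
- move=> m x y f _ IH mn /=; have ? := IH mn; split=> //.
    by split=> //; apply: coherent_one.
  by rewrite class1_hcomp (one_bd_class1 (one_bd_one m y));
    apply: (@cmpm1 (pres P)).
- move=> m i x y f g h _ IH mn; have /= := IH mn;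
    rewrite !class1_vcomp => -[[? ? E] ? E'].
  by rewrite -E'.
- move=> m i x y f im _ IH mn; have gf := IH mn.
  have [? E] := coherent_bd_id gatt i Src mn gf.
  by rewrite class1_vcomp /= E.
- move=> m i x y f im _ IH mn; have gf := IH mn.
  have [? E] := coherent_bd_id gatt i Tgt mn gf.
  by rewrite class1_vcomp /= E.
- move=> m i x y z f f' g g' _ IH1 _ IH2 mn.
  have /= [? ? E1] := IH1 mn; have /= [? ? E2] := IH2 mn.
  by split; rewrite /= ?class1_vcomp ?class1_hcomp ?class1_vcomp ?E1 ?E2.
- move=> m i j x y f f' g g' ij _ IH mn.
  have /= := IH mn; rewrite !class1_vcomp => -[[? ? E1] [? ? E2] E3].
  by split=> //=; rewrite ?class1_vcomp ?E1 ?E3 ?E2; split=> //;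
    rewrite -?E1 -?E2 -?E3.
- move=> m x y z f g _ IHf _ IHg mn /=.
  have ? := IHf (ltnW mn); have ? := IHg (ltnW mn); split=> //.
- by move=> m i x y f g _ IH mn; have /= [? ? E] := IH (ltnW mn); split=> //;
    rewrite ?class1_vcomp ?class1_idc ?class1_vcomp.
- move=> m x y f _ IH mn; have gf := IH mn;
    have gS := coherent_bdS gatt Src mn gf.
  by rewrite class1_vcomp /= class1_inv.
- move=> m x y f _ IH mn; have gf := IH mn;
    have gT := coherent_bdS gatt Tgt mn gf.
  rewrite class1_vcomp /= class1_inv //; split=> //.
  by rewrite -(class1_bd Tgt gf).
Qed.

Lemma valid_coherent n x y (f : cell n x y) : valid f -> coherent f.
Proof. by move=> vf; apply: (proj1 (coherent_main n)). Qed.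

Lemma eqc_coherent n x y (f g : cell n x y) :
  eqc f g -> [/\ coherent f, coherent g & class1 f = class1 g].
Proof. by move=> vf; apply: (proj2 (coherent_main n)). Qed.

Variables (C : category) (F : functor (pres P) C).

Lemma biactE (D : natsys C) (w : arrow C) (a : D w) (w' : arrow C) u v
  (E : u \; amap w \; v = amap w') :
  biact a w' u v = nact D (FactHom E : @hom (fact C) w w') a.
Proof.
rewrite /biact; case: pselect => // E'; congr (nact D _ a).
exact: fact_homP.
Qed.

Lemma biactD (D : natsys C) (w : arrow C) (a b : D w) (w' : arrow C) u v :
  biact (a + b) w' u v = biact a w' u v + biact b w' u v.
Proof. by rewrite /biact; case: pselect => E; rewrite ?raddfD ?addr0. Qed.

Lemma biactN (D : natsys C) (w : arrow C) (a : D w) (w' : arrow C) u v :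
  biact (- a) w' u v = - biact a w' u v.
Proof. by rewrite /biact; case: pselect => E; rewrite ?raddfN ?oppr0. Qed.

Lemma biact0 (D : natsys C) (w : arrow C) (w' : arrow C) u v :
  biact (0 : D w) w' u v = 0.
Proof. by rewrite /biact; case: pselect => E; rewrite ?raddf0. Qed.

Lemma biact_comp (D : natsys C) (w w' w'' : arrow C) (a : D w) u v u' v' :
  u \; amap w \; v = amap w' ->
  biact (biact a w' u v) w'' u' v' = biact a w'' (u' \; u) (v \; v').
Proof.
move=> E; rewrite (biactE a E) /biact.
case: pselect => E'; case: pselect => E2 //.
- rewrite -nactM; congr (nact D _ a); exact: fact_homP.
- by case: E2; rewrite -E' -E !cmpA.
- by case: E'; rewrite -E2 -E !cmpA.
Qed.

(* The bracket of [f], seen in the value of [RFSgen] at a 1-cell [w] which is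
   meant to be equal to [bar F f]. *)
Definition bracket_at n x y (f : cell n x y) (w : hom (F x) (F y)) : RFSgen F n
  (Arrow w) :=
  biact (bracket F f) (Arrow w) (idm _) (idm _).

Lemma bar_hcomp n x y z (f : cell n x y) (g : cell n y z) :
  bar F (Hcomp f g) = bar F f \; bar F g.
Proof. by rewrite /bar -!/(class1 _) class1_hcomp -fmapM. Qed.

Lemma bracket_hcomp n x y z (f : cell n x y) (g : cell n y z) w w' :
  bar F f = w -> bar F g = w' ->
  bracket_at (Hcomp f g) (w \; w') =
  biact (bracket_at f w) (Arrow (w \; w')) (idm _) w' +
  biact (bracket_at g w') (Arrow (w \; w')) w (idm _).
Proof.
move=> <- <-; rewrite /bracket_at /= biactD !biact_comp /= ?bar_hcomp ?cmp1m
  ?cmpm1 //.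
Qed.

Lemma bar_eqc n x y (f g : cell n x y) : eqc f g -> bar F f = bar F g.
Proof. by move=> /eqc_coherent [_ _ E]; rewrite /bar -!/(class1 _) E. Qed.

Lemma valid_bar_bd n e x y (f : cell n.+1 x y) :
  valid f -> bar F (bdS e f) = bar F f.
Proof. by move=> /valid_coherent vf; rewrite /bar -!/(class1 _) class1_bd. Qed.

Lemma valid_bar_vcomp n i x y (f g : cell n.+1 x y) :
  valid (Vcomp i f g) ->
  bar F f = bar F (Vcomp i f g) /\ bar F g = bar F (Vcomp i f g).
Proof.
move=> /valid_coherent [_ _ E].
by rewrite /bar -!/(class1 _) class1_vcomp E.
Qed.

Lemma bracket_vcomp n i x y (f g : cell n.+1 x y) w :
  bar F f = w -> bar F g = w ->
  bracket_at (Vcomp i f g) w = bracket_at f w + bracket_at g w.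
Proof.
move=> E1 E2; have E : bar F (Vcomp i f g) = w by rewrite /bar -/(class1 _)
  class1_vcomp.
by rewrite /bracket_at /= biactD !biact_comp /= ?cmp1m ?cmpm1 // ?E ?E1 ?E2 //;
  apply: etrans E1 (esym E).
Qed.

Lemma bracket_inv n x y (f : cell n.+1 x y) w :
  bar F f = w -> bar F (Inv f) = w -> bracket_at (Inv f) w = - bracket_at f w.
Proof.
by move=> E1 E; rewrite /bracket_at /= biactN !biact_comp /= ?cmp1m ?cmpm1 // E
  E1.
Qed.

Lemma bracket_idc n x y (f : cell n x y) w : bracket_at (Idc f) w = 0.
Proof. exact: biact0. Qed.

Lemma bracket_one n (x : pob P) w :
  bracket_at (one_iter n x : cell n x x) w = 0.
Proof. by case: n => [|n]; exact: biact0. Qed.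

Lemma bracket_eqc n x y (f g : cell n x y) :
  eqc f g -> forall w, bracket_at f w = bracket_at g w.
Proof.
have vb k (a b : pob P) (h : cell k a b) : valid h -> coherent h by exact:
  valid_coherent.
pose same k (a b : pob P) (h h' : cell k a b) :=
  forall w, bar F h = w -> bracket_at h w = bracket_at h' w.
suff H : eqc f g -> same _ _ _ f g.
  move=> fg w; case: (pselect (bar F f = w)) => [/(H fg)//|ne].
  rewrite /bracket_at /biact; case: pselect => E; first by case: ne; move: E;
    rewrite /= cmp1m cmpm1.
  by case: pselect => // E'; case: ne; rewrite (bar_eqc fg); move: E';
    rewrite /= cmp1m cmpm1.
have VB k (a b : pob P) i (f1 f2 : cell k.+1 a b) : coherent (Vcomp i f1 f2) ->
   bar F f1 = bar F f2 /\ bar F (Vcomp i f1 f2) = bar F f1.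
  by move=> [_ _ E]; rewrite /bar -!/(class1 _) class1_vcomp E.
have IB k (a b : pob P) (f1 : cell k.+1 a b) : coherent f1 -> bar F (Inv f1) =
  bar F f1.
  by move=> E; rewrite /bar -!/(class1 _) class1_inv.
move: n x y f g; apply: (@eqc_mind P (fun _ _ _ _ => True) same) => //.
- by move=> n x y f g fg IH w E; rewrite IH // (bar_eqc fg).
- by move=> n x y f g h fg IH _ IH' w E; rewrite IH // IH' // -(bar_eqc fg).
- by move=> n x y f g _ _ w _; rewrite !bracket_idc.
- move=> n x y f g fg IH w; have [gf gg _] := eqc_coherent fg;
    rewrite IB // => E.
  by rewrite !bracket_inv ?IB -?(bar_eqc fg) // IH.
- move=> n x y z f f' g g' ff IH gg IH' w; rewrite bar_hcomp => <-.
  by rewrite !bracket_hcomp -?(bar_eqc ff) -?(bar_eqc gg) // IH ?IH'.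
- move=> n i x y f f' g g' v _ ff IH gg IH' w.
  have [E E'] := VB _ _ _ _ _ _ (vb _ _ _ _ v).
  rewrite E' => Ew; rewrite !bracket_vcomp -?(bar_eqc ff) -?(bar_eqc gg) -?E //
    IH ?IH' //.
  by rewrite -E.
- move=> n x y z t f g h vf _ vg _ vh _ w; rewrite !bar_hcomp => <-.
  rewrite (bracket_hcomp (bar_hcomp f g)) // bracket_hcomp //.
  rewrite cmpA (bracket_hcomp (f := f) erefl (bar_hcomp g h)) (bracket_hcomp (f
    := g) erefl erefl).
  by rewrite !biactD !biact_comp /= ?cmp1m ?cmpm1 // addrA.
- move=> n x y f vf _ w; rewrite bar_hcomp => <-.
  have E : bar F (one_iter n x : cell n x x) = idm _.
    by rewrite /bar -/(class1 _) (one_bd_class1 (one_bd_one n x)) (fmap1 F).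
  rewrite E (bracket_hcomp E erefl) bracket_one biact0 add0r /bracket_at
    biact_comp /= ?cmp1m ?cmpm1 //.
- move=> n x y f vf _ w; rewrite bar_hcomp => <-.
  have E : bar F (one_iter n y : cell n y y) = idm _.
    by rewrite /bar -/(class1 _) (one_bd_class1 (one_bd_one n y)) (fmap1 F).
  rewrite E (bracket_hcomp erefl E) bracket_one biact0 addr0 /bracket_at
    biact_comp /= ?cmp1m ?cmpm1 //.
- move=> n i x y f g h v _ w; have [E1 E2] := VB _ _ _ _ _ _ (vb _ _ _ _ v).
  have gv : coherent (Vcomp i f g) by case: (vb _ _ _ _ v).
  have [E3 E4] := VB _ _ _ _ _ _ gv.
  rewrite E2 => Ew; have Ef : bar F f = w by rewrite -E4.
  have Eg : bar F g = w by rewrite -E3.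
  have Eh : bar F h = w by rewrite -E1.
  have Egh : bar F (Vcomp i g h) = w by rewrite -Eg /bar -!/(class1 _)
    class1_vcomp.
  by rewrite !bracket_vcomp // addrA.
- move=> n i x y f im vf _ w.
  have E : bar F (bd_id Src i f) = bar F f.
    by rewrite /bar -!/(class1 _) (one_bd_class1 (one_bd_id _ _
      (coherent_one_bd (vb _ _ _ _ vf)))).
  rewrite /bar -/(class1 _) class1_vcomp -/(bar _ _) E => Ew;
    rewrite bracket_vcomp ?E //.
  by rewrite /= ltnNge im bracket_idc add0r.
- move=> n i x y f im vf _ w.
  have E : bar F (bd_id Tgt i f) = bar F f.
    by rewrite /bar -!/(class1 _) (one_bd_class1 (one_bd_id _ _
      (coherent_one_bd (vb _ _ _ _ vf)))).
  rewrite /bar -/(class1 _) class1_vcomp -/(bar _ _) => Ew;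
    rewrite bracket_vcomp ?E //.
  by rewrite /= ltnNge im bracket_idc addr0.
- move=> n i x y z f f' g g' v1 _ v2 _ w.
  have [E1 E2] := VB _ _ _ _ _ _ (vb _ _ _ _ v1).
  have [E3 E4] := VB _ _ _ _ _ _ (vb _ _ _ _ v2).
  rewrite bar_hcomp E2 E4 => <-.
  rewrite (bracket_hcomp E2 E4) !bracket_vcomp ?bar_hcomp ?E1 ?E3 //
    !bracket_hcomp //.
  by rewrite !biactD addrACA.
- move=> n i j x y f f' g g' ij v _ w.
  have [E1 E2] := VB _ _ _ _ _ _ (vb _ _ _ _ v).
  have v1 : coherent (Vcomp j f f') by case: (vb _ _ _ _ v).
  have v2 : coherent (Vcomp j g g') by case: (vb _ _ _ _ v).
  have [E3 E4] := VB _ _ _ _ _ _ v1; have [E5 E6] := VB _ _ _ _ _ _ v2.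
  have VV k (h h' : cell n.+1 x y) : bar F (Vcomp k h h') = bar F h by rewrite
    /bar -!/(class1 _) class1_vcomp.
  rewrite E2 => Ew.
  have Ef : bar F f = w by rewrite -E4.
  have Ef' : bar F f' = w by rewrite -E3.
  have Eg : bar F g = w by rewrite -E6 -E1.
  have Eg' : bar F g' = w by rewrite -E5.
  by rewrite !bracket_vcomp ?VV // addrACA.
- move=> n x y z f g _ _ _ _ w.
  rewrite [bar _ _](bar_hcomp (Idc f) (Idc g)) => <-.
  by rewrite (bracket_hcomp (f := Idc f) erefl erefl) !bracket_idc !biact0
    addr0.
- move=> n i x y f g v _ w; have [E1 E2] := VB _ _ _ _ _ _ (vb _ _ _ _ v).
  rewrite [bar _ _]E2 => Ew; rewrite bracket_vcomp ?bracket_idc ?addr0 //.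
  by rewrite -Ew E1.
- move=> n x y f v _ w; rewrite /bar -/(class1 _) class1_vcomp => Ew.
  by rewrite bracket_vcomp ?bracket_inv ?IB ?bracket_idc ?subrr //; apply: vb.
- move=> n x y f v _ w; rewrite /bar -/(class1 _) class1_vcomp -/(bar _ _) IB
    => [Ew|]; last exact: vb.
  by rewrite bracket_vcomp ?bracket_inv ?IB ?bracket_idc ?addNr //; apply: vb.
Qed.

End WellDefined.

(* Main.v *)
(* Modulo the axioms, the cells of each dimension at least 2 form, under the two
   lowest compositions, a (2,1)-category over the free category: an Eckmann-Hilton
   argument expresses every higher composition of [f] and [g] by the composition
   [f m^- g] along 1-cells, [m] being their common boundary.

   Acyclicity provides a left-to-right normalisation of 1-cells by 2-cells,
   defined by recursion on words, and conjugation by it turns a cell [f] acted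
   upon by a normal form [u] into a loop [base u f] based at a normal form.
   In dimension 2, acyclicity provides 3-cells [theta] contracting [base u f],
   again by recursion on [f]; the Peiffer identity makes them compatible with
   horizontal composition. Conjugating the loops of dimension at least 3 by
   [theta] makes their boundary of dimension 2 trivial. Such flat loops commute,
   and the class of a cell among them is additive in the sense of the bracket, so
   that it factors through the free natural system on the generators as a map
   [phi]. It is a chain map, and the bracket of [phi b] is [b] when [b] is a
   cycle; [phi b] is then filled by acyclicity, and the bracket of a filler is a
   chain with boundary [b]. In degrees 0, 1 and 2, the chosen 1-cells, 2-cells and
   3-cells play this role directly. *)

From HB Require Import structures.
From Stdlib Require Import Eqdep_dec.
From mathcomp Require Import all_boot all_algebra boolp.
From mathcomp Require Import freeg.
Require Import Defs.

Set Implicit Arguments.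
Unset Strict Implicit.
Unset Printing Implicit Defensive.

Local Open Scope cat_scope.

(** * Boundaries of formal cells *)

(** A basis element [u[a]v] over [w] remembers only classes of 1-cells, so the summands of a chain
    share no boundary and cannot be composed. Loops at the single 1-cell [hat w] can: under
    composition along 1-cells they form a group in every dimension, and sources, targets and
    identities are group morphisms. A chain thus becomes one loop, which acyclicity can fill. For
    this loop to depend additively on the chain, the chosen contractions must respect composition
    strictly, not up to higher cells. A recursion on formal cells gives this by definition and moves
    the difficulty to invariance under the axioms. For 1-cells only associativity and units are at
    stake. For 2-cells the exchange law is the one axiom that does not follow from group and action
    laws. No compatible choice is made above dimension 3: there flat loops commute, and their right
    action depends only on the class of the acting 1-cell. This stops what would otherwise be an
    infinite tower of coherences. *)

Section Syntax.
Variables (N : option nat) (P : polygraph N).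
Local Notation cell := (fcell (@gen P)).

(* [f] and [g] are composable along their boundaries of dimension [i + 1]. *)
Fixpoint composable i n x y : cell n x y -> cell n x y -> Prop :=
  match n with
  | 0 => fun _ _ => True
  | k.+1 => fun f g =>
      if i == k then eqc (bdS Tgt f) (bdS Src g)
      else composable i (bdS Tgt f) (bdS Src g)
  end.

Arguments composable i [n x y] f g : simpl never.

Lemma composableS i n x y (f g : cell n.+1 x y) :
  composable i f g = if i == n then eqc (bdS Tgt f) (bdS Src g)
                     else composable i (bdS Tgt f) (bdS Src g).
Proof. by []. Qed.

Lemma bdS_vcomp e i n x y (f g : cell n.+2 x y) :
  bdS e (Vcomp i f g) = if (i <= n)%N then Vcomp i (bdS e f) (bdS e g)
                        else if e is Src then bdS e f else bdS e g.
Proof. by []. Qed.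

Lemma bdS_hcomp e n x y z (f : cell n.+1 x y) (g : cell n.+1 y z) :
  bdS e (Hcomp f g) = Hcomp (bdS e f) (bdS e g).
Proof. by []. Qed.

Lemma bdS_idc e n x y (f : cell n x y) : bdS e (Idc f) = f.
Proof. by []. Qed.

Local Notation pk f := (existT (fun k => cell k _ _) _ f).

(** [bd_iter] takes the last boundary outermost, while recursions on cells need the first one
    innermost. The two sides live over [iter m.+1 predn n.+1] and [iter m predn n], which are not
    convertible for a variable [m]; hence the dependent pairs. *)
Lemma bd_iterS e m n x y (f : cell n.+1 x y) :
  pk (bd_iter e m.+1 f) = pk (bd_iter e m (bdS e f)).
Proof.
elim: m => [|m IH] //.
pose G (p : {k & cell k x y}) := let: existT k f := p in
  existT (fun k => cell k x y) (predn k)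
    (match k as k return cell k x y -> cell k.-1 x y with
    | 0 => id | k.+1 => @bdS P e k x y end f).
by rewrite -[LHS]/(G (pk (bd_iter e m.+1 f))) IH.
Qed.

Definition eqc_pk x y (p q : {k & cell k x y}) : Prop :=
  exists k f g, [/\ p = existT _ k f, q = existT _ k g & eqc f g].

Lemma eqc_pkP n x y (f g : cell n x y) : eqc_pk (pk f) (pk g) <-> eqc f g.
Proof.
split=> [[k [f' [g' [E E' fg]]]]|fg]; last by exists n, f, g.
have En := congr1 (@projT1 _ _) E; simpl in En; subst k.
have inj := inj_pair2_eq_dec _ (@eq_comparable nat).
by rewrite (inj _ _ _ _ E) (inj _ _ _ _ E').
Qed.

Lemma composableP i n x y (f g : cell n.+1 x y) : (i <= n)%N ->
  eqc (bd_iter Tgt (n.+1 - i) f) (bd_iter Src (n.+1 - i) g) <-> composable i f g.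
Proof.
elim: n f g => [|n IH] f g; first by rewrite leqn0 => /eqP ->.
rewrite leq_eqVlt => /orP[/eqP->|lt_in].
  by rewrite subSnn composableS eqxx.
have -> : composable i f g = composable i (bdS Tgt f) (bdS Src g).
  by rewrite composableS (ltn_eqF lt_in).
rewrite -IH // subSn; last exact: ltnW.
by rewrite -!eqc_pkP !bd_iterS.
Qed.

Lemma composable_vcompl i n x y (f g h : cell n.+1 x y) : (i <= n)%N ->
  composable i (Vcomp i f g) h = composable i g h.
Proof.
elim: n f g h => [|n IH] f g h; first by rewrite leqn0 => /eqP ->.
rewrite !(composableS _ _ h) bdS_vcomp leq_eqVlt => /orP[/eqP->|lt_in].
  by rewrite eqxx ltnn.
by rewrite (ltn_eqF lt_in) -ltnS lt_in; apply: IH.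
Qed.

Lemma composable_vcompr i n x y (f g h : cell n.+1 x y) : (i <= n)%N ->
  composable i f (Vcomp i g h) = composable i f g.
Proof.
elim: n f g h => [|n IH] f g h; first by rewrite leqn0 => /eqP ->.
rewrite !(composableS _ f) bdS_vcomp leq_eqVlt => /orP[/eqP->|lt_in].
  by rewrite eqxx ltnn.
by rewrite (ltn_eqF lt_in) -ltnS lt_in; apply: IH.
Qed.

(** Inversion of [valid] by a match on the cell: inverting this indexed family directly would
    produce equalities of dependent pairs over objects without decidable equality. *)
Definition valid_parts n x y (f : cell n x y) : Prop :=
  match f with
  | @Idc _ _ _ _ _ f => valid f
  | @Inv _ _ _ _ _ f => valid f
  | @Hcomp _ _ _ _ _ _ f g => valid f /\ valid g
  | @Vcomp _ _ n i _ _ f g =>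
      [/\ (i <= n)%N, valid f, valid g & composable i f g]
  | _ => True
  end.

Lemma validE n x y (f : cell n x y) : valid f -> valid_parts f.
Proof. by case=> // m i ? ? ? ? im ? ? /composableP; split=> //; tauto. Qed.

Lemma valid_vcompP n i x y (f g : cell n.+1 x y) :
  valid (Vcomp i f g) <-> [/\ (i <= n)%N, valid f, valid g & composable i f g].
Proof.
by split=> [/validE//|[im vf vg c]]; apply: valid_vcomp => //;
  apply/composableP.
Qed.

Lemma valid_one_iter n (x : pob P) : valid (one_iter n x : cell n x x).
Proof. by elim: n => [|n IH]; [exact: valid_one|exact: valid_idc]. Qed.

Lemma parallel_sym n x y (f g : cell n x y) : parallel f g -> parallel g f.
Proof. by case: n f g => //= n f g fg e; apply/eqc_sym. Qed.

Lemma parallel_trans n x y (f g h : cell n x y) :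
  parallel f g -> parallel g h -> parallel f h.
Proof. by case: n f g h => //= n f g h fg gh e; apply: eqc_trans (gh e). Qed.

Definition sphere_bd n x y : cell n x y -> Prop :=
  match n with
  | 0 => fun _ => True
  | k.+1 => fun f => is_sphere (bdS Src f) (bdS Tgt f)
  end.

Lemma valid_bd_sphere n e x y (f : cell n.+1 x y) :
  sphere_bd f -> valid (bdS e f).
Proof. by case=> vs vt _; case: e. Qed.

Lemma parallel_refl n x y (f : cell n x y) : sphere_bd f -> parallel f f.
Proof. by case: n f => //= n f sf e; apply/eqc_refl/valid_bd_sphere. Qed.

Lemma hcomp_parallel n x y z (f f' : cell n x y) (g g' : cell n y z) :
  parallel f f' -> parallel g g' -> parallel (Hcomp f g) (Hcomp f' g').
Proof. by case: n f f' g g' => //= n f f' g g' ff gg e;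
  exact: (eqc_hcomp (ff e) (gg e)). Qed.

Lemma composable_hcomp i n x y z (f f' : cell n x y) (g g' : cell n y z) :
  composable i f f' -> composable i g g' ->
  composable i (Hcomp f g) (Hcomp f' g').
Proof.
elim: n f f' g g' => // n IH f f' g g'; rewrite !composableS.
case: ifP => _; last exact: IH.
exact: eqc_hcomp.
Qed.

(** * Spherical boundaries and compatibility of [eqc], one dimension at a time *)

Section Step.
Variable n : nat.
Hypothesis IHv : forall m x y (f : cell m x y), (m <= n)%N -> valid f ->
  sphere_bd f.
Hypothesis IHe : forall m x y (f g : cell m x y), (m <= n)%N -> eqc f g ->
  [/\ valid f, valid g & parallel f g].

Lemma composable_parallel_le i m x y (f f' g g' : cell m x y) : (m <= n.+1)%N ->
  parallel f f' -> parallel g g' -> composable i f g -> composable i f' g'.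
Proof.
elim: m f f' g g' => [|m IH] f f' g g' // mn ff gg; rewrite !composableS.
case: eqP => _ => [fg|].
  exact: eqc_trans (eqc_trans (eqc_sym (ff Tgt)) fg) (gg Src).
apply: IH (ltnW mn) _ _.
- by case: (IHe (mn : (m <= n)%N) (ff Tgt)).
- by case: (IHe (mn : (m <= n)%N) (gg Src)).
Qed.

Lemma bd_parallel_le e e' m x y (f : cell m.+1 x y) : (m <= n)%N ->
  sphere_bd f -> parallel (bdS e f) (bdS e' f).
Proof.
move=> mn sf; have p e1 := parallel_refl (IHv mn (valid_bd_sphere e1 sf)).
case: sf => _ _ q; case: e; case: e' => //; exact: parallel_sym.
Qed.

(** By globularity the boundaries of a cell below the top ones are the same computed from its source
    or from its target, so composability along them may be tested on any choice of top
    boundaries. *)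
Lemma composable_bd_le i e e' m x y (f g : cell m.+1 x y) :
  (m <= n)%N -> (i < m)%N -> sphere_bd f -> sphere_bd g ->
  composable i f g <-> composable i (bdS e f) (bdS e' g).
Proof.
move=> mn im sf sg; rewrite composableS (ltn_eqF im).
by split; apply: (composable_parallel_le (leqW mn)); apply: bd_parallel_le.
Qed.

Lemma vcomp_parallel_le i m x y (f f' g g' : cell m.+1 x y) :
  (m <= n)%N -> sphere_bd f -> sphere_bd g -> valid (Vcomp i f g) ->
  parallel f f' -> parallel g g' -> parallel (Vcomp i f g) (Vcomp i f' g').
Proof.
move=> mn sf sg v ff gg e; have [im vf vg c] := validE v.
have := ff e; have := gg e.
case: m => [|k] in f f' g g' mn sf sg v ff gg im vf vg c *; first by case: e.
rewrite !bdS_vcomp; case: (leqP i k) => ik; last by case: e.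
move=> gg' ff'; apply: eqc_vcomp => //.
apply/valid_vcompP; split=> //; first exact: (valid_bd_sphere e sf).
  exact: (valid_bd_sphere e sg).
by apply/(composable_bd_le e e mn ik sf sg).
Qed.

Lemma vcomp_sphere_le i m x y (f g : cell m.+1 x y) :
  (m <= n)%N -> sphere_bd f -> sphere_bd g -> valid (Vcomp i f g) ->
  sphere_bd (Vcomp i f g).
Proof.
move=> mn sf sg v; have [im vf vg c] := validE v.
have [[vsf vtf pf] [vsg vtg pg]] := (sf, sg).
case: m => [|k] in f g mn sf sg v im vf vg c vsf vtf pf vsg vtg pg *.
  by split.
rewrite /sphere_bd !bdS_vcomp; case: (leqP i k) => ik; last first.
  have ek : i = k.+1 by apply/eqP; rewrite eqn_leq im.
  move: c; rewrite composableS ek eqxx => c; split=> //.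
  apply: parallel_trans pf _; apply: parallel_trans pg.
  by case: (IHe mn c).
have vv e : valid (Vcomp i (bdS e f) (bdS e g)).
  apply/valid_vcompP; split=> //;
    [exact: valid_bd_sphere|exact: valid_bd_sphere|].
  by apply/(composable_bd_le e e mn ik sf sg).
split; [exact: vv|exact: vv|].
by apply: vcomp_parallel_le pf pg;
  [exact: ltnW|exact: IHv|exact: IHv|exact: vv].
Qed.

Lemma eqc_bd_id_le e i m x y (f g : cell m x y) : (m <= n)%N -> eqc f g ->
  eqc (bd_id e i f) (bd_id e i g).
Proof.
elim: m f g => //= m IH f g mn fg; case: ifP => // _; apply/eqc_idc.
by apply: IH (ltnW mn) _; case: (IHe mn fg).
Qed.

Lemma valid_bd_id_le e i m x y (f : cell m x y) : (m <= n.+1)%N ->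
  valid f -> sphere_bd f -> valid (bd_id e i f).
Proof.
elim: m f => //= m IH f mn vf sf; case: ifP => // _; apply/valid_idc.
have vb := valid_bd_sphere (f := f) e sf.
exact: (IH (bdS e f) (ltnW mn) vb (IHv (mn : (m <= n)%N) vb)).
Qed.

Lemma bd_id_low e i m x y (f : cell m x y) : (m <= i)%N -> bd_id e i f = f.
Proof. by case: m f => //= m f ->. Qed.

Lemma bd_id_high e i m x y (f : cell m.+1 x y) : (i <= m)%N ->
  bd_id e i f = Idc (bd_id e i (bdS e f)).
Proof. by rewrite leqNgt => /negbTE /= ->. Qed.

Lemma composable_bd_idl_le i m x y (f : cell m.+1 x y) : (m <= n)%N ->
  (i <= m)%N -> sphere_bd f -> composable i (bd_id Src i f) f.
Proof.
elim: m f => [|m IH] f mn im sf.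
  move: im; rewrite leqn0 => /eqP ->; apply: eqc_refl.
  by case: sf.
have vb : valid (bdS Src f) by case: sf.
rewrite bd_id_high // composableS bdS_idc.
move: im; rewrite leq_eqVlt => /orP[/eqP->|im].
  by rewrite eqxx bd_id_low //; apply: eqc_refl.
by rewrite (ltn_eqF im); apply: IH; rewrite ?(ltnW mn) //; apply: IHv.
Qed.

Lemma composable_bd_idr_le i m x y (f : cell m.+1 x y) : (m <= n)%N ->
  (i <= m)%N -> sphere_bd f -> composable i f (bd_id Tgt i f).
Proof.
elim: m f => [|m IH] f mn im sf.
  move: im; rewrite leqn0 => /eqP ->; apply: eqc_refl.
  by case: sf.
have vb : valid (bdS Tgt f) by case: sf.
rewrite bd_id_high // composableS bdS_idc.
move: im; rewrite leq_eqVlt => /orP[/eqP->|im].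
  by rewrite eqxx bd_id_low //; apply: eqc_refl.
by rewrite (ltn_eqF im); apply: IH; rewrite ?(ltnW mn) //; apply: IHv.
Qed.

(** As [i < j], the boundaries of a [j]-composite that matter along [i] are, up to [eqc], those of
    either factor. This and the next lemma make both sides of the exchange law composable
    together. *)
Lemma composable_vv1_le i j m x y (f f' g g' : cell m.+1 x y) :
  (m <= n)%N -> (i < j <= m)%N ->
  sphere_bd f -> sphere_bd f' -> sphere_bd g -> sphere_bd g' ->
  composable j f f' -> composable j g g' ->
  composable i (Vcomp j f f') (Vcomp j g g') ->
  composable i f g /\ composable i f' g'.
Proof.
elim: m f f' g g' => [|m IH] f f' g g' mn.
  by case/andP=> ij; rewrite leqn0 => /eqP ej; rewrite ej in ij.
case/andP=> ij; rewrite leq_eqVlt => /orP[/eqP ej|jm] sf sf' sg sg'.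
  rewrite !composableS !bdS_vcomp ej eqxx ltnn => cf cg.
  have im : (i < m.+1)%N by rewrite -ej.
  have [_ _ pf] := IHe mn cf; have [_ _ pg] := IHe mn cg.
  rewrite (ltn_eqF im) => c; split.
    apply: (composable_parallel_le (leqW mn) _ _ c).
      apply: parallel_trans (parallel_sym pf).
      exact: (bd_parallel_le _ _ mn sf').
    exact: (bd_parallel_le _ _ mn sg).
  apply: (composable_parallel_le (leqW mn) _ _ c).
    exact: (bd_parallel_le _ _ mn sf').
  apply: parallel_trans pg; exact: (bd_parallel_le _ _ mn sg).
move=> cf cg; have im := ltn_trans ij jm.
have IHs e (h : cell m.+2 x y) : sphere_bd h -> sphere_bd (bdS e h).
  by move=> sh; apply: IHv => //; apply: valid_bd_sphere.
rewrite !(composableS i) (ltn_eqF im) !bdS_vcomp -ltnS jm.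
apply: IH; rewrite ?(ltnW mn) ?ij //; do ?exact: IHs.
  by apply/(composable_bd_le Tgt Tgt mn jm).
by apply/(composable_bd_le Src Src mn jm).
Qed.

Lemma composable_vv2_le i j m x y (f f' g g' : cell m.+1 x y) :
  (m <= n)%N -> (i < j <= m)%N ->
  sphere_bd f -> sphere_bd f' -> sphere_bd g -> sphere_bd g' ->
  composable j f f' -> composable j g g' ->
  composable i f g -> composable i f' g' ->
  valid f -> valid g ->
  composable j (Vcomp i f g) (Vcomp i f' g').
Proof.
elim: m f f' g g' => [|m IH] f f' g g' mn.
  by case/andP=> ij; rewrite leqn0 => /eqP ej; rewrite ej in ij.
case/andP=> ij jm1 sf sf' sg sg' cf cg c c' vf vg.
have im : (i < m.+1)%N by apply: leq_trans jm1.
have cb e (h h' : cell m.+2 x y) : sphere_bd h -> sphere_bd h' ->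
    composable i h h' -> composable i (bdS e h) (bdS e h').
  by move=> sh sh' ?; apply/(composable_bd_le e e mn im).
have IHs e (h : cell m.+2 x y) : sphere_bd h -> sphere_bd (bdS e h).
  by move=> sh; apply: IHv => //; apply: valid_bd_sphere.
rewrite composableS !bdS_vcomp -ltnS im.
move: jm1; rewrite leq_eqVlt => /orP[/eqP ej|jm].
  move: cf cg; rewrite !composableS ej eqxx => cf cg; apply: eqc_vcomp => //.
  apply/valid_vcompP; split=> //; first exact: (valid_bd_sphere Tgt sf).
    exact: (valid_bd_sphere Tgt sg).
  exact: cb.
move: cf cg; rewrite !(composableS j) (ltn_eqF jm) => cf cg.
apply: IH; rewrite ?(ltnW mn) ?ij //;
  do ?[exact: IHs|exact: cb|exact: valid_bd_sphere].
Qed.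

Lemma valid_sphere_bd_le m x y (f : cell m x y) :
  (m <= n.+1)%N -> valid f -> sphere_bd f.
Proof.
move=> + vf; elim: m x y / f vf.
- by move=> [|k] x y a // _ _; apply: poly_att.
- by [].
- move=> m x y f _ /validE vf mn; split=> //.
  by apply/parallel_refl/IHv.
- move=> m x y f IH /validE vf mn; have [? ? /parallel_sym] := IH vf mn.
  by split.
- move=> m x y z f IHf g IHg /validE[vf vg] mn;
  case: m => // m in f g IHf IHg vf vg mn *.
  have [? ? ?] := IHf vf mn; have [? ? ?] := IHg vg mn.
  by split; [exact: valid_hcomp|exact: valid_hcomp|exact: hcomp_parallel].
- move=> m i x y f IHf g IHg v mn; have [_ vf vg _] := validE v.
  by apply: vcomp_sphere_le => //; [apply: IHf|apply: IHg].
Qed.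

End Step.

(** The two halves need a simultaneous induction: validity of a composite rests on [eqc] between
    lower boundaries, and an axiom of [eqc] passes to boundaries only when these are valid. *)
Lemma eqc_main n :
  (forall m x y (f : cell m x y), (m <= n)%N -> valid f -> sphere_bd f) /\
  (forall m x y (f g : cell m x y), (m <= n)%N -> eqc f g ->
    [/\ valid f, valid g & parallel f g]).
Proof.
elim: n => [|n [IHv IHe]].
  by split=> [[]|[] // x y f g _ _]; split=> //; apply: valid1.
have sph m x y (f : cell m x y) := valid_sphere_bd_le IHv IHe (f := f).
split=> // m x y f g + fg; move: m x y f g fg.
have ir m x y (f : cell m.+1 x y) e : (m <= n)%N -> valid f ->
    eqc (bdS e f) (bdS e f).
  by move=> mn vf; apply/eqc_refl/valid_bd_sphere/sph.
(* Boundaries of valid cells in this dimension are already settled by [sph], so the predicate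
   attached to [valid] can be trivial. *)
apply: (@eqc_mind P (fun _ _ _ _ => True)) => //.
- by move=> m x y f vf _ mn; split=> //; apply/parallel_refl/sph.
- by move=> m x y f g _ IH mn; have [? ? /parallel_sym] := IH mn; split.
- move=> m x y f g h _ IH _ IH' mn; have [? _ p] := IH mn.
  by have [_ ? p'] := IH' mn; split=> //; apply: parallel_trans p'.
- move=> m x y f g fg IH mn; have [? ? ?] := IH (ltnW mn).
  by split; [exact: valid_idc|exact: valid_idc|].
- move=> m x y f g fg IH mn; have [? ? p] := IH mn.
  by split; [exact: valid_inv|exact: valid_inv|move=> e; exact: (p (flip e))].
- move=> m x y z f f' g g' _ IH _ IH' mn; have [? ? ?] := IH mn.
  have [? ? ?] := IH' mn.
  by split; [exact: valid_hcomp|exact: valid_hcomp|exact: hcomp_parallel].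
- move=> m i x y f f' g g' v _ ff IH gg IH' mn; have [vf vf' p] := IH mn.
  have [vg vg' p'] := IH' mn; have [im _ _ c] := validE v; split=> //.
    apply/valid_vcompP; split=> //.
    by apply: (composable_parallel_le IHe mn) p p' c.
  by apply: (vcomp_parallel_le IHv IHe mn _ _ v p p'); apply: sph.
- move=> m x y z t f g h vf _ vg _ vh _ mn.
  have vl := valid_hcomp (valid_hcomp vf vg) vh.
  have vr := valid_hcomp vf (valid_hcomp vg vh); split=> //.
  case: m => [//|m] in f g h vf vg vh mn vl vr * => e.
  by apply: eqc_hcompA; apply/valid_bd_sphere/sph.
- move=> m x y f vf _ mn; split=> //.
    by apply: valid_hcomp => //; apply: valid_one_iter.
  case: m => [//|m] in f vf mn * => e.
  by apply: eqc_hcomp1l; apply/valid_bd_sphere/sph.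
- move=> m x y f vf _ mn; split=> //.
    by apply: valid_hcomp => //; apply: valid_one_iter.
  case: m => [//|m] in f vf mn * => e.
  by apply: eqc_hcomp1r; apply/valid_bd_sphere/sph.
- move=> m i x y f g h v _ mn; have sv := sph _ _ _ _ mn v.
  have [im /validE[_ vf vg cfg] vh] := validE v.
  rewrite composable_vcompl // => cgh.
  have vr : valid (Vcomp i f (Vcomp i g h)).
    apply/valid_vcompP; rewrite composable_vcompr //; split=> //.
    exact/valid_vcompP.
  split=> // e; have := valid_bd_sphere e sv; have := ir _ _ _ _ e mn v.
  case: m => [|m] in f g h {v sv vf vg vh cfg cgh vr} mn im *; first by case: e.
  rewrite !bdS_vcomp; case: leqP => im'; last by case: e.
  by move=> _; apply: eqc_vcompA.
- move=> m i x y f im vf _ mn; have sf := sph _ _ _ _ mn vf.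
  have vi e := valid_bd_id_le IHv e i mn vf sf.
  have v : valid (Vcomp i (bd_id Src i f) f).
    by apply/valid_vcompP; split=> //; apply: (composable_bd_idl_le IHv).
  split=> // e; have v' := v; rewrite bd_id_high // in v v' *.
  case: m => [|m] in f im vf mn sf v v' vi *; first by case: e; apply: ir.
  have vb e' : valid (bdS e' f) := valid_bd_sphere e' sf.
  have := valid_bd_sphere e (sph _ _ _ _ mn v').
  rewrite bdS_vcomp; case: leqP => im' vv; last first.
    by case: e vv; rewrite ?bdS_idc ?bd_id_low // => vv; apply: ir.
  rewrite bdS_idc in vv *.
  apply: eqc_trans (eqc_vcomp1l im' (vb e)).
  apply: eqc_vcomp => //; last exact: ir.
  rewrite !bd_id_high //; apply/eqc_idc/(eqc_bd_id_le IHe); first exact: ltnW.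
  exact: (bd_parallel_le IHv Src e (mn : (m < n)%N) sf Src).
- move=> m i x y f im vf _ mn; have sf := sph _ _ _ _ mn vf.
  have vi e := valid_bd_id_le IHv e i mn vf sf.
  have v : valid (Vcomp i f (bd_id Tgt i f)).
    by apply/valid_vcompP; split=> //; apply: (composable_bd_idr_le IHv).
  split=> // e; have v' := v; rewrite bd_id_high // in v v' *.
  case: m => [|m] in f im vf mn sf v v' vi *; first by case: e; apply: ir.
  have vb e' : valid (bdS e' f) := valid_bd_sphere e' sf.
  have := valid_bd_sphere e (sph _ _ _ _ mn v').
  rewrite bdS_vcomp; case: leqP => im' vv; last first.
    by case: e vv; rewrite ?bdS_idc ?bd_id_low // => vv; apply: ir.
  rewrite bdS_idc in vv *.
  apply: eqc_trans (eqc_vcomp1r im' (vb e)).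
  apply: eqc_vcomp => //; first exact: ir.
  rewrite !bd_id_high //; apply/eqc_idc/(eqc_bd_id_le IHe); first exact: ltnW.
  exact: (bd_parallel_le IHv Tgt e (mn : (m < n)%N) sf Tgt).
- move=> m i x y z f f' g g' vF _ vG _ mn.
  have [im vf vf' c] := validE vF; have [_ vg vg' c'] := validE vG.
  have v1 := valid_hcomp vF vG.
  have v2 : valid (Vcomp i (Hcomp f g) (Hcomp f' g')).
    apply/valid_vcompP; split=> //;
      [exact: valid_hcomp|exact: valid_hcomp|exact: composable_hcomp].
  split=> // e; have := ir _ _ _ _ e mn v2.
  have := valid_bd_sphere e (sph _ _ _ _ mn vF).
  have := valid_bd_sphere e (sph _ _ _ _ mn vG).
  case: m => [|m] in f f' g g' {vF vG vf vf' c vg vg' c' v1 v2} mn im *;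
    first by case: e.
  rewrite bdS_hcomp !bdS_vcomp; case: leqP => im'; last by case: e.
  by move=> *; apply: eqc_hv.
- move=> m i j x y f f' g g' ij v _ mn.
  have [im vF vG c] := validE v.
  have [jm vf vf' cf] := validE vF; have [_ vg vg' cg] := validE vG.
  have ijm : (i < j <= m)%N by rewrite ij.
  have sp h (vh : valid h) := sph m.+1 x y h mn vh.
  have [c1 c2] := composable_vv1_le IHv IHe mn ijm (sp _ vf) (sp _ vf') (sp _ vg)
    (sp _ vg') cf cg c.
  have v2 : valid (Vcomp j (Vcomp i f g) (Vcomp i f' g')).
    apply/valid_vcompP; split=> //; do ?exact/valid_vcompP.
    by apply: (composable_vv2_le IHv IHe mn) => //; apply: sp.
  split=> // e; have := ir _ _ _ _ e mn v2; have := valid_bd_sphere e (sp _ v).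
  case: m => [|m] in f f' g g' {v vF vG c vf vf' vg vg' cf cg c1 c2 v2 sp} mn ij im jm ijm *.
    by move: ij jm; case: (j).
  have im' : (i <= m)%N by rewrite -ltnS (leq_trans ij).
  by rewrite !bdS_vcomp im'; case: leqP => jm';
    [move=> *; apply: eqc_vv|case: e].
- move=> m x y z f g vf _ vg _ mn; split.
  + exact/valid_idc/valid_hcomp.
  + by apply: valid_hcomp; apply: valid_idc.
  + by move=> e; apply/eqc_refl/valid_hcomp.
- move=> m i x y f g v _ mn; have [im vf vg c] := validE v.
  have v2 : valid (Vcomp i (Idc f) (Idc g)).
    apply/valid_vcompP; split; rewrite ?(leqW im) //; do ?exact: valid_idc.
    by rewrite composableS (ltn_eqF (im : (i < m.+1)%N)).
  split; [exact: valid_idc|by []|] => e.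
  by rewrite bdS_vcomp im; apply: eqc_refl.
- move=> m x y f vf _ mn; have sf := sph _ _ _ _ mn vf.
  have vb e' : valid (bdS e' f) := valid_bd_sphere e' sf.
  split; [|exact: valid_idc|].
    apply/valid_vcompP; split=> //; first exact: valid_inv.
    by rewrite composableS eqxx; apply: ir.
  have b := ir _ _ _ f Src mn vf.
  move=> e; case: m => [|m] in f vf mn sf vb b *; first by case: e; exact: b.
  by rewrite bdS_vcomp ltnn; case: e; exact: b.
- move=> m x y f vf _ mn; have sf := sph _ _ _ _ mn vf.
  have vb e' : valid (bdS e' f) := valid_bd_sphere e' sf.
  split; [|exact: valid_idc|].
    apply/valid_vcompP; split=> //; first exact: valid_inv.
    by rewrite composableS eqxx; exact: (ir _ _ _ f Src mn vf).
  have b := ir _ _ _ f Tgt mn vf.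
  move=> e; case: m => [|m] in f vf mn sf vb b *; first by case: e; exact: b.
  by rewrite bdS_vcomp ltnn; case: e; exact: b.
Qed.

Lemma valid_sphere_bd n x y (f : cell n x y) : valid f -> sphere_bd f.
Proof. exact: (proj1 (eqc_main n)). Qed.

Lemma eqc_sphere n x y (f g : cell n x y) : eqc f g -> is_sphere f g.
Proof. exact: (proj2 (eqc_main n)). Qed.

End Syntax.

(** * Cells modulo the axioms *)

Section Quotient.
Variables (N : option nat) (P : polygraph N).
Local Notation cell := (fcell (@gen P)).

Lemma valid_bdS e n x y (f : cell n.+1 x y) : valid f -> valid (bdS e f).
Proof. by move/valid_sphere_bd/(valid_bd_sphere e). Qed.

Lemma eqc_bdS e n x y (f g : cell n.+1 x y) :
  eqc f g -> eqc (bdS e f) (bdS e g).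
Proof. by case/eqc_sphere=> _ _ /(_ e). Qed.

Lemma eqc_valid n x y (f g : cell n x y) : eqc f g -> valid f /\ valid g.
Proof. by case/eqc_sphere. Qed.

Lemma eqc_bdS2 e n x y (f : cell n.+2 x y) :
  valid f -> eqc (bdS e (bdS Src f)) (bdS e (bdS Tgt f)).
Proof. by move/valid_sphere_bd => [_ _ /(_ e)]. Qed.

Lemma valid_bd_id e i n x y (f : cell n x y) : valid f -> valid (bd_id e i f).
Proof.
elim: n f => //= n IH f vf; case: ifP => // _.
exact/valid_idc/IH/valid_bdS.
Qed.

Lemma eqc_idcP n x y (f g : cell n x y) : eqc (Idc f) (Idc g) <-> eqc f g.
Proof. by split=> [/(eqc_bdS Src)|/eqc_idc]. Qed.

Lemma composable_bd_id i n x y (f g : cell n.+1 x y) : (i <= n)%N ->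
  composable i f g <-> eqc (bd_id Tgt i f) (bd_id Src i g).
Proof.
elim: n f g => [|n IH] f g.
  by rewrite leqn0 => /eqP ->; rewrite !bd_id_high // !bd_id_low // eqc_idcP.
rewrite composableS leq_eqVlt => /orP[/eqP->|im].
  by rewrite eqxx !(@bd_id_high _ _ _ _ n.+1) // !bd_id_low // eqc_idcP.
by rewrite (ltn_eqF im) IH // !(@bd_id_high _ _ _ _ n.+1) ?(ltnW im) // eqc_idcP.
Qed.

(** [eqc] is a partial equivalence relation, reflexive exactly on valid cells; a class is therefore
    encoded as the set of cells equivalent to some valid one. *)
Definition hcell n x y : Type :=
  {c : cell n x y -> Prop | exists2 f, valid f & c = eqc f}.

Definition mk n x y (f : cell n x y) (vf : valid f) : hcell n x y :=
  exist _ (eqc f) (ex_intro2 _ _ f vf erefl).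

Definition rep n x y (c : hcell n x y) : cell n x y := s2val (cid2 (svalP c)).

Lemma rep_valid n x y (c : hcell n x y) : valid (rep c).
Proof. by rewrite /rep; case: cid2. Qed.

Lemma mkP n x y (f g : cell n x y) (vf : valid f) (vg : valid g) :
  mk vf = mk vg <-> eqc f g.
Proof.
split=> [/(congr1 (@proj1_sig _ _)) /= E|fg]; first by rewrite E;
  apply: eqc_refl.
apply: eq_exist; apply/funext => h; apply/propext; split.
  by apply: eqc_trans; apply: eqc_sym.
exact: eqc_trans.
Qed.

Lemma mk_rep n x y (c : hcell n x y) : mk (rep_valid c) = c.
Proof.
case: c => c pc; apply: eq_exist; rewrite /rep; case: cid2 => /= f _ E.
by rewrite E.
Qed.

Lemma rep_mk n x y (f : cell n x y) (vf : valid f) : eqc (rep (mk vf)) f.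
Proof. by apply/(mkP (rep_valid (mk vf)) vf); rewrite mk_rep. Qed.

Lemma hcellP n x y (c : hcell n x y) : exists f (vf : valid f), c = mk vf.
Proof. by exists (rep c), (rep_valid c); rewrite mk_rep. Qed.

Definition Xgen n x y (a : @gen P n x y) : hcell n x y := mk (valid_gen a).
Definition Xone n x : hcell n x x := mk (valid_one_iter n x).
Definition Xid n x y (c : hcell n x y) : hcell n.+1 x y :=
  mk (valid_idc (rep_valid c)).
Definition Xinv n x y (c : hcell n.+1 x y) : hcell n.+1 x y :=
  mk (valid_inv (rep_valid c)).
Definition Xbd e n x y (c : hcell n.+1 x y) : hcell n x y :=
  mk (valid_bdS e (rep_valid c)).
Definition Xh n x y z (c : hcell n x y) (d : hcell n y z) : hcell n x z :=
  mk (valid_hcomp (rep_valid c) (rep_valid d)).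
(** Made total by the value [c] when the representatives do not compose; the laws below carry [comp]
    as a premise instead. *)
Definition Xv i n x y (c d : hcell n.+1 x y) : hcell n.+1 x y :=
  if pselect (valid (Vcomp i (rep c) (rep d))) is left v then mk v else c.

Lemma Xid_mk n x y (f : cell n x y) (vf : valid f) :
  Xid (mk vf) = mk (valid_idc vf).
Proof. exact/mkP/eqc_idc/rep_mk. Qed.

Lemma Xinv_mk n x y (f : cell n.+1 x y) (vf : valid f) :
  Xinv (mk vf) = mk (valid_inv vf).
Proof. exact/mkP/eqc_inv/rep_mk. Qed.

Lemma Xbd_mk e n x y (f : cell n.+1 x y) (vf : valid f) :
  Xbd e (mk vf) = mk (valid_bdS e vf).
Proof. exact/mkP/eqc_bdS/rep_mk. Qed.

Lemma Xh_mk n x y z (f : cell n x y) (g : cell n y z) vf vg :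
  Xh (@mk _ _ _ f vf) (@mk _ _ _ g vg) = mk (valid_hcomp vf vg).
Proof. by apply/mkP/eqc_hcomp; apply: rep_mk. Qed.

Lemma Xv_mk i n x y (f g : cell n.+1 x y) vf vg (v : valid (Vcomp i f g)) :
  Xv i (@mk _ _ _ f vf) (@mk _ _ _ g vg) = mk v.
Proof.
have E : eqc (Vcomp i f g) (Vcomp i (rep (mk vf)) (rep (mk vg))).
  by apply: eqc_vcomp => //; apply/eqc_sym/rep_mk.
rewrite /Xv; case: pselect => [v'|[]]; last by case: (eqc_valid E).
exact/mkP/eqc_sym.
Qed.

Fixpoint bI e i n x y : hcell n x y -> hcell n x y :=
  match n with
  | 0 => id
  | k.+1 => fun c => if (k < i)%N then c else Xid (bI e i (Xbd e c))
  end.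

Lemma bI_low e i n x y (c : hcell n x y) : (n <= i)%N -> bI e i c = c.
Proof. by case: n c => //= n c ->. Qed.

Lemma bI_high e i n x y (c : hcell n.+1 x y) : (i <= n)%N ->
  bI e i c = Xid (bI e i (Xbd e c)).
Proof. by rewrite leqNgt => /negbTE /= ->. Qed.

Lemma bI_mk e i n x y (f : cell n x y) (vf : valid f) :
  bI e i (mk vf) = mk (valid_bd_id e i vf).
Proof.
elim: n f vf => [|n IH] f vf; first exact/mkP/eqc_refl.
rewrite [LHS]/= Xbd_mk IH; case: ifP => h.
  by apply/mkP; rewrite /= h; apply: eqc_refl.
rewrite Xid_mk; apply/mkP; rewrite /= h; apply: eqc_refl.
exact/valid_idc/valid_bd_id/valid_bdS.
Qed.

(** Compares identities over the boundaries rather than the boundaries themselves: both sides keep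
    the dimension of the cells, which is also the form of the unit laws. *)
Definition comp i n x y (c d : hcell n.+1 x y) := bI Tgt i c = bI Src i d.

Lemma comp_mk i n x y (f g : cell n.+1 x y) vf vg : (i <= n)%N ->
  comp i (@mk _ _ _ f vf) (@mk _ _ _ g vg) <-> valid (Vcomp i f g).
Proof.
move=> im; rewrite /comp !bI_mk mkP -composable_bd_id // valid_vcompP.
by split=> [|[]].
Qed.

Fixpoint Xs e n x y : hcell n x y -> hcell 0 x y :=
  match n with 0 => id | k.+1 => fun c => Xs e (Xbd e c) end.

Fixpoint Xj n x y (a : hcell 0 x y) : hcell n x y :=
  match n with 0 => a | k.+1 => Xid (Xj k a) end.

Lemma Xbd_id e n x y (c : hcell n x y) : Xbd e (Xid c) = c.
Proof.
by have [f [vf ->]] := hcellP c; rewrite Xid_mk Xbd_mk; apply/mkP/eqc_refl.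
Qed.

Lemma Xid_inj n x y : injective (@Xid n x y).
Proof. by move=> c d /(congr1 (@Xbd Src _ _ _)); rewrite !Xbd_id. Qed.

Lemma Xbd2 e e' n x y (c : hcell n.+2 x y) :
  Xbd e (Xbd e' c) = Xbd e (Xbd Src c).
Proof.
have [f [vf ->]] := hcellP c; rewrite !Xbd_mk; apply/mkP.
by case: e'; [apply/eqc_refl/valid_bdS/valid_bdS|apply/eqc_sym/eqc_bdS2].
Qed.

Lemma Xbd_h e n x y z (c : hcell n.+1 x y) (d : hcell n.+1 y z) :
  Xbd e (Xh c d) = Xh (Xbd e c) (Xbd e d).
Proof.
have [f [vf ->]] := hcellP c; have [g [vg ->]] := hcellP d.
by rewrite Xh_mk !Xbd_mk Xh_mk; apply/mkP/eqc_refl/valid_hcomp;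
  apply: valid_bdS.
Qed.

Lemma Xid_h n x y z (c : hcell n x y) (d : hcell n y z) :
  Xid (Xh c d) = Xh (Xid c) (Xid d).
Proof.
have [f [vf ->]] := hcellP c; have [g [vg ->]] := hcellP d.
by rewrite Xh_mk !Xid_mk Xh_mk; apply/mkP/eqc_idc_hcomp.
Qed.

Lemma Xid_one n x : Xid (Xone n x) = Xone n.+1 x.
Proof. by rewrite /Xone Xid_mk;
  apply/mkP/eqc_refl/valid_idc/valid_one_iter. Qed.

Lemma Xbd_inv e n x y (c : hcell n.+1 x y) : Xbd e (Xinv c) = Xbd (flip e) c.
Proof.
have [f [vf ->]] := hcellP c; rewrite Xinv_mk !Xbd_mk.
exact/mkP/eqc_refl/(valid_bdS (flip e) vf).
Qed.

Lemma XhA n x y z t (c : hcell n x y) (d : hcell n y z) (e : hcell n z t) :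
  Xh (Xh c d) e = Xh c (Xh d e).
Proof.
have [f [vf ->]] := hcellP c; have [g [vg ->]] := hcellP d.
have [h [vh ->]] := hcellP e.
by rewrite !Xh_mk; apply/mkP/eqc_hcompA.
Qed.

Lemma Xh1r n x y (c : hcell n x y) : Xh c (Xone n y) = c.
Proof.
have [f [vf ->]] := hcellP c.
by rewrite Xh_mk; apply/mkP/eqc_hcomp1r.
Qed.

Lemma Xs_id e n x y (c : hcell n x y) : Xs e (Xid c) = Xs e c.
Proof. by rewrite /= Xbd_id. Qed.

Lemma Xs_bd e e' n x y (c : hcell n.+2 x y) : Xs e (Xbd e' c) = Xs e c.
Proof. by rewrite /= Xbd2 -(@Xbd2 e e). Qed.

Lemma Xs_h e n x y z (c : hcell n x y) (d : hcell n y z) :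
  Xs e (Xh c d) = Xh (Xs e c) (Xs e d).
Proof. by elim: n c d => //= n IH c d; rewrite Xbd_h. Qed.

Lemma Xs_j e n x y (a : hcell 0 x y) : Xs e (Xj n a) = a.
Proof. by elim: n => // n IH; rewrite Xs_id. Qed.

Lemma Xj_h n x y z (a : hcell 0 x y) (b : hcell 0 y z) :
  Xj n (Xh a b) = Xh (Xj n a) (Xj n b).
Proof. by elim: n => //= n ->; rewrite Xid_h. Qed.

Lemma Xj_one n x : Xj n (Xone 0 x) = Xone n x.
Proof. by elim: n => //= n ->; rewrite Xid_one. Qed.

Lemma bI0 e n x y (c : hcell n x y) : bI e 0 c = Xj n (Xs e c).
Proof. by elim: n c => //= n IH c; rewrite IH. Qed.

Lemma comp0P n x y (c d : hcell n.+1 x y) : comp 0 c d <-> Xs Tgt c = Xs Src d.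
Proof.
rewrite /comp !bI0; split=> [/(congr1 (@Xs Src _ _ _))|->//].
by rewrite !Xs_j.
Qed.

Lemma bI_bI e e' i n x y (c : hcell n x y) : bI e i (bI e' i c) = bI e' i c.
Proof.
elim: n c => // n IH c; have [h|h] := leqP i n; last by rewrite !bI_low.
by rewrite !bI_high // Xbd_id IH.
Qed.

Lemma bI_bd e e' i n x y (c : hcell n.+2 x y) : (i <= n)%N ->
  bI e i (Xbd e' c) = bI e i (Xbd e c).
Proof. by move=> im; rewrite !bI_high // Xbd2 [in RHS]Xbd2. Qed.

Lemma comp_bd e e' i n x y (c d : hcell n.+2 x y) : (i <= n)%N ->
  comp i c d <-> comp i (Xbd e c) (Xbd e' d).
Proof.
move=> im; rewrite /comp (bI_bd Tgt e c im) (bI_bd Src e' d im).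
rewrite !(@bI_high _ _ n.+1) ?(leqW im) //.
by split=> [/Xid_inj|->].
Qed.

Lemma comp_top n x y (c d : hcell n.+1 x y) :
  comp n c d <-> Xbd Tgt c = Xbd Src d.
Proof.
rewrite /comp !bI_high // !bI_low //.
by split=> [/Xid_inj|->].
Qed.

Lemma Xbd_v e i n x y (c d : hcell n.+2 x y) : (i <= n)%N -> comp i c d ->
  Xbd e (Xv i c d) = Xv i (Xbd e c) (Xbd e d).
Proof.
move=> im k; have : comp i (Xbd e c) (Xbd e d) by apply/comp_bd.
have [f [vf Ef]] := hcellP c; have [g [vg Eg]] := hcellP d.
move: k; rewrite Ef Eg !Xbd_mk => /(comp_mk _ _ (leqW im)) v /(comp_mk _ _ im) v'.
rewrite !Xv_mk !Xbd_mk; apply/mkP; rewrite bdS_vcomp im; exact: eqc_refl.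
Qed.

Lemma bdS_vcomp_top e n x y (f g : cell n.+1 x y) :
  bdS e (Vcomp n f g) = if e is Src then bdS e f else bdS e g.
Proof. by case: n f g => // n f g; rewrite bdS_vcomp ltnn. Qed.

Lemma Xbd_v_top e n x y (c d : hcell n.+1 x y) : comp n c d ->
  Xbd e (Xv n c d) = if e is Src then Xbd e c else Xbd e d.
Proof.
have [f [vf ->]] := hcellP c; have [g [vg ->]] := hcellP d.
move=> /(comp_mk _ _ (leqnn n)) v; rewrite Xv_mk !Xbd_mk.
have E := bdS_vcomp_top e f g.
by case: e E => E; apply/mkP; rewrite E; apply/eqc_refl/valid_bdS.
Qed.

Lemma Xid_v i n x y (c d : hcell n.+1 x y) : (i <= n)%N -> comp i c d ->
  Xid (Xv i c d) = Xv i (Xid c) (Xid d).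
Proof.
have [f [vf ->]] := hcellP c; have [g [vg ->]] := hcellP d.
move=> im /(comp_mk _ _ im) v; have E := eqc_idc_vcomp v.
have [_ v'] := eqc_valid E.
by rewrite (Xv_mk _ _ v) !Xid_mk (Xv_mk _ _ v'); apply/mkP.
Qed.

Lemma XvA i n x y (c d e : hcell n.+1 x y) : (i <= n)%N -> comp i c d ->
  comp i d e -> Xv i (Xv i c d) e = Xv i c (Xv i d e).
Proof.
have [f [vf ->]] := hcellP c; have [g [vg ->]] := hcellP d.
have [h [vh ->]] := hcellP e.
move=> im /(comp_mk _ _ im) v /(comp_mk _ _ im) v'.
have V : valid (Vcomp i (Vcomp i f g) h).
  apply/valid_vcompP; split=> //; rewrite composable_vcompl //.
  by case/valid_vcompP: v'.
have E := eqc_vcompA V; have [_ V'] := eqc_valid E.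
by rewrite (Xv_mk _ _ v) (Xv_mk _ _ v') (Xv_mk _ _ V) (Xv_mk _ _ V'); apply/mkP.
Qed.

Lemma Xv1l i n x y (c : hcell n.+1 x y) : (i <= n)%N -> Xv i (bI Src i c) c = c.
Proof.
have [f [vf ->]] := hcellP c => im; have E := eqc_vcomp1l im vf.
have [v _] := eqc_valid E; rewrite bI_mk Xv_mk; exact/mkP.
Qed.

Lemma Xv1r i n x y (c : hcell n.+1 x y) : (i <= n)%N -> Xv i c (bI Tgt i c) = c.
Proof.
have [f [vf ->]] := hcellP c => im; have E := eqc_vcomp1r im vf.
have [v _] := eqc_valid E; rewrite bI_mk Xv_mk; exact/mkP.
Qed.

Lemma Xhv i n x y z (c c' : hcell n.+1 x y) (d d' : hcell n.+1 y z) :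
  (i <= n)%N -> comp i c c' -> comp i d d' ->
  Xh (Xv i c c') (Xv i d d') = Xv i (Xh c d) (Xh c' d').
Proof.
have [f [vf ->]] := hcellP c; have [f' [vf' ->]] := hcellP c'.
have [g [vg ->]] := hcellP d; have [g' [vg' ->]] := hcellP d'.
move=> im /(comp_mk _ _ im) v /(comp_mk _ _ im) v'.
have E := eqc_hv v v'; have [_ V] := eqc_valid E.
by rewrite (Xv_mk _ _ v) (Xv_mk _ _ v') !Xh_mk (Xv_mk _ _ V); apply/mkP.
Qed.

Lemma Xvinvr n x y (c : hcell n.+1 x y) : Xv n c (Xinv c) = Xid (Xbd Src c).
Proof.
have [f [vf ->]] := hcellP c; have E := eqc_invr vf.
have [v _] := eqc_valid E; rewrite Xinv_mk Xv_mk Xbd_mk Xid_mk; exact/mkP.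
Qed.

Lemma Xvinvl n x y (c : hcell n.+1 x y) : Xv n (Xinv c) c = Xid (Xbd Tgt c).
Proof.
have [f [vf ->]] := hcellP c; have E := eqc_invl vf.
have [v _] := eqc_valid E; rewrite Xinv_mk Xv_mk Xbd_mk Xid_mk; exact/mkP.
Qed.

(** The exchanged side is composable too, because both members of an [eqc] are valid. *)
Lemma Xvv i j n x y (c c' d d' : hcell n.+1 x y) : (i < j <= n)%N ->
  comp j c c' -> comp j d d' -> comp i (Xv j c c') (Xv j d d') ->
  comp j (Xv i c d) (Xv i c' d') /\
  Xv i (Xv j c c') (Xv j d d') = Xv j (Xv i c d) (Xv i c' d').
Proof.
have [f [vf ->]] := hcellP c; have [f' [vf' ->]] := hcellP c'.
have [g [vg ->]] := hcellP d; have [g' [vg' ->]] := hcellP d'.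
move=> /andP[ij jm] /(comp_mk _ _ jm) v /(comp_mk _ _ jm) v'.
have im : (i <= n)%N by apply: leq_trans jm; apply: ltnW.
rewrite (Xv_mk _ _ v) (Xv_mk _ _ v') => /(comp_mk _ _ im) V.
have E := eqc_vv ij V; have [_ V'] := eqc_valid E.
have [_ v1 v2 _] := validE V'.
rewrite (Xv_mk _ _ v1) (Xv_mk _ _ v2) (Xv_mk _ _ V) (Xv_mk _ _ V').
by split; [apply/comp_mk|apply/mkP].
Qed.

Lemma Xs_bI e e' i n x y (c : hcell n x y) : (0 < i)%N ->
  Xs e (bI e' i c) = Xs e c.
Proof.
move=> i0; elim: n c => // n IH c; have [h|h] := leqP i n;
  last by rewrite bI_low.
rewrite bI_high // Xs_id IH; case: n {IH} h c => [|n] h c;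
  last by rewrite Xs_bd.
by case: i i0 h.
Qed.

Lemma Xs_comp e i n x y (c d : hcell n.+1 x y) : (0 < i)%N -> comp i c d ->
  Xs e c = Xs e d.
Proof. by move=> i0 E; rewrite -(Xs_bI e Tgt c i0) E Xs_bI. Qed.

End Quotient.

(** * The two lowest compositions, their inverses, and elimination of the others *)

Section TwoCat.
Variables (N : option nat) (P : polygraph N).
Local Notation cell := (fcell (@gen P)).
Local Notation X := (@hcell N P).
Local Notation v := (Xv 0).
Local Notation s := (Xs Src).
Local Notation t := (Xs Tgt).

Lemma Xs_v0 e n x y (c d : X n.+1 x y) : t c = s d ->
  Xs e (v c d) = if e is Src then Xs e c else Xs e d.
Proof.
move/comp0P; elim: n c d => [|n IH] c d k.
  by rewrite [LHS]/= Xbd_v_top //; case: (e).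
by rewrite -(@Xs_bd _ _ e e) Xbd_v // IH ?(Xs_bd e e) //; apply/comp_bd.
Qed.

Lemma s_v n x y (c d : X n.+1 x y) : t c = s d -> s (v c d) = s c.
Proof. exact: (Xs_v0 Src). Qed.

Lemma t_v n x y (c d : X n.+1 x y) : t c = s d -> t (v c d) = t d.
Proof. exact: (Xs_v0 Tgt). Qed.

Lemma v_assoc n x y (c d e : X n.+1 x y) : t c = s d -> t d = s e ->
  v (v c d) e = v c (v d e).
Proof. by move=> /comp0P h /comp0P k; apply: XvA. Qed.

Lemma v1l n x y (c : X n.+1 x y) a : a = s c -> v (Xj n.+1 a) c = c.
Proof. by move=> ->; rewrite -bI0 Xv1l. Qed.

Lemma v1r n x y (c : X n.+1 x y) a : a = t c -> v c (Xj n.+1 a) = c.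
Proof. by move=> ->; rewrite -bI0 Xv1r. Qed.

Lemma h_v n x y z (c c' : X n.+1 x y) (d d' : X n.+1 y z) :
  t c = s c' -> t d = s d' -> v (Xh c d) (Xh c' d') = Xh (v c c') (v d d').
Proof. by move=> /comp0P ? /comp0P ?; rewrite Xhv. Qed.

Lemma bd_v e n x y (c d : X n.+2 x y) : t c = s d ->
  Xbd e (v c d) = v (Xbd e c) (Xbd e d).
Proof. by move=> /comp0P ?; rewrite Xbd_v. Qed.

Lemma id_v n x y (c d : X n.+1 x y) : t c = s d ->
  Xid (v c d) = v (Xid c) (Xid d).
Proof. by move=> /comp0P ?; rewrite Xid_v. Qed.

(* Eckmann-Hilton: the exchange law expresses the higher compositions by the
   1-composition. *)
Lemma Xv_eckmann j n x y (c d m' : X n.+1 x y) (m := bI Tgt j c) :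
  (0 < j <= n)%N -> comp j c d -> bI Tgt j m' = m' -> bI Src j m' = m' ->
  s m' = t m -> t m' = s m ->
  v m m' = Xj _ (s m) -> v m' m = Xj _ (t m) ->
  Xv j c d = v (v c m') d.
Proof.
move=> jn k mT mS sm tm mm' m'm; have /andP[j0 jn'] := jn.
have [sc tc] : s m = s c /\ t m = t c by rewrite !Xs_bI.
have [sd td] : s m = s d /\ t m = t d by rewrite /m k !Xs_bI.
have Em : comp j c m by rewrite /comp bI_bI.
have Em' : comp j m d by rewrite /comp bI_bI.
have mm : comp j m' m' by rewrite /comp mT mS.
have vm : Xv j m' m' = m' by rewrite -{1}mS Xv1l.
have vd : Xv j m d = d by rewrite /m k Xv1l.
have vc : Xv j c m = c by rewrite Xv1r.
have c1 : comp 0 (Xv j m' m') (Xv j m d) by rewrite vm vd; apply/comp0P;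
  rewrite tm.
have [k1 E1] := Xvv jn mm Em' c1.
have c2 : comp 0 (Xv j c m) (Xv j (v m' m) (v m' d)).
  by rewrite -E1 vm vd vc; apply/comp0P; rewrite s_v ?tm // sm.
have [_ E2] := Xvv jn Em k1 c2.
(* Exchange has turned [v c (v m' d)] into the [j]-composite of [v c (v m' m)] and [v m (v m' d)].
   As [m'] inverts [m], these two factors are [c] and [d]. *)
have <- : v c (v m' m) = c by rewrite m'm v1r.
have e1 : v m (v m' d) = d by rewrite -v_assoc ?mm' ?v1l ?sm ?tm.
by rewrite -{1}e1 -E2 vc -E1 vm vd m'm v1r // v_assoc ?sm ?tm ?tc ?sd.
Qed.

Lemma Xs_inv e n x y (c : X n.+2 x y) : Xs e (Xinv c) = Xs e c.
Proof. by rewrite -(Xs_bd e Src) Xbd_inv Xs_bd. Qed.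

Lemma bI_top e n x y (c : X n.+1 x y) : bI e n c = Xid (Xbd e c).
Proof. by rewrite bI_high // bI_low. Qed.

(** [Xinv] inverts the composition of highest dimension only. Rewriting both its laws along 1-cells
    by Eckmann-Hilton shows that [a I b] inverts [c], where [I] is [Xinv c] and [a], [b] invert the
    target and the source of [c], by induction on the dimension. *)
Lemma Xi_ex n x y (c : X n.+1 x y) : exists d : X n.+1 x y,
  [/\ s d = t c, t d = s c, v c d = Xj _ (s c) & v d c = Xj _ (t c)].
Proof.
elim: n c => [|n IH] c.
  by exists (Xinv c); rewrite /= !Xbd_inv Xvinvr Xvinvl.
have [b []] := IH (Xbd Src c); have [a []] := IH (Xbd Tgt c); rewrite !Xs_bd.
move=> sa ta ca ac sb tb cb bc; set I := Xinv c.
have [sI tI] : s I = s c /\ t I = t c by rewrite !Xs_inv.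
have e1 : v (v c (Xid a)) I = Xid (Xbd Src c).
  rewrite -Xvinvr; apply/esym/Xv_eckmann;
    rewrite ?leqnn ?bI_top ?Xbd_id ?Xs_id ?Xs_bd //.
  - by apply/comp_top; rewrite Xbd_inv.
  - by rewrite -id_v ?ca ?sa ?Xs_bd.
  - by rewrite -id_v ?ac ?ta ?Xs_bd.
have e2 : v (v I (Xid b)) c = Xid (Xbd Tgt c).
  rewrite -Xvinvl; apply/esym/Xv_eckmann;
    rewrite ?leqnn ?bI_top ?Xbd_id ?Xs_id ?Xs_bd ?Xbd_inv ?Xs_bd //.
  - by apply/comp_top; rewrite Xbd_inv.
  - by rewrite sb tI.
  - by rewrite tb sI.
  - by rewrite -id_v ?cb ?sb ?sI ?Xs_bd.
  - by rewrite -id_v ?bc ?tb ?tI ?Xs_bd.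
have [sa' ta'] : s (Xid a) = t c /\ t (Xid a) = s c by rewrite !Xs_id.
have [sb' tb'] : s (Xid b) = t c /\ t (Xid b) = s c by rewrite !Xs_id.
have sai : s (v (Xid a) I) = t c by rewrite s_v ?sI.
have tai : t (v (Xid a) I) = t c by rewrite t_v ?tI ?sI.
exists (v (v (Xid a) I) (Xid b)); split.
- by rewrite s_v ?tai.
- by rewrite t_v ?tai.
- rewrite -v_assoc ?sai ?tai // -v_assoc ?sI // e1 -id_v ?Xs_bd ?sb //.
  by rewrite cb.
- rewrite v_assoc ?tai // v_assoc ?sI //; last by rewrite s_v ?tI.
  rewrite -(v_assoc (c := I) (d := Xid b)) ?tI ?sb' ?tb' //.
  by rewrite e2 -id_v ?Xs_bd ?ta // ac.
Qed.

Definition Xi n x y (c : X n.+1 x y) : X n.+1 x y := proj1_sig (cid (Xi_ex c)).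

Lemma Xi_spec n x y (c : X n.+1 x y) :
  [/\ s (Xi c) = t c, t (Xi c) = s c,
      v c (Xi c) = Xj _ (s c) & v (Xi c) c = Xj _ (t c)].
Proof. exact: (proj2_sig (cid (Xi_ex c))). Qed.

Lemma s_i n x y (c : X n.+1 x y) : s (Xi c) = t c.
Proof. by case: (Xi_spec c). Qed.

Lemma t_i n x y (c : X n.+1 x y) : t (Xi c) = s c.
Proof. by case: (Xi_spec c). Qed.

Lemma v_ir n x y (c : X n.+1 x y) : v c (Xi c) = Xj _ (s c).
Proof. by case: (Xi_spec c). Qed.

Lemma v_il n x y (c : X n.+1 x y) : v (Xi c) c = Xj _ (t c).
Proof. by case: (Xi_spec c). Qed.

Lemma i_uniq n x y (c d : X n.+1 x y) : t c = s d -> t d = s c ->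
  v c d = Xj _ (s c) -> d = Xi c.
Proof.
move=> k k' E; rewrite -[RHS](v1r (a := s c)) ?t_i // -E -v_assoc ?t_i //.
by rewrite v_il v1l.
Qed.

Lemma id_i n x y (c : X n.+1 x y) : Xid (Xi c) = Xi (Xid c).
Proof.
apply: i_uniq; rewrite ?Xs_id ?s_i ?t_i //.
by rewrite -id_v ?s_i // v_ir.
Qed.

Lemma bd_i e n x y (c : X n.+2 x y) : Xbd e (Xi c) = Xi (Xbd e c).
Proof.
apply: i_uniq; rewrite ?Xs_bd ?s_i ?t_i //.
by rewrite -bd_v ?s_i // v_ir Xbd_id.
Qed.

Lemma bI_i e j n x y (c : X n.+1 x y) : (0 < j)%N ->
  bI e j (Xi c) = Xi (bI e j c).
Proof.
move=> j0; elim: n c => [|n IH] c; first by rewrite !bI_low.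
have [h|h] := leqP j n.+1; last by rewrite !bI_low.
by rewrite !(@bI_high _ _ _ _ n.+1) // bd_i IH id_i.
Qed.

Lemma XvE j n x y (c d : X n.+1 x y) : (0 < j <= n)%N -> comp j c d ->
  Xv j c d = v (v c (Xi (bI Tgt j c))) d.
Proof.
move=> jn k; have /andP[j0 _] := jn.
apply: Xv_eckmann; rewrite ?bI_i ?bI_bI ?s_i ?t_i ?v_ir ?v_il //.
Qed.

Lemma Xinv_0 x y (c : X 1 x y) : Xinv c = Xi c.
Proof. by apply: i_uniq; rewrite /= ?Xbd_inv ?Xvinvr. Qed.

Lemma Xinv_E n x y (c : X n.+2 x y) :
  Xinv c = v (v (Xid (Xbd Tgt c)) (Xi c)) (Xid (Xbd Src c)).
Proof.
have [si ti] : s (Xid (Xbd Src c)) = s c /\ t (Xid (Xbd Src c)) = t c.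
  by rewrite !Xs_id !Xs_bd.
have [sj tj] : s (Xid (Xbd Tgt c)) = s c /\ t (Xid (Xbd Tgt c)) = t c.
  by rewrite !Xs_id !Xs_bd.
have [sI tI] : s (Xinv c) = s c /\ t (Xinv c) = t c by rewrite !Xs_inv.
have E : v (v c (Xi (Xid (Xbd Tgt c)))) (Xinv c) = Xid (Xbd Src c).
  by rewrite -bI_top -XvE ?leqnn // ?Xvinvr //; apply/comp_top; rewrite Xbd_inv.
set T := Xid (Xbd Tgt c) in sj tj E *; set I := Xinv c in sI tI E *.
have sjI : s (v (Xi T) I) = t c by rewrite s_v ?s_i ?t_i ?sj ?sI.
have scjI : s (v c (v (Xi T) I)) = s c by rewrite s_v ?sjI.
rewrite -E (v_assoc (c := c)) ?s_i ?t_i ?sj ?tj ?sI // v_assoc ?s_i ?t_i ?scjI //.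
rewrite -(v_assoc (c := Xi c) (d := c)) ?t_i ?sjI // v_il v1l ?sjI //.
by rewrite -v_assoc ?s_i ?t_i ?sj ?sI // v_ir sj v1l.
Qed.

Section Induction.
Variable Q : forall n x y, X n x y -> Prop.
Hypotheses (Qgen : forall n x y (a : @gen P n.+1 x y), Q (Xgen a))
  (Qid : forall n x y (c : X n x y), Q (Xid c))
  (Qi : forall n x y (c : X n.+1 x y), Q c -> Q (Xi c))
  (Qh : forall n x y z (c : X n.+1 x y) (d : X n.+1 y z),
    Q c -> Q d -> Q (Xh c d))
  (Qv : forall n x y (c d : X n.+1 x y), t c = s d -> Q c -> Q d -> Q (v c d)).

(** [XvE] and [Xinv_E] express higher compositions and formal inverses through [v], [Xi] and
    identities, so a property need only be tested against the two lowest compositions. *)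
Lemma hcell_ind n x y (c : X n.+1 x y) : Q c.
Proof.
have [f [vf ->]] := hcellP c.
suff : forall m x y (f : cell m x y) (vf : valid f),
    if m is 0 then True else Q (mk vf) by move/(_ _ _ _ _ vf).
move=> {x y c vf f} m x y f; elim: m x y / f.
- by move=> [|m] x y a vf //; rewrite (_ : mk _ = Xgen a) //;
  apply/mkP/eqc_refl.
- by [].
- move=> m x y f _ vf; have vf' := validE vf.
  rewrite (_ : mk _ = Xid (mk vf')) // Xid_mk; exact/mkP/eqc_refl.
- move=> m x y f IH vf; have vf' : valid f := validE vf.
  rewrite (_ : mk _ = Xinv (mk vf')); last by rewrite Xinv_mk;
    exact/mkP/eqc_refl.
  have := IH vf'; move: (mk _) => c {IH vf vf' f}.
  case: m c => [|m] c Qc; first by rewrite Xinv_0; exact: (Qi Qc).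
  have s1 : s (Xid (Xbd Tgt c)) = s c by rewrite Xs_id Xs_bd.
  have t1 : t (Xid (Xbd Tgt c)) = t c by rewrite Xs_id Xs_bd.
  rewrite Xinv_E; apply: (Qv _ _ (Qid _)).
    by rewrite t_v ?s_i // t_i Xs_id Xs_bd.
  by apply: (Qv _ (Qid _) (Qi Qc)); rewrite s_i.
- move=> [//|m] x y z f IHf g IHg vf; have [vf' vg'] := validE vf.
  rewrite (_ : mk _ = Xh (mk vf') (mk vg')); last by rewrite Xh_mk;
    exact/mkP/eqc_refl.
  exact: (Qh (IHf vf') (IHg vg')).
- move=> m i x y f IHf g IHg vf; have [im vf' vg' _] := validE vf.
  rewrite (_ : mk _ = Xv i (mk vf') (mk vg')); last first.
    by rewrite (Xv_mk _ _ vf); exact/mkP/eqc_refl.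
  have Qc := IHf vf'; have Qd := IHg vg'.
  have k : comp i (mk vf') (mk vg') by apply/comp_mk.
  move: (mk vf') (mk vg') Qc Qd k => c d Qc Qd k {IHf IHg}.
  have [i0|i0] := posnP i.
    by move: k; rewrite i0 => /comp0P k; apply: Qv.
  have i1 : t c = s (Xi (bI Tgt i c)) by rewrite s_i Xs_bI.
  rewrite XvE ?i0 //; apply: (Qv _ _ Qd).
    by rewrite t_v // t_i Xs_bI // (Xs_comp Src i0 k).
  apply: (Qv i1 Qc); apply: Qi.
  by rewrite bI_high.
Qed.
End Induction.
End TwoCat.

(** * Normal forms of 1-cells *)

Section Normal.
Variables (N : option nat) (P : polygraph N).
Local Notation cell := (fcell (@gen P)).
Local Notation X := (@hcell N P).
Local Notation W := (@pres_hom P).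
Local Notation v := (Xv 0).
Local Notation s := (Xs Src).
Local Notation t := (Xs Tgt).
Local Notation "u ** w" := (pres_cmp u w) (at level 40, left associativity).

Lemma mulWA x y z t (f : W x y) (g : W y z) (h : W z t) :
  f ** g ** h = f ** (g ** h).
Proof. exact: (@cmpA (pres P)). Qed.

Definition oneW x : W x x := pres_class (One x).

Lemma mulW1 x y (f : W x y) : f ** oneW y = f.
Proof. exact: (@cmpm1 (pres P)). Qed.

Lemma mul1W x y (f : W x y) : oneW x ** f = f.
Proof. exact: (@cmp1m (pres P)). Qed.

Definition mk0 x y (f : cell 0 x y) : X 0 x y := mk (valid1 f).

Lemma Xs_mk n x y (f : cell n x y) (vf : valid f) : s (mk vf) = mk0 (src1 f).
Proof.
elim: n f vf => [|n IH] f vf; first exact/mkP/eqc_refl.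
by rewrite [LHS]/= Xbd_mk IH.
Qed.

Definition cls0 x y (a : X 0 x y) : W x y := pres_class (rep a).

Lemma cls0_mk x y (f : cell 0 x y) (vf : valid f) : cls0 (mk vf) = pres_class f.
Proof. exact/pres_classP/cong2_eqc/rep_mk. Qed.

Lemma cls0_h x y z (a : X 0 x y) (b : X 0 y z) :
  cls0 (Xh a b) = cls0 a ** cls0 b.
Proof.
have [f [vf ->]] := hcellP a; have [g [vg ->]] := hcellP b.
by rewrite Xh_mk !cls0_mk pres_cmpE.
Qed.

Lemma cls0_one x : cls0 (Xone 0 x) = oneW x.
Proof. exact: cls0_mk. Qed.

Definition cls n x y (c : X n x y) : W x y := cls0 (s c).

Lemma cls_mk n x y (f : cell n x y) (vf : valid f) : cls (mk vf) = class1 f.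
Proof. by rewrite /cls Xs_mk cls0_mk. Qed.

Lemma cls_bd e n x y (c : X n.+1 x y) : cls (Xbd e c) = cls c.
Proof.
have [f [vf ->]] := hcellP c.
by rewrite Xbd_mk !cls_mk; apply/class1_bd/valid_coherent.
Qed.

Lemma cls_s e n x y (c : X n x y) : cls0 (Xs e c) = cls c.
Proof. by elim: n c => //= n IH c; rewrite IH cls_bd. Qed.

Lemma cls_h n x y z (c : X n x y) (d : X n y z) : cls (Xh c d) = cls c ** cls d.
Proof. by rewrite /cls Xs_h cls0_h. Qed.

Definition hat x y (w : W x y) : X 0 x y := mk0 (pres_repr w).

Lemma cls_hat x y (w : W x y) : cls0 (hat w) = w.
Proof. by rewrite cls0_mk pres_reprK. Qed.

(** Each rule of [cong2] is realised by a 2-cell: a generator, an identity, an inverse [Xi], a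
    composite [v] or a concatenation [Xh]. *)
Lemma link_ex x y (a b : X 0 x y) : cls0 a = cls0 b ->
  exists c : X 1 x y, s c = a /\ t c = b.
Proof.
have mkE (c : X 0 x y) : c = mk0 (rep c).
  by rewrite -{1}(mk_rep c); apply/mkP/eqc_refl/rep_valid.
move/pres_classP => E; rewrite [a]mkE [b]mkE {mkE}.
move: (rep a) (rep b) E => f g fg {a b}; elim: x y f g / fg.
- move=> x y a; exists (Xgen a).
  by rewrite /= /Xgen !Xbd_mk; split; apply/mkP/eqc_refl/valid1.
- by move=> x y f g fg; exists (Xid (mk0 f)); rewrite !Xs_id; split=> //;
  apply/mkP.
- by move=> x y f; exists (Xid (mk0 f)); rewrite !Xs_id.
- by move=> x y f g _ [c [<- <-]]; exists (Xi c); rewrite s_i t_i.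
- move=> x y f g h _ [c [<- tc]] _ [d [sd <-]]; exists (v c d).
  by rewrite s_v ?t_v ?tc ?sd.
- move=> x y z f f' g g' _ [c [sc tc]] _ [d [sd td]]; exists (Xh c d).
  by rewrite !Xs_h sc tc sd td !Xh_mk; split; apply/mkP/eqc_refl/valid1.
Qed.

Definition link x y (a b : X 0 x y) (E : cls0 a = cls0 b) : X 1 x y :=
  proj1_sig (cid (link_ex E)).

Lemma linkP x y (a b : X 0 x y) (E : cls0 a = cls0 b) :
  s (link E) = a /\ t (link E) = b.
Proof. by rewrite /link; case: cid. Qed.

Lemma nf_cls x y z (u : W x y) (a : X 0 y z) :
  cls0 (Xh (hat u) a) = cls0 (hat (u ** cls0 a)).
Proof. by rewrite cls0_h !cls_hat. Qed.

(* On 1-cells, a chosen 2-cell from [hat u . f] to its normal form, made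
   compatible with composition by recursion on the syntax of [f]; the values on
   higher cells are irrelevant. *)
Fixpoint nf_form n x y (f : cell n x y) x0 (u : W x0 x) : X 1 x0 y :=
  match f in fcell _ _ x y return W x0 x -> X 1 x0 y with
  | @One _ _ _ => fun u => Xid (hat u)
  | @Hcomp _ _ _ _ _ _ f g => fun u =>
      v (Xh (nf_form f u) (Xid (mk0 (src1 g)))) (nf_form g (u ** class1 f))
  | f' => fun u => link (nf_cls u (mk0 (src1 f')))
  end u.

Lemma src1_hcomp n x y z (f : cell n x y) (g : cell n y z) :
  src1 (Hcomp f g) = Hcomp (src1 f) (src1 g).
Proof. by elim: n f g => //= n IH f g; rewrite -IH. Qed.

Lemma mk0_hcomp x y z (f : cell 0 x y) (g : cell 0 y z) :
  mk0 (Hcomp f g) = Xh (mk0 f) (mk0 g).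
Proof. by rewrite Xh_mk; apply/mkP/eqc_refl/valid1. Qed.

Lemma nf_form_bd n x y (f : cell n x y) x0 (u : W x0 x) :
  s (nf_form f u) = Xh (hat u) (mk0 (src1 f)) /\
  t (nf_form f u) = hat (u ** class1 f).
Proof.
have gP x1 z r (w : W x1 z) (a : X 0 z r) : s (link (nf_cls w a)) = Xh (hat w) a /\
    t (link (nf_cls w a)) = hat (w ** cls0 a).
  exact: linkP.
have cE m z r (h : cell m z r) : cls0 (mk0 (src1 h)) = class1 h by apply: cls0_mk.
elim: n x y / f x0 u => [n x y a|x|n x y f _|n x y f _|n x y z f IHf g IHg|n i x y f _ g _] x0 u;
  rewrite -?cE; try exact: gP.
- rewrite /= !Xbd_id; split.
    by rewrite -[LHS](Xh1r (hat u)); congr Xh; apply/mkP/eqc_refl/valid1.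
  by rewrite cls0_mk mulW1.
- have [sf tf] := IHf _ u; have [sg tg] := IHg _ (u ** class1 f).
  have k : t (Xh (nf_form f u) (Xid (mk0 (src1 g)))) = s (nf_form g (u ** class1 f)).
    by rewrite sg Xs_h tf Xs_id.
  rewrite [nf_form _ _]/= s_v ?t_v // Xs_h sf tg Xs_id src1_hcomp mk0_hcomp.
  by rewrite XhA cls0_h !cE mulWA.
Qed.

Lemma eqc_mk0_src1 n x y (f g : cell n x y) : eqc f g ->
  mk0 (src1 f) = mk0 (src1 g).
Proof.
move=> fg; have [vf vg] := eqc_valid fg.
by rewrite -(Xs_mk vf) -(Xs_mk vg); congr Xs; apply/mkP.
Qed.

(** In dimension 1 the only axioms are associativity and units of concatenation, which the recursion
    turns into those of [v]. The premise [n = 0] disposes of all the other axioms, as they concern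
    cells of dimension at least 2. *)
Lemma nf_form_eqc n x y (f g : cell n x y) : eqc f g -> n = 0 ->
  forall x0 (u : W x0 x), nf_form f u = nf_form g u.
Proof.
pose Q n x y (f g : cell n x y) := n = 0 ->
  forall x0 (u : W x0 x), nf_form f u = nf_form g u.
move=> fg; move: n x y f g fg;
  apply: (@eqc_mind P (fun _ _ _ _ => True) Q) => //.
- by move=> n x y f g _ IH n0 x0 u; rewrite IH.
- by move=> n x y f g h _ IH _ IH' n0 x0 u; rewrite IH // IH'.
- move=> n x y z f f' g g' ff IH gg IH' n0 x0 u /=.
  have [_ _ E] := eqc_coherent ff.
  by rewrite IH // IH' // (eqc_mk0_src1 gg) E.
- move=> n x y z t f g h _ _ _ _ _ _ n0 x0 u /=.
  have [_ tf] := nf_form_bd f u; have [sg tg] := nf_form_bd g (u ** class1 f).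
  have [sh _] := nf_form_bd h (u ** class1 f ** class1 g).
  rewrite class1_hcomp -mulWA src1_hcomp mk0_hcomp Xid_h.
  rewrite -XhA -v_assoc; last 2 first.
  + by rewrite !Xs_h !Xs_id tf sg.
  + by rewrite !Xs_h !Xs_id sh tg.
  congr Xv; rewrite h_v ?Xs_id ?Xs_h ?Xs_id ?tf ?sg //; congr Xh.
  by rewrite (@v1l _ _ 0 _ _ (Xid (mk0 (src1 h))) (mk0 (src1 h))) ?Xs_id.
- move=> n x y f _ _ n0 x0 u; subst n; rewrite [LHS]/= mulW1.
  have [sf _] := nf_form_bd f u.
  rewrite -[RHS](v1l (a := Xh (hat u) (mk0 (src1 f)))) // [Xj _ _]/= Xid_h.
  by congr Xv.
- move=> n x y f _ _ n0 x0 u; subst n; rewrite [LHS]/=.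
  have [_ tf] := nf_form_bd f u;
    rewrite -[RHS](v1r (a := hat (u ** class1 f))) //.
  congr Xv; rewrite -[RHS]Xh1r -Xid_one; congr (Xh _ (Xid _)).
  exact/mkP/eqc_refl/valid1.
Qed.

Definition nf x0 x y (u : W x0 x) (a : X 0 x y) : X 1 x0 y := nf_form (rep a) u.

Lemma nf_mk x0 x y (u : W x0 x) (f : cell 0 x y) vf :
  nf u (@mk _ _ _ _ _ f vf) = nf_form f u.
Proof. by apply: nf_form_eqc => //; apply: rep_mk. Qed.

Lemma s_nf x0 x y (u : W x0 x) (a : X 0 x y) : s (nf u a) = Xh (hat u) a.
Proof.
have [f [vf ->]] := hcellP a; rewrite nf_mk.
have [-> _] := nf_form_bd f u; congr Xh; exact/mkP/eqc_refl.
Qed.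

Lemma t_nf x0 x y (u : W x0 x) (a : X 0 x y) : t (nf u a) = hat (u ** cls0 a).
Proof.
have [f [vf ->]] := hcellP a; rewrite nf_mk.
by have [_ ->] := nf_form_bd f u; rewrite cls0_mk.
Qed.

Lemma nf_h x0 x y z (u : W x0 x) (a : X 0 x y) (b : X 0 y z) :
  nf u (Xh a b) = v (Xh (nf u a) (Xid b)) (nf (u ** cls0 a) b).
Proof.
have [f [vf ->]] := hcellP a; have [g [vg ->]] := hcellP b.
rewrite Xh_mk !nf_mk cls0_mk /=; congr (Xv _ (Xh _ (Xid _)) _).
exact/mkP/eqc_refl.
Qed.
End Normal.

(** * Loops at normal forms *)

Section Loops.
Variables (N : option nat) (P : polygraph N).
Local Notation X := (@hcell N P).
Local Notation v := (Xv 0).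
Local Notation s := (Xs Src).
Local Notation t := (Xs Tgt).
Local Notation "u ** w" := (pres_cmp u w) (at level 40, left associativity).

Fixpoint Xlift n x y (c : X 1 x y) : X n.+1 x y :=
  if n is k.+1 return X n.+1 x y then Xid (Xlift k c) else c.

Lemma Xs_lift e n x y (c : X 1 x y) : Xs e (Xlift n c) = Xs e c.
Proof. by elim: n => // n IH; rewrite Xs_id. Qed.

Lemma lift_v n x y (c d : X 1 x y) : t c = s d ->
  Xlift n (v c d) = v (Xlift n c) (Xlift n d).
Proof. by move=> k; elim: n => //= n ->; rewrite id_v // !Xs_lift. Qed.

Lemma lift_h n x y z (c : X 1 x y) (d : X 1 y z) :
  Xlift n (Xh c d) = Xh (Xlift n c) (Xlift n d).
Proof. by elim: n => //= n ->; rewrite Xid_h. Qed.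

Lemma lift_id n x y (a : X 0 x y) : Xlift n (Xid a) = Xj n.+1 a.
Proof. by elim: n => //= n ->. Qed.

Definition conj_cell n x y (p q c : X n.+1 x y) := v (v (Xi p) c) q.

Lemma s_conj n x y (p q c : X n.+1 x y) : s c = s p -> t c = s q ->
  s (conj_cell p q c) = t p.
Proof. by move=> sc tc; rewrite !s_v ?t_v ?s_i ?t_i. Qed.

Lemma t_conj n x y (p q c : X n.+1 x y) : s c = s p -> t c = s q ->
  t (conj_cell p q c) = t q.
Proof. by move=> sc tc; rewrite !t_v ?t_i. Qed.

Lemma conj_v n x y (p q r c d : X n.+1 x y) :
  s c = s p -> t c = s q -> s d = s q -> t d = s r ->
  v (conj_cell p q c) (conj_cell q r d) = conj_cell p r (v c d).
Proof.
move=> sc tc sd td; rewrite /conj_cell.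
rewrite (v_assoc (c := Xi q) (d := d)) ?t_i //.
rewrite (v_assoc (c := v (Xi p) c) (d := q)) ?t_v ?t_i ?s_v ?s_i //.
rewrite -(v_assoc (c := q) (d := Xi q)) ?t_i ?s_i ?s_v //.
rewrite v_ir v1l ?s_v ?sd // -v_assoc ?t_v ?t_i ?tc ?sd //.
  by rewrite (v_assoc (c := Xi p)) ?t_i ?tc ?sd.
by rewrite t_i.
Qed.

Lemma conj_j n x y (p : X n.+1 x y) : conj_cell p p (Xj _ (s p)) = Xj _ (t p).
Proof. by rewrite /conj_cell v1r ?t_i // v_il. Qed.

Lemma conj_bd e n x y (p q c : X n.+2 x y) : s c = s p -> t c = s q ->
  Xbd e (conj_cell p q c) = conj_cell (Xbd e p) (Xbd e q) (Xbd e c).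
Proof. by move=> sc tc; rewrite /conj_cell !bd_v ?t_v ?t_i ?bd_i. Qed.

Lemma conj_id n x y (p q c : X n.+1 x y) : s c = s p -> t c = s q ->
  Xid (conj_cell p q c) = conj_cell (Xid p) (Xid q) (Xid c).
Proof. by move=> sc tc; rewrite /conj_cell !id_v ?t_v ?t_i ?id_i. Qed.

Lemma i_h n x y z (c : X n.+1 x y) (d : X n.+1 y z) :
  Xi (Xh c d) = Xh (Xi c) (Xi d).
Proof.
apply/esym/i_uniq; rewrite ?Xs_h ?s_i ?t_i //.
by rewrite h_v ?s_i // !v_ir Xj_h.
Qed.

Lemma i_v n x y (c d : X n.+1 x y) : t c = s d -> Xi (v c d) = v (Xi d) (Xi c).
Proof.
move=> k; apply/esym/i_uniq; rewrite ?s_v ?t_v ?s_i ?t_i //.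
rewrite v_assoc ?s_v ?s_i ?t_i // -(v_assoc (c := d) (d := Xi d)) ?s_i ?t_i //.
by rewrite v_ir v1l ?v_ir ?s_i.
Qed.

Lemma i_j n x y (a : X 0 x y) : Xi (Xj n.+1 a) = Xj _ a.
Proof. by apply/esym/i_uniq; rewrite ?Xs_j // v1l ?Xs_j. Qed.

Lemma conj_h n x y z (p q c : X n.+1 x y) (d : X n.+1 y z) :
  s c = s p -> t c = s q ->
  Xh (conj_cell p q c) d =
  conj_cell (Xh p (Xj _ (s d))) (Xh q (Xj _ (t d))) (Xh c d).
Proof.
move=> sc tc; rewrite /conj_cell i_h i_j !h_v ?Xs_j ?t_v ?t_i //.
  by rewrite v1l // v1r.
by rewrite Xs_j.
Qed.

Lemma conj_conj n x y (p q p' q' c : X n.+1 x y) :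
  s c = s p -> t c = s q -> t p = s p' -> t q = s q' ->
  conj_cell (v p p') (v q q') c = conj_cell p' q' (conj_cell p q c).
Proof.
move=> sc tc tp tq; rewrite /conj_cell i_v //.
by rewrite -!v_assoc ?t_v ?t_i ?s_v ?s_i ?t_v ?t_i.
Qed.

(** Cells of dimension n + 2 of which only the source and target of dimension 1 are prescribed; this
    is what makes [v] a group law on them. *)
Record loop n x y (w : @pres_hom P x y) : Type := Loop {
  lval : X n.+1 x y;
  lvalP : s lval = hat w /\ t lval = hat w }.

Lemma loop_inj n x y w : injective (@lval n x y w).
Proof.
case=> c pc [d pd] /= E; rewrite E in pc *; congr Loop; exact: Prop_irrelevance.
Qed.

Variables (n : nat) (x y : pob P) (w : @pres_hom P x y).
Local Notation K := (loop n w).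

Lemma s_l (l : K) : s (lval l) = hat w. Proof. by case: l => ? []. Qed.
Lemma t_l (l : K) : t (lval l) = hat w. Proof. by case: l => ? []. Qed.

Definition loop1 : K := @Loop n x y w (Xj _ (hat w)) (conj (Xs_j _ _ _) (Xs_j _ _ _)).

Lemma loopM_subproof (l m : K) :
  s (v (lval l) (lval m)) = hat w /\ t (v (lval l) (lval m)) = hat w.
Proof. by rewrite s_v ?t_v ?s_l ?t_l. Qed.
Definition loopM (l m : K) : K := Loop (loopM_subproof l m).

Lemma loopV_subproof (l : K) :
  s (Xi (lval l)) = hat w /\ t (Xi (lval l)) = hat w.
Proof. by rewrite s_i t_i s_l t_l. Qed.
Definition loopV (l : K) : K := Loop (loopV_subproof l).

Lemma loopMA : associative loopM.
Proof. by move=> l m k; apply: loop_inj; rewrite /= v_assoc ?s_l ?t_l. Qed.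
Lemma loop1M : left_id loop1 loopM.
Proof. by move=> l; apply: loop_inj; rewrite /= v1l ?s_l. Qed.
Lemma loopM1 : right_id loop1 loopM.
Proof. by move=> l; apply: loop_inj; rewrite /= v1r ?t_l. Qed.
Lemma loopVM : left_inverse loop1 loopV loopM.
Proof. by move=> l; apply: loop_inj; rewrite /= v_il t_l. Qed.
Lemma loopMV : right_inverse loop1 loopV loopM.
Proof. by move=> l; apply: loop_inj; rewrite /= v_ir s_l. Qed.

HB.instance Definition _ := gen_eqMixin K.
HB.instance Definition _ := gen_choiceMixin K.
HB.instance Definition _ :=
  isGroup.Build K loopMA loop1M loopM1 loopVM loopMV.

Definition to_loop (c : X n.+1 x y) : K :=
  if pselect (s c = hat w /\ t c = hat w) is left h then Loop h else 1%g.

Lemma to_loopK (c : X n.+1 x y) :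
  s c = hat w -> t c = hat w -> lval (to_loop c) = c.
Proof. by move=> sc tc; rewrite /to_loop; case: pselect => // -[]. Qed.

Lemma lvalM (l m : K) : lval (l * m)%g = v (lval l) (lval m). Proof. by []. Qed.
Lemma lval1 : lval (1%g : K) = Xj _ (hat w). Proof. by []. Qed.

End Loops.

Section GroupLemmas.
Local Open Scope group_scope.

Lemma morph_monoid (G H : groupType) (f : G -> H) :
  {morph f : x y / x * y} -> monoid_morphism f.
Proof.
move=> fM; split=> //; apply: (@mulgI _ (f 1)).
by rewrite -fM !mulg1.
Qed.

End GroupLemmas.

(** * Boundaries of loops, right action on loops, and the loop carried by a cell *)

Section LoopMaps.
Local Open Scope group_scope.
Variables (N : option nat) (P : polygraph N).
Local Notation X := (@hcell N P).
Local Notation W := (@pres_hom P).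
Local Notation v := (Xv 0).
Local Notation s := (Xs Src).
Local Notation t := (Xs Tgt).
Local Notation "u ** w" := (pres_cmp u w) (at level 40, left associativity).

Section Fixed.
Variables (x y : pob P) (w : W x y).

Lemma lbd_subproof e n (l : loop n.+1 w) :
  s (Xbd e (lval l)) = hat w /\ t (Xbd e (lval l)) = hat w.
Proof. by rewrite !Xs_bd s_l t_l. Qed.
Definition lbd e n (l : loop n.+1 w) : loop n w := Loop (lbd_subproof e l).

Lemma lid_subproof n (l : loop n w) :
  s (Xid (lval l)) = hat w /\ t (Xid (lval l)) = hat w.
Proof. by rewrite !Xs_id s_l t_l. Qed.
Definition lid n (l : loop n w) : loop n.+1 w := Loop (lid_subproof l).

Lemma lval_bd e n (l : loop n.+1 w) : lval (lbd e l) = Xbd e (lval l).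
Proof. by []. Qed.

Lemma lval_id n (l : loop n w) : lval (lid l) = Xid (lval l).
Proof. by []. Qed.

Lemma lbdM e n : {morph @lbd e n : l m / l * m}.
Proof. by move=> l m; apply: loop_inj; rewrite /= bd_v ?s_l ?t_l. Qed.

Lemma lidM n : {morph @lid n : l m / l * m}.
Proof. by move=> l m; apply: loop_inj; rewrite /= id_v ?s_l ?t_l. Qed.

HB.instance Definition _ e n :=
  isUMagmaMorphism.Build _ _ (@lbd e n) (morph_monoid (@lbdM e n)).
HB.instance Definition _ n :=
  isUMagmaMorphism.Build _ _ (@lid n) (morph_monoid (@lidM n)).

Fixpoint llift n (l : loop 0 w) : loop n w :=
  if n is k.+1 return loop n w then lid (llift k l) else l.

Fixpoint llift1 n (l : loop 1 w) : loop n.+1 w :=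
  if n is k.+1 return loop n.+1 w then lid (llift1 k l) else l.

(* A loop of index [n] has dimension [n + 2]; these are its source and target of
   dimension 2. *)
Fixpoint lbd2 e n : loop n w -> loop 0 w :=
  match n with 0 => id | k.+1 => fun l => lbd2 e (lbd e l) end.

Lemma lliftM n : {morph llift n : l m / l * m}.
Proof. by elim: n => //= n IH l m; rewrite IH gmulfM. Qed.
Lemma llift1M n : {morph llift1 n : l m / l * m}.
Proof. by elim: n => //= n IH l m; rewrite IH gmulfM. Qed.
Lemma lbd2M e n : {morph @lbd2 e n : l m / l * m}.
Proof. by elim: n => //= n IH l m; rewrite gmulfM IH. Qed.

HB.instance Definition _ n :=
  isUMagmaMorphism.Build _ _ (llift n) (morph_monoid (@lliftM n)).
HB.instance Definition _ e n :=
  isUMagmaMorphism.Build _ _ (@lbd2 e n) (morph_monoid (@lbd2M e n)).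

Lemma lbd_one e n : lbd e (1 : loop n.+1 w) = 1.
Proof. exact: gmulf1. Qed.

Lemma lbd_inv e n (l : loop n.+1 w) : lbd e l^-1 = (lbd e l)^-1.
Proof. exact: gmulfV. Qed.

Lemma lid_one n : lid (1 : loop n w) = 1.
Proof. exact: gmulf1. Qed.

Lemma lid_inv n (l : loop n w) : lid l^-1 = (lid l)^-1.
Proof. exact: gmulfV. Qed.

Lemma lbd2_one e n : lbd2 e (1 : loop n w) = 1.
Proof. exact: gmulf1. Qed.

Lemma lbd2_inv e n (l : loop n w) : lbd2 e l^-1 = (lbd2 e l)^-1.
Proof. exact: gmulfV. Qed.

Lemma llift_one n : llift n (1 : loop 0 w) = 1.
Proof. exact: gmulf1. Qed.

Lemma lbd_id e n (l : loop n w) : lbd e (lid l) = l.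
Proof. by apply: loop_inj; rewrite /= Xbd_id. Qed.

Lemma lbd_bd e e' n (l : loop n.+2 w) : lbd e (lbd e' l) = lbd e (lbd Src l).
Proof. by apply: loop_inj; rewrite /= Xbd2. Qed.

Lemma lbd2_lift e n (l : loop 0 w) : lbd2 e (llift n l) = l.
Proof. by elim: n => //= n IH; rewrite lbd_id. Qed.

Lemma lbd2_lift1 e n (l : loop 1 w) : lbd2 e (llift1 n l) = lbd e l.
Proof. by elim: n => //= n IH; rewrite lbd_id. Qed.

Lemma lbd2_bd e e' n (l : loop n.+2 w) : lbd2 e (lbd e' l) = lbd2 e l.
Proof. by rewrite /= lbd_bd -(lbd_bd _ e). Qed.

Lemma bI1 e n (l : loop n.+1 w) :
  bI e 1 (lval l) = Xid (lval (llift n (lbd2 e l))).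
Proof.
elim: n l => [|n IH] l; first by [].
by rewrite bI_high // -[Xbd e (lval l)]/(lval (lbd e l)) IH.
Qed.

(* Both products are the 2-composite of [l] and [m], by the exchange law. *)
Lemma peiffer n (l m : loop n.+1 w) : lbd2 Tgt l = 1 -> lbd2 Src m = 1 ->
  l * m = m * l.
Proof.
move=> l1 m1; have n1 : (0 < 1 <= n.+1)%N by [].
have El : bI Tgt 1 (lval l) = Xj _ (hat w) by rewrite bI1 l1 llift_one.
have Em : bI Src 1 (lval m) = Xj _ (hat w) by rewrite bI1 m1 llift_one.
have k : comp 1 (lval l) (lval m) by rewrite /comp El Em.
have jj e : bI e 1 (Xj n.+2 (hat w)) = Xj _ (hat w).
  by have := bI1 e (1 : loop n.+1 w); rewrite lbd2_one llift_one.
have k1 : comp 1 (Xj n.+2 (hat w)) (lval m) by rewrite /comp jj Em.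
have k2 : comp 1 (lval l) (Xj n.+2 (hat w)) by rewrite /comp jj El.
have vm : Xv 1 (Xj n.+2 (hat w)) (lval m) = lval m by rewrite -{1}Em Xv1l.
have vl : Xv 1 (lval l) (Xj n.+2 (hat w)) = lval l by rewrite -El Xv1r.
have c0 : comp 0 (Xv 1 (Xj n.+2 (hat w)) (lval m)) (Xv 1 (lval l) (Xj n.+2 (hat w))).
  by rewrite vm vl; apply/comp0P; rewrite t_l s_l.
have [_ E] := Xvv n1 k1 k2 c0.
apply: loop_inj; rewrite !lvalM.
rewrite -{2}vm -{2}vl E v1l ?s_l // v1r ?t_l //.
by rewrite (XvE (j := 1)) // El i_j v1r ?t_l.
Qed.

End Fixed.

Lemma bd_lift e n x y (c : X 1 x y) : Xbd e (Xlift n.+1 c) = Xlift n c.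
Proof. exact: Xbd_id. Qed.

Lemma bd_j e n x y (a : X 0 x y) : Xbd e (Xj n.+1 a) = Xj n a.
Proof. exact: Xbd_id. Qed.

Section Action.
Variables (x0 x y : pob P) (u : W x0 x).

(** Whiskering by [a] on the right, then renormalisation. The class [w] is an argument of its own,
    the value being 1 when it differs from [u ** cls0 a]; iterated actions then need no transport
    along associativity of [**]. The same holds for [base]. *)
Definition act n (l : loop n u) (a : X 0 x y) (w : W x0 y) : loop n w :=
  to_loop w (conj_cell (Xlift n (nf u a)) (Xlift n (nf u a))
               (Xh (lval l) (Xj n.+1 a))).

Definition base n (f : X n.+1 x y) (w : W x0 y) : loop n w :=
  to_loop w (conj_cell (Xlift n (nf u (s f))) (Xlift n (nf u (t f)))
               (Xh (Xj n.+1 (hat u)) f)).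

Lemma lval_act n (l : loop n u) (a : X 0 x y) w : u ** cls0 a = w ->
  lval (act l a w) = conj_cell (Xlift n (nf u a)) (Xlift n (nf u a))
               (Xh (lval l) (Xj n.+1 a)).
Proof.
by move=> <-; rewrite to_loopK // ?s_conj ?t_conj ?Xs_lift ?t_nf ?s_nf ?Xs_h
  ?s_l ?t_l ?Xs_j.
Qed.

Lemma lval_base n (f : X n.+1 x y) w : u ** cls f = w ->
  lval (base f w) = conj_cell (Xlift n (nf u (s f))) (Xlift n (nf u (t f)))
               (Xh (Xj n.+1 (hat u)) f).
Proof.
by move=> <-; rewrite to_loopK // ?s_conj ?t_conj ?Xs_lift ?t_nf ?s_nf ?Xs_h
  ?s_l ?t_l ?Xs_j ?cls_s.
Qed.

Lemma actM n (a : X 0 x y) w :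
  {morph (fun l : loop n u => act l a w) : l m / l * m}.
Proof.
(* For any other [w] the action is constantly 1, because [hat] is injective. *)
have [E|E] := pselect (u ** cls0 a = w); last first.
  suff a1 (l : loop n u) : act l a w = 1 by move=> l m; rewrite !a1 mulg1.
  rewrite /act /to_loop; case: pselect => // h; exfalso; move: h.1.
  rewrite s_conj ?Xs_lift ?t_nf ?s_nf ?Xs_h ?s_l ?t_l ?Xs_j // => h1.
  by case: E; rewrite -[LHS]cls_hat h1 cls_hat.
move=> l m; apply: loop_inj; rewrite lvalM !lval_act //.
rewrite conj_v ?Xs_lift ?s_nf ?Xs_h ?s_l ?t_l ?Xs_j // h_v ?s_l ?t_l ?Xs_j //.
by rewrite (v1l (c := Xj _ a)) ?Xs_j.
Qed.

Lemma act1 n a w : act (1 : loop n u) a w = 1.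
Proof. exact: (morph_monoid (@actM n a w)).1. Qed.

Lemma actV n (l : loop n u) a w : act l^-1 a w = (act l a w)^-1.
Proof. by apply/esym/mulg1_eq; rewrite -actM mulgV act1. Qed.

Lemma lbd_act e n (l : loop n.+1 u) a w : u ** cls0 a = w ->
  lbd e (act l a w) = act (lbd e l) a w.
Proof.
move=> E; apply: loop_inj; rewrite lval_bd !lval_act //.
by rewrite conj_bd ?Xs_lift ?s_nf ?Xs_h ?s_l ?t_l ?Xs_j // !bd_lift Xbd_h bd_j.
Qed.

Lemma lid_act n (l : loop n u) a w : u ** cls0 a = w ->
  lid (act l a w) = act (lid l) a w.
Proof.
move=> E; apply: loop_inj; rewrite lval_id !lval_act //.
by rewrite conj_id ?Xs_lift ?s_nf ?Xs_h ?s_l ?t_l ?Xs_j // Xid_h.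
Qed.

Lemma base_v n (f g : X n.+1 x y) w : u ** cls f = w -> t f = s g ->
  base (v f g) w = base f w * base g w.
Proof.
move=> E k; have Eg : u ** cls g = w by rewrite -E /cls -k cls_s.
apply: loop_inj; rewrite lvalM !lval_base // ?s_v ?t_v //;
  last by rewrite /cls s_v.
rewrite k conj_v ?Xs_lift ?s_nf ?Xs_h ?Xs_j ?k //.
by rewrite h_v ?Xs_j // (v1l (c := Xj _ _)) ?Xs_j.
Qed.

Lemma lbd_base e n (f : X n.+2 x y) w : u ** cls f = w ->
  lbd e (base f w) = base (Xbd e f) w.
Proof.
move=> E; apply: loop_inj; rewrite lval_bd !lval_base ?cls_bd //.
rewrite conj_bd ?Xs_lift ?s_nf ?Xs_h ?Xs_j // !bd_lift Xbd_h !Xs_bd.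
by rewrite bd_j.
Qed.

Lemma base_id n (f : X n.+1 x y) w : u ** cls f = w ->
  base (Xid f) w = lid (base f w).
Proof.
move=> E; apply: loop_inj; rewrite lval_id !lval_base ?Xs_id //.
  by rewrite conj_id ?Xs_lift ?s_nf ?Xs_h ?Xs_j // Xid_h.
by rewrite -E -(cls_bd Src) Xbd_id.
Qed.

Lemma base_j n (a : X 0 x y) w : u ** cls0 a = w -> base (Xj n.+1 a) w = 1.
Proof.
move=> E; apply: loop_inj; rewrite lval_base ?/cls ?Xs_j // lval1 -Xj_h.
have -> : Xh (hat u) a = s (Xlift n (nf u a)) by rewrite Xs_lift s_nf.
by rewrite conj_j Xs_lift t_nf E.
Qed.

(** By exchange, both sides are the conjugate of the single cell [Xh (lval l) f]. *)
Lemma act_base n (l : loop n u) (f : X n.+1 x y) w : u ** cls f = w ->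
  act l (s f) w * base f w = base f w * act l (t f) w.
Proof.
move=> E; apply: loop_inj; rewrite !lvalM lval_base // !lval_act ?cls_s //.
rewrite !conj_v ?Xs_lift ?s_nf ?Xs_h ?s_l ?t_l ?Xs_j //.
rewrite !h_v ?s_l ?t_l ?Xs_j //.
by rewrite v1r ?t_l // !v1l ?s_l // v1r.
Qed.

Lemma base_i n (f : X n.+1 x y) w : u ** cls f = w ->
  base (Xi f) w = (base f w)^-1.
Proof.
move=> E; apply/esym/mulg1_eq; rewrite -base_v ?s_i //.
by rewrite v_ir base_j.
Qed.
End Action.

(** The action is strict because [nf] normalises a concatenation from left to right, as stated by
    [nf_h]. *)
Lemma act_act n x0 x y z (u : W x0 x) (l : loop n u) (a : X 0 x y) (b : X 0 y z)
    w w' : u ** cls0 a = w -> w ** cls0 b = w' ->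
  act (act l a w) b w' = act l (Xh a b) w'.
Proof.
move=> E E'; apply: loop_inj.
rewrite !lval_act // ?cls0_h -?mulWA ?E ?E' // nf_h lift_v ?E; last first.
  by rewrite Xs_h Xs_id t_nf s_nf E.
rewrite lift_h lift_id conj_conj ?Xs_h ?Xs_lift ?s_l ?t_l ?s_nf ?t_nf ?Xs_j ?XhA ?E //.
rewrite conj_h ?Xs_lift ?s_nf ?Xs_h ?s_l ?t_l ?Xs_j //.
by rewrite Xj_h XhA.
Qed.

(** The concatenation is normalised through [w], and exchange separates the two factors. This is the
    derivation rule of brackets in multiplicative form: [act] plays right multiplication, and
    passing from [u] to [w] plays left multiplication. *)
Lemma base_h n x0 x y z (u : W x0 x) (f : X n.+1 x y) (g : X n.+1 y z) w w' :
  u ** cls f = w -> w ** cls g = w' ->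
  base u (Xh f g) w' = act (base u f w) (s g) w' * base w g w'.
Proof.
move=> E E'; apply: loop_inj; rewrite lvalM lval_base ?cls_h -?mulWA ?E //.
rewrite !Xs_h !nf_h !cls_s E !lift_v;
  try by rewrite Xs_h Xs_id t_nf s_nf cls_s E.
rewrite !lift_h !lift_id conj_conj;
  try by rewrite !Xs_h !Xs_j !Xs_lift ?s_nf ?t_nf ?cls_s ?E ?XhA.
rewrite lval_act ?cls_s // !lval_base // conj_v; first last.
- by rewrite Xs_h Xs_j Xs_lift s_nf.
- by rewrite Xs_h Xs_j Xs_lift s_nf.
- by rewrite !Xs_h Xs_j ?t_conj ?Xs_lift ?s_nf ?t_nf ?Xs_h ?Xs_j ?cls_s ?E.
- by rewrite !Xs_h Xs_j ?s_conj ?Xs_lift ?s_nf ?t_nf ?Xs_h ?Xs_j ?cls_s ?E.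
have sf : s (Xh (Xj n.+1 (hat u)) f) = s (Xlift n (nf u (s f))).
  by rewrite Xs_h Xs_j Xs_lift s_nf.
have tf : t (Xh (Xj n.+1 (hat u)) f) = s (Xlift n (nf u (t f))).
  by rewrite Xs_h Xs_j Xs_lift s_nf.
have tA : t (conj_cell (Xlift n (nf u (s f))) (Xlift n (nf u (t f)))
    (Xh (Xj n.+1 (hat u)) f)) = hat w by rewrite t_conj // Xs_lift t_nf cls_s E.
congr conj_cell; rewrite -XhA -conj_h // h_v ?Xs_j ?tA //.
by rewrite v1r ?v1l ?tA.
Qed.
End LoopMaps.

(** * Contraction of 2-cells *)

Section Contraction.
Local Open Scope group_scope.
Variables (N : option nat) (P : polygraph N).
Local Notation cell := (fcell (@gen P)).
Local Notation X := (@hcell N P).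
Local Notation W := (@pres_hom P).
Local Notation v := (Xv 0).
Local Notation s := (Xs Src).
Local Notation t := (Xs Tgt).
Local Notation "u ** w" := (pres_cmp u w) (at level 40, left associativity).
Hypothesis acP : acyclic P.

Lemma fill n x y (c d : X n.+1 x y) : dim_le n.+3 N ->
  (forall e, Xbd e c = Xbd e d) ->
  exists A : X n.+2 x y, Xbd Src A = c /\ Xbd Tgt A = d.
Proof.
have [f [vf ->]] := hcellP c; have [g [vg ->]] := hcellP d.
move=> nN par; case: (acP (f := f) (g := g) nN).
  by split=> // e; have := par e; rewrite !Xbd_mk => /mkP.
move=> A [vA sA tA]; exists (mk vA); rewrite !Xbd_mk.
by split; apply/mkP.
Qed.

Lemma fill_loop0 x y (w : W x y) (l m : loop 0 w) : dim_le 3 N ->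
  exists L : loop 1 w, lbd Src L = l /\ lbd Tgt L = m.
Proof.
move=> N3; have [|A [sA tA]] := fill (c := lval l) (d := lval m) N3.
  by case; [exact: etrans (s_l l) (esym (s_l m))|exact: etrans (t_l l) (esym (t_l m))].
have hA : s A = hat w /\ t A = hat w.
  by rewrite -!(Xs_bd _ Src A) sA s_l t_l.
by exists (Loop hA); split; apply: loop_inj.
Qed.

Lemma fill_loop n x y (w : W x y) (l m : loop n.+1 w) : dim_le n.+4 N ->
  (forall e, lbd e l = lbd e m) ->
  exists L : loop n.+2 w, lbd Src L = l /\ lbd Tgt L = m.
Proof.
move=> N3 par; have [|A [sA tA]] := fill (c := lval l) (d := lval m) N3.
  by move=> e; rewrite -!lval_bd par.
have hA : s A = hat w /\ t A = hat w.
  by rewrite -!(Xs_bd _ Src A) sA s_l t_l.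
by exists (Loop hA); split; apply: loop_inj.
Qed.

Definition null x y (w : W x y) (l : loop 0 w) : loop 1 w :=
  if pselect (exists L : loop 1 w, lbd Src L = l /\ lbd Tgt L = 1) is left h
  then proj1_sig (cid h) else 1.

Lemma nullP x y (w : W x y) (l : loop 0 w) : dim_le 3 N ->
  lbd Src (null l) = l /\ lbd Tgt (null l) = 1.
Proof.
move=> N3; rewrite /null; case: pselect => [h|[]]; first by case: cid.
exact: fill_loop0.
Qed.

(** [theta_form] recurses over all dimensions at once and must feed [base] with a 2-cell in each of
    them; outside dimension 2, and on invalid cells, an identity serves as default. *)
Definition class2 n x y : cell n x y -> X 1 x y :=
  match n with
  | 1 => fun f => if pselect (valid f) is left vf then mk vf
                  else Xid (mk0 (src1 f))
  | _ => fun f => Xid (mk0 (src1 f))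
  end.

(* On 2-cells, a chosen 3-cell from [base u f] to the identity, made compatible
   with composition by recursion on the syntax of [f]; the values on higher
   cells are irrelevant. *)
Fixpoint theta_form n x y (f : cell n x y) x0 :
    forall (u : W x0 x) (w : W x0 y), loop 1 w :=
  match f in fcell _ _ x y return forall (u : W x0 x) (w : W x0 y), loop 1 w with
  | @Gen _ _ _ _ _ a => fun u w => null (base u (class2 (Gen a)) w)
  | @One _ _ _ => fun u w => 1
  | @Idc _ _ _ _ _ f => fun u w => 1
  | @Inv _ _ _ _ _ f => fun u w => (theta_form f u w)^-1
  | @Hcomp _ _ _ _ _ _ f g => fun u w =>
      act (theta_form f u (u ** class1 f)) (mk0 (src1 g)) w *
      theta_form g (u ** class1 f) w
  | @Vcomp _ _ _ _ _ _ f g => fun u w => theta_form f u w * theta_form g u w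
  end.

Lemma theta_inv n x y (f : cell n.+1 x y) x0 (u : W x0 x) w :
  theta_form (Inv f) u w = (theta_form f u w)^-1.
Proof. by []. Qed.

Lemma theta_hcomp n x y z (f : cell n x y) (g : cell n y z) x0 (u : W x0 x) w :
  theta_form (Hcomp f g) u w =
  act (theta_form f u (u ** class1 f)) (mk0 (src1 g)) w *
  theta_form g (u ** class1 f) w.
Proof. by []. Qed.

Lemma cls0_src1 n x y (f : cell n x y) : cls0 (mk0 (src1 f)) = class1 f.
Proof. exact: cls0_mk. Qed.

Section Dim3.
Hypothesis N3 : dim_le 3 N.

(** Every clause of [theta_form] copies the behaviour of [base] under the corresponding operation,
    so a contraction has to be chosen on generators only. *)
Lemma theta_form_bd x y (f : cell 1 x y) (vf : valid f) x0 (u : W x0 x) w :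
  u ** class1 f = w ->
  lbd Src (theta_form f u w) = base u (mk vf) w /\ lbd Tgt (theta_form f u w) = 1.
Proof.
pose Q n x y : cell n x y -> Prop := match n with
  | 1 => fun f => forall (vf : valid f) x0 (u : W x0 x) w, u ** class1 f = w ->
    lbd Src (theta_form f u w) = base u (mk vf) w /\
    lbd Tgt (theta_form f u w) = 1
  | _ => fun=> True end.
suff : forall n x y (f : cell n x y), Q n x y f by move/(_ _ _ _ f); apply.
move=> {x y f vf x0 u w} n x y f; elim: n x y / f => //.
- move=> [|[|n]] x y a //= vf x0 u w E.
  have [-> ->] := nullP (base u (class2 (Gen a)) w) N3; split=> //.
  rewrite /class2; case: pselect => // vf'; congr (base u _ w).
  exact/mkP/eqc_refl.
- move=> [|n] x y f _ // vf x0 u w E; rewrite /= !lbd_one.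
  have vf' := validE vf.
  rewrite (_ : mk vf = Xid (mk vf')); last by rewrite Xid_mk;
    apply/mkP/eqc_refl.
  by split=> //; apply: esym; apply: (@base_j N P _ _ _ u 0);
    rewrite -E cls0_mk.
- move=> [|n] x y f IH // vf x0 u w E; have vf' : valid f := validE vf.
  have Ew : u ** class1 f = w by rewrite -E class1_inv //;
    apply: valid_coherent.
  have [sf tf] := IH vf' x0 u w Ew.
  rewrite (_ : mk vf = Xinv (mk vf')); last by rewrite Xinv_mk;
    apply/mkP/eqc_refl.
  by rewrite Xinv_0 base_i ?cls_mk // theta_inv !lbd_inv sf tf invg1.
- move=> [|[|n]] x y z f IHf g IHg // vf x0 u w E; have [vf' vg'] := validE vf.
  rewrite class1_hcomp -mulWA in E.
  have [sf tf] := IHf vf' x0 u _ erefl; have [sg tg] := IHg vg' x0 _ _ E.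
  rewrite (_ : mk vf = Xh (mk vf') (mk vg')); last by rewrite Xh_mk;
    apply/mkP/eqc_refl.
  rewrite (base_h (w := u ** class1 f)) ?cls_mk // Xs_mk theta_hcomp !lbdM.
  by rewrite !lbd_act ?cls0_src1 // sf tf sg tg act1 mulg1.
- move=> [|n] i x y f IHf g IHg // vf x0 u w E;
  have [im vf' vg' c] := validE vf.
  move: im; rewrite leqn0 => /eqP i0; subst i.
  have := valid_coherent vf => /= -[_ _ Ec]; rewrite class1_vcomp in E.
  have [sf tf] := IHf vf' x0 u w E; rewrite Ec in E.
  have [sg tg] := IHg vg' x0 u w E.
  rewrite (_ : mk vf = v (mk vf') (mk vg')); last by rewrite (Xv_mk _ _ vf);
    apply/mkP/eqc_refl.
  have k : t (mk vf') = s (mk vg') by apply/comp0P/comp_mk.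
  rewrite base_v ?cls_mk ?Ec //.
  by rewrite !lbdM sf tf sg tg mulg1.
Qed.

Lemma act_one n x0 y (u w : W x0 y) (l : loop n u) (E : u = w) :
  act l (Xone 0 y) w = ecast w (loop n w) E l.
Proof.
case: w / E; apply: loop_inj; rewrite lval_act ?cls0_one ?mulW1 //.
have -> : nf u (Xone 0 y) = Xid (hat u) by rewrite nf_mk.
by rewrite lift_id /conj_cell i_j Xj_one Xh1r v1l ?s_l // v1r ?t_l //.
Qed.

(* Peiffer: a 3-cell [m] from [base u f] to the identity conjugates as
   [base u f] itself does. *)
Lemma act_exchange x0 x y (u : W x0 x) w (l : loop 1 u) (f : X 1 x y) (m : loop 1 w) :
  u ** cls f = w -> lbd Tgt l = 1 -> lbd Src m = base u f w ->
  act l (s f) w * m = m * act l (t f) w.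
Proof.
move=> E l1 mf; have := act_base l (f := Xid f) (w := w).
rewrite base_id // !Xs_id => H.
have {}H : act l (s f) w * lid (base u f w) = lid (base u f w) * act l (t f) w.
  by apply: H; rewrite -E -(cls_bd Src) Xbd_id.
(* The first factor exchanges the two actions by [act_base]. The second has a trivial source, and
   the loop to be moved across it has a trivial target, so they commute by Peiffer. *)
have -> : m = lid (base u f w) * ((lid (base u f w))^-1 * m) by rewrite mulgA mulgV mul1g.
rewrite mulgA H -!mulgA; congr (_ * _); rewrite [RHS]mulgA.
apply: (@peiffer _ _ _ _ _ 0).
  by rewrite -[LHS]/(lbd Tgt (act l (t f) w)) lbd_act ?cls_s // l1 act1.
by rewrite -[LHS]/(lbd Src _) lbdM lbd_inv lbd_id mf mulVg.
Qed.

(** All axioms reduce to group laws and action laws, except the exchange between concatenation and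
    composition along 1-cells, which is [act_exchange]. *)
Lemma theta_form_eqc n x y (f g : cell n x y) : eqc f g -> n = 1%N ->
  forall x0 (u : W x0 x) w, u ** class1 f = w ->
  theta_form f u w = theta_form g u w.
Proof.
pose Q n x y (f g : cell n x y) := n = 1%N -> forall x0 (u : W x0 x) w,
  u ** class1 f = w -> theta_form f u w = theta_form g u w.
have VC m i x' y' (h k : cell m.+1 x' y') : valid (Vcomp i h k) ->
  class1 h = class1 k.
  by move/valid_coherent => -[].
move=> fg; move: n x y f g fg;
  apply: (@eqc_mind P (fun _ _ _ _ => True) Q) => //.
- move=> n x y f g fg IH n1 x0 u w E; have [_ _ Ec] := eqc_coherent fg.
  by rewrite IH // Ec.
- move=> n x y f g h fg IH gh IH' n1 x0 u w E; have [_ _ Ec] := eqc_coherent fg.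
  by rewrite IH // IH' // -Ec.
- move=> n x y f g fg IH n1 x0 u w E /=; have [cf _ _] := eqc_coherent fg.
  by rewrite IH // -E class1_inv.
- move=> n x y z f f' g g' ff IH gg IH' n1 x0 u w E /=.
  have [_ _ Ec] := eqc_coherent ff; rewrite class1_hcomp -mulWA in E.
  by rewrite IH // IH' // (eqc_mk0_src1 gg) Ec.
- move=> n i x y f f' g g' vv _ ff IH gg IH' n1 x0 u w;
  rewrite class1_vcomp => E /=.
  by rewrite IH // IH' // -(VC _ _ _ _ _ _ vv).
- move=> n x y z r f g h _ _ _ _ _ _ n1 x0 u w E /=.
  rewrite !class1_hcomp -!mulWA in E.
  by rewrite actM act_act ?cls0_src1 ?class1_hcomp -?mulWA // src1_hcomp mk0_hcomp mulgA.
- move=> n x y f _ _ n1 x0 u w E; subst n.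
  by rewrite /= act1 mul1g mulW1.
- move=> n x y f _ _ n1 x0 u w E; subst n; rewrite class1_hcomp mulW1 in E.
  rewrite [LHS]/= mulg1 (_ : mk0 _ = Xone 0 y); last exact/mkP/eqc_refl/valid1.
  by rewrite act_one; case: w / E.
- by move=> n i x y f g h vv _ n1 x0 u w E /=; rewrite mulgA.
- move=> n i x y f im _ _ [n1] x0 u w E; subst n.
  by move: im; rewrite leqn0 => /eqP i0; subst i; rewrite /= mul1g.
- move=> n i x y f im _ _ [n1] x0 u w E; subst n.
  by move: im; rewrite leqn0 => /eqP i0; subst i; rewrite /= mulg1.
- move=> n i x y z f f' g g' v1 _ v2 _ [n1] x0 u w; subst n.
  rewrite class1_hcomp !class1_vcomp -mulWA => E /=.
  have [_ vf vf' _] := validE v1; have [im vg vg' c] := validE v2.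
  rewrite !class1_vcomp -(VC _ _ _ _ _ _ v1) actM -!mulgA; congr (_ * _).
  rewrite !mulgA; congr (_ * _).
  have Ef' : u ** class1 f' = u ** class1 f by rewrite (VC _ _ _ _ _ _ v1).
  have [_ tT] := theta_form_bd vf' Ef'; have [sG _] := theta_form_bd vg E.
  (* Once the outer factors are cancelled, what remains is to move the contraction of [f'] across
     that of [g]; on the way, the 1-cell acting on it changes from the source of [g] to its
     target. *)
  have := act_exchange _ tT sG; rewrite cls_mk => /(_ E); rewrite Xs_mk.
  move: im; rewrite leqn0 => /eqP i0; subst i.
  have -> : t (mk vg) = mk0 (src1 g').
    by rewrite -(Xs_mk vg'); apply/comp0P/comp_mk.
  by [].
- move=> n i j x y f f' g g' ij vv _ [n1] x0 u w; subst n.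
  have [_ /validE[jm _ _ _] _ _] := validE vv.
  by have := leq_trans ij jm; rewrite ltn0.
- by move=> n x y z f g _ _ _ _ n1 x0 u w E; rewrite /= act1 mulg1.
- by move=> n x y f _ _ n1 x0 u w E; rewrite /= mulgV.
- by move=> n x y f _ _ n1 x0 u w E; rewrite /= mulVg.
Qed.

End Dim3.
End Contraction.

(** * Flat loops *)

Section GroupLemmas.
Local Open Scope group_scope.

(** The group computation behind [flatten_merge], where [r] and [q] are the lifted targets of [f]
    and [g] and both commutations come from Peiffer. *)
Lemma merge_conj (H : groupType) (a1 a2 f r b1 b2 g q : H) :
  commute (a2^-1 * r) (g * q^-1) ->
  commute (a1^-1 * f * r^-1 * a2) b1 ->
  (a1 * b1)^-1 * (f * g) * (r * q)^-1 * (a2 * b2) =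
  a1^-1 * f * r^-1 * a2 * (b1^-1 * g * q^-1 * b2).
Proof.
move=> c1 c2; set m := a1^-1 * f * r^-1 * a2 in c2 *.
have -> : f = a1 * m * a2^-1 * r by rewrite /m !mulgA mulgV mul1g mulgK mulgVK.
have -> : (a1 * b1)^-1 * (a1 * m * a2^-1 * r * g) * (r * q)^-1 * (a2 * b2) =
    b1^-1 * m * (a2^-1 * r * (g * q^-1)) * r^-1 * a2 * b2.
  by rewrite !invgM !mulgA mulgVK.
by clearbody m; rewrite c1 !mulgA -(commuteV c2) mulgK mulgVK.
Qed.

End GroupLemmas.

Section Linear.
Local Open Scope group_scope.
Variables (N : option nat) (P : polygraph N).
Local Notation cell := (fcell (@gen P)).
Local Notation X := (@hcell N P).
Local Notation W := (@pres_hom P).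
Local Notation v := (Xv 0).
Local Notation s := (Xs Src).
Local Notation t := (Xs Tgt).
Local Notation "u ** w" := (pres_cmp u w) (at level 40, left associativity).
Hypothesis acP : acyclic P.
Hypothesis N3 : dim_le 3 N.

Definition theta x0 x y (u : W x0 x) (c : X 1 x y) (w : W x0 y) : loop 1 w :=
  theta_form (rep c) u w.

Lemma theta_mk x0 x y (u : W x0 x) (f : cell 1 x y) (vf : valid f) w :
  u ** class1 f = w -> theta u (mk vf) w = theta_form f u w.
Proof.
move=> E; apply: (theta_form_eqc acP N3) => //; first exact: rep_mk.
by have [_ _ ->] := eqc_coherent (rep_mk vf).
Qed.

Lemma theta_bd x0 x y (u : W x0 x) (c : X 1 x y) w : u ** cls c = w ->
  lbd Src (theta u c w) = base u c w /\ lbd Tgt (theta u c w) = 1.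
Proof.
have [f [vf ->]] := hcellP c; rewrite cls_mk => E; rewrite theta_mk //.
exact: theta_form_bd.
Qed.

Lemma theta_h x0 x y z (u : W x0 x) (c : X 1 x y) (d : X 1 y z) w w' :
  u ** cls c = w -> w ** cls d = w' ->
  theta u (Xh c d) w' = act (theta u c w) (s d) w' * theta w d w'.
Proof.
have [f [vf ->]] := hcellP c; have [g [vg ->]] := hcellP d.
rewrite Xh_mk !cls_mk => E E'; rewrite !theta_mk // ?class1_hcomp -?mulWA ?E //.
by rewrite theta_hcomp Xs_mk E.
Qed.

Lemma theta_v x0 x y (u : W x0 x) (c d : X 1 x y) w : u ** cls c = w ->
  t c = s d -> theta u (v c d) w = theta u c w * theta u d w.
Proof.
move=> E k; have E' : u ** cls d = w by rewrite -E /cls -k cls_s.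
move: E E' k; have [f [vf ->]] := hcellP c; have [g [vg ->]] := hcellP d.
rewrite !cls_mk => E E' /comp0P /comp_mk V; have {}V := V (leqnn _).
by rewrite (Xv_mk _ _ V) !theta_mk // class1_vcomp.
Qed.

Lemma theta_id x0 x y (u : W x0 x) (a : X 0 x y) w : u ** cls0 a = w ->
  theta u (Xid a) w = 1.
Proof.
have [f [vf ->]] := hcellP a; rewrite cls0_mk => E.
by rewrite Xid_mk theta_mk.
Qed.

Fixpoint bd2 e n x y : X n.+1 x y -> X 1 x y :=
  match n with 0 => id | k.+1 => fun c => bd2 e (Xbd e c) end.

Lemma s_bd2 e e' n x y (c : X n.+1 x y) : Xs e (bd2 e' c) = Xs e c.
Proof. by elim: n c => // n IH c; rewrite [bd2 _ _]/= IH Xs_bd. Qed.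

Lemma cls_bd2 e n x y (c : X n.+1 x y) : cls (bd2 e c) = cls c.
Proof. by rewrite /cls s_bd2. Qed.

Lemma bd2_v e n x y (c d : X n.+1 x y) : t c = s d ->
  bd2 e (v c d) = v (bd2 e c) (bd2 e d).
Proof. by elim: n c d => // n IH c d k; rewrite /= bd_v // IH // !Xs_bd. Qed.

Lemma bd2_h e n x y z (c : X n.+1 x y) (d : X n.+1 y z) :
  bd2 e (Xh c d) = Xh (bd2 e c) (bd2 e d).
Proof. by elim: n c d => // n IH c d; rewrite /= Xbd_h IH. Qed.

Lemma bd2_id e n x y (c : X n.+1 x y) : bd2 e (Xid c) = bd2 e c.
Proof. by rewrite /= Xbd_id. Qed.

Lemma bd2_bd e e' n x y (c : X n.+3 x y) : bd2 e (Xbd e' c) = bd2 e c.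
Proof. by rewrite /= Xbd2 -(Xbd2 _ e). Qed.

Lemma lbd2_base e n x0 x y (u : W x0 x) (c : X n.+1 x y) w : u ** cls c = w ->
  lbd2 e (base u c w) = base u (bd2 e c) w.
Proof.
elim: n c => // n IH c E; rewrite [LHS]/= lbd_base // IH // cls_bd //.
Qed.

Lemma llift_act n x0 x y (u : W x0 x) (l : loop 0 u) (a : X 0 x y) w :
  u ** cls0 a = w -> llift n (act l a w) = act (llift n l) a w.
Proof. by move=> E; elim: n => //= n ->; rewrite lid_act. Qed.

Lemma llift1_act n x0 x y (u : W x0 x) (l : loop 1 u) (a : X 0 x y) w :
  u ** cls0 a = w -> llift1 n (act l a w) = act (llift1 n l) a w.
Proof. by move=> E; elim: n => //= n ->; rewrite lid_act. Qed.

Lemma lbd2_act e n x0 x y (u : W x0 x) (l : loop n u) (a : X 0 x y) w :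
  u ** cls0 a = w -> lbd2 e (act l a w) = act (lbd2 e l) a w.
Proof. by move=> E; elim: n l => //= n IH l; rewrite lbd_act. Qed.

Definition flat n x y (w : W x y) (l : loop n.+1 w) :=
  lbd2 Src l = 1 /\ lbd2 Tgt l = 1.

(** A 3-cell [L] contracting [k] factors the lift of [k] as [L] times [L^-1 k]. The first factor has
    a trivial target and the second a trivial source, so each commutes with a flat loop by
    Peiffer. *)
Lemma flat_llift n x y (w : W x y) (l : loop n.+1 w) (k : loop 0 w) :
  flat l -> commute l (llift n.+1 k).
Proof.
move=> [sl tl]; have [sL tL] := nullP acP k N3.
have -> : llift n.+1 k =
    llift1 n (null k) * ((llift1 n (null k))^-1 * llift n.+1 k).
  by rewrite mulgA mulgV mul1g.
apply: commuteM; first by apply/commute_sym/peiffer; rewrite ?lbd2_lift1.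
by apply: peiffer; rewrite // lbd2M lbd2_inv lbd2_lift1 lbd2_lift sL mulVg.
Qed.

Section Straighten.
Variables (n : nat) (x y : pob P) (w : W x y).

(** Conjugation by [a1] and [a2] for the composition along 2-cells, written in the loop group by the
    Eckmann-Hilton formula: gluing along the target of [f] inserts the inverse of its lift. *)
Definition flatten (a1 a2 : loop 1 w) (f : loop n.+1 w) : loop n.+1 w :=
  (llift1 n a1)^-1 * f * (llift n.+1 (lbd2 Tgt f))^-1 * llift1 n a2.

Definition contracts (a1 a2 : loop 1 w) (f : loop n.+1 w) :=
  [/\ lbd Src a1 = lbd2 Src f, lbd Tgt a1 = 1,
      lbd Src a2 = lbd2 Tgt f & lbd Tgt a2 = 1].

Lemma flatten_flat a1 a2 f : contracts a1 a2 f -> flat (flatten a1 a2 f).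
Proof.
case=> s1 t1 s2 t2; rewrite /flat /flatten.
rewrite !lbd2M !lbd2_inv !lbd2_lift1 !lbd2_lift s1 t1 s2 t2.
by rewrite mulVg mul1g mulVg invg1 mul1g mulgV mulg1.
Qed.

Lemma flatten_merge a1 a2 f b1 b2 g : contracts a1 a2 f -> contracts b1 b2 g ->
  flatten (a1 * b1) (a2 * b2) (f * g) = flatten a1 a2 f * flatten b1 b2 g.
Proof.
move=> cf cg; have [_ tf] := flatten_flat cf; have [sf _] := flatten_flat cf.
have [[s1 t1 s2 t2] [s1' t1' s2' t2']] := (cf, cg).
rewrite /flatten lbd2M !llift1M lliftM; apply: merge_conj.
  apply/commute_sym/peiffer.
    by rewrite lbd2M lbd2_inv lbd2_lift mulgV.
  by rewrite lbd2M lbd2_inv lbd2_lift lbd2_lift1 s2 mulVg.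
apply/commute_sym/peiffer; first by rewrite lbd2_lift1.
exact: sf.
Qed.
End Straighten.

Definition straighten n x0 x y (u : W x0 x) (f : X n.+2 x y) (w : W x0 y) :
    loop n.+1 w :=
  flatten (theta u (bd2 Src f) w) (theta u (bd2 Tgt f) w) (base u f w).

Section M.
Variables (x0 x y : pob P) (u : W x0 x) (w : W x0 y).

Lemma straighten_contracts n (f : X n.+2 x y) : u ** cls f = w ->
  contracts (theta u (bd2 Src f) w) (theta u (bd2 Tgt f) w) (base u f w).
Proof.
move=> E; rewrite /contracts !lbd2_base //.
have [-> ->] := theta_bd (c := bd2 Src f) (etrans (congr1 _ (cls_bd2 _ _)) E).
by have [-> ->] := theta_bd (c := bd2 Tgt f) (etrans (congr1 _ (cls_bd2 _ _)) E).
Qed.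

Lemma straighten_flat n (f : X n.+2 x y) :
  u ** cls f = w -> flat (straighten u f w).
Proof. by move=> E; apply/flatten_flat/straighten_contracts. Qed.

Lemma straighten_id n (f : X n.+2 x y) : u ** cls f = w ->
  straighten u (Xid f) w = lid (straighten u f w).
Proof.
move=> E; rewrite /straighten /flatten !bd2_id base_id // !lidM !lid_inv.
by rewrite /= lbd_id.
Qed.

Lemma straighten_id0 (f : X 1 x y) :
  u ** cls f = w -> straighten u (Xid f) w = 1.
Proof.
move=> E; rewrite /straighten /flatten !bd2_id base_id // [lbd2 _ _]/= lbd_id.
by rewrite mulgK mulVg.
Qed.

Lemma lbd_straighten e n (f : X n.+3 x y) : u ** cls f = w ->
  lbd e (straighten u f w) = straighten u (Xbd e f) w.
Proof.
move=> E; rewrite /straighten /flatten !bd2_bd !lbdM !lbd_inv lbd_base //.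
rewrite !lbd2_base ?cls_bd // bd2_bd.
by rewrite [llift1 n.+1 _]/= [llift n.+2 _]/= [llift1 n.+1 _]/= !lbd_id.
Qed.

Lemma straighten_v n (f g : X n.+2 x y) : u ** cls f = w -> t f = s g ->
  straighten u (v f g) w = straighten u f w * straighten u g w.
Proof.
move=> E k; have E' : u ** cls g = w by rewrite -E /cls -k cls_s.
have k2 e : t (bd2 e f) = s (bd2 e g) by rewrite !s_bd2.
have Eb e (h : X n.+2 x y) : u ** cls h = w -> u ** cls (bd2 e h) = w.
  by rewrite cls_bd2.
rewrite /straighten !bd2_v // !theta_v ?base_v ?Eb //.
by apply: flatten_merge; apply: straighten_contracts.
Qed.
End M.

Lemma act_flatten n x0 x y (u : W x0 x) a1 a2 (f : loop n.+1 u) (a : X 0 x y) w :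
  u ** cls0 a = w ->
  act (flatten a1 a2 f) a w = flatten (act a1 a w) (act a2 a w) (act f a w).
Proof.
by move=> E; rewrite /flatten !actM !actV !llift1_act // lbd2_act // llift_act.
Qed.

Lemma act_contracts n x0 x y (u : W x0 x) a1 a2 (f : loop n.+1 u) (a : X 0 x y) w :
  u ** cls0 a = w -> contracts a1 a2 f ->
  contracts (act a1 a w) (act a2 a w) (act f a w).
Proof.
move=> E [s1 t1 s2 t2]; rewrite /contracts !lbd2_act // !lbd_act //.
by rewrite s1 t1 s2 t2 act1.
Qed.

Lemma straighten_h n x0 x y z (u : W x0 x) (f : X n.+2 x y) (g : X n.+2 y z) w w' :
  u ** cls f = w -> w ** cls g = w' ->
  straighten u (Xh f g) w' = act (straighten u f w) (s g) w' * straighten w g w'.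
Proof.
move=> E E'; have Ea : w ** cls0 (s g) = w' by [].
rewrite /straighten !bd2_h !(theta_h (w := w)) ?cls_bd2 // !s_bd2 (base_h E E').
rewrite act_flatten //; apply: flatten_merge; last exact: straighten_contracts.
by apply: act_contracts => //; apply: straighten_contracts.
Qed.

(* Normalised so as to vanish on identities. *)
Definition reduced n x y (w : W x y) (l : loop n.+1 w) : loop n.+1 w :=
  l * (lid (lbd Tgt l))^-1.

Section Flat.
Variables (x y : pob P) (w : W x y).

Lemma flat1 n : flat (1 : loop n.+1 w).
Proof. by rewrite /flat !lbd2_one. Qed.

Lemma flatM n (l m : loop n.+1 w) : flat l -> flat m -> flat (l * m).
Proof. by case=> sl tl [sm tm]; rewrite /flat !lbd2M sl tl sm tm mulg1. Qed.

Lemma flatV n (l : loop n.+1 w) : flat l -> flat l^-1.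
Proof. by case=> sl tl; rewrite /flat !lbd2_inv sl tl invg1. Qed.

Lemma flatC n (l m : loop n.+1 w) : flat l -> flat m -> l * m = m * l.
Proof. by case=> _ tl [sm _]; apply: peiffer. Qed.

Lemma flat_lid_bd e n (l : loop n.+1 w) : flat l -> flat (lid (lbd e l)).
Proof.
case=> sl tl; rewrite /flat [lbd2 Src _]/= [lbd2 Tgt _]/= !lbd_id.
case: n l sl tl => [|n] l sl tl.
  by case: e; [rewrite [lbd2 Src _]sl [lbd2 Tgt _]sl|rewrite [lbd2 Src _]tl [lbd2 Tgt _]tl].
by rewrite !lbd2_bd.
Qed.

Lemma flat_reduced n (l : loop n.+1 w) : flat l -> flat (reduced l).
Proof. by move=> fl; apply/flatM/flatV/flat_lid_bd. Qed.

Lemma reducedM n (l m : loop n.+1 w) : flat l -> flat m ->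
  reduced (l * m) = reduced l * reduced m.
Proof.
move=> fl fm; rewrite /reduced lbdM lidM invgM -!mulgA; congr (_ * _).
rewrite mulgA; apply: flatC; last exact/flatV/flat_lid_bd.
exact: (flat_reduced fm).
Qed.

Lemma reduced_lid n (l : loop n w) : reduced (lid l) = 1.
Proof. by rewrite /reduced lbd_id mulgV. Qed.

Lemma lbd_reduced n (l : loop n.+1 w) : lbd Tgt (reduced l) = 1.
Proof. by rewrite /reduced lbdM lbd_inv lbd_id mulgV. Qed.

(** The correcting factors on the right involve the iterated target of [l], which is the same
    through its source and its target, and cancel. This is the germ of the chain map property
    [lbd_phi]. *)
Lemma lbd_reduced_src n (l : loop n.+2 w) : flat l ->
  lbd Src (reduced l) = reduced (lbd Src l) * (reduced (lbd Tgt l))^-1.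
Proof.
move=> fl; rewrite /reduced lbdM lbd_inv lbd_id invgM invgK !mulgA.
have -> : lbd Tgt (lbd Src l) = lbd Tgt (lbd Tgt l) by rewrite (lbd_bd _ Tgt).
by rewrite mulgVK.
Qed.
End Flat.

Lemma act_reduced n x0 x y (u : W x0 x) (l : loop n.+1 u) (a : X 0 x y) w :
  u ** cls0 a = w -> act (reduced l) a w = reduced (act l a w).
Proof. by move=> E; rewrite /reduced actM actV -lid_act // lbd_act. Qed.

Lemma act_flat n x0 x y (u : W x0 x) (l : loop n.+1 u) (a : X 0 x y) w :
  u ** cls0 a = w -> flat l -> flat (act l a w).
Proof. by move=> E [sl tl]; rewrite /flat !lbd2_act // sl tl act1. Qed.

(* Flat loops commute with the lifts of 2-cells. *)
Lemma act_flat_cls n x0 x y (u : W x0 x) (l : loop n.+1 u) (a b : X 0 x y) w :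
  u ** cls0 a = w -> cls0 a = cls0 b -> flat l -> act l a w = act l b w.
Proof.
move=> E ab fl; have [c [sc tc]] := link_ex ab.
have Ec : u ** cls c = w by rewrite /cls sc.
have Ebc m : base u (Xlift m c) w = llift m (base u c w) /\ cls (Xlift m c) = cls c.
  elim: m => [|m [IH1 IH2]]; first by [].
  have E2 : cls (Xid (Xlift m c)) = cls (Xlift m c) by rewrite -(cls_bd Src) Xbd_id.
  by split; [rewrite /= base_id ?IH2 // IH1|rewrite /= E2 IH2].
(* The lift of a 2-cell from [a] to [b] intertwines the two actions on [l]; it commutes with flat
   loops and can be cancelled. *)
have := act_base l (f := Xlift n.+1 c) (w := w).
have [-> ->] := Ebc n.+1; rewrite !Xs_lift sc tc => /(_ Ec).
rewrite -(flat_llift _ (act_flat (a := b) _ fl)) -?ab //.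
by move/mulIg.
Qed.
End Linear.

Import GRing.Theory.
Local Open Scope ring_scope.

Lemma freeab_ind (T : Type) (Q : freeab T -> Prop) :
  Q 0 -> (forall a b, Q a -> Q b -> Q (a - b)) -> (forall t, Q (fgen t)) ->
  forall a, Q a.
Proof.
move=> Q0 QB Qg a.
have QN b : Q b -> Q (- b) by move=> Qb; rewrite -sub0r; apply: QB.
have QD b c : Q b -> Q c -> Q (b + c).
  by move=> Qb Qc; rewrite -[c]opprK; apply/QB/QN.
rewrite -(freeg_sumE a); elim/big_ind: _ => // x _.
rewrite -[coeff x a]intz -freegU_mulz.
have Qn n : Q (<<(x : {classic T})>> *+ n).
  by elim: n => [|n IH]; rewrite ?mulr0n ?mulrSr //; apply: QD => //; apply: Qg.
by case: (coeff x a) => n; rewrite ?NegzE ?mulrNz -?pmulrn; [|apply: QN].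
Qed.

Section HcellInd.
Variables (N : option nat) (P : polygraph N).
Local Notation X := (@hcell N P).

(** Brackets in one dimension live in one natural system, so the index must stay fixed. The casts
    are along equalities of natural numbers and hence trivial. *)
Lemma hcell_ind_at n (Q : forall x y, X n.+1 x y -> Prop) :
  (forall x y (a : @gen P n.+1 x y), Q _ _ (Xgen a)) ->
  (forall x y (c : X n x y), Q _ _ (Xid c)) ->
  (forall x y (c : X n.+1 x y), Q _ _ c -> Q _ _ (Xi c)) ->
  (forall x y z (c : X n.+1 x y) (d : X n.+1 y z), Q _ _ c -> Q _ _ d ->
    Q _ _ (Xh c d)) ->
  (forall x y (c d : X n.+1 x y), Xs Tgt c = Xs Src d -> Q _ _ c -> Q _ _ d ->
    Q _ _ (Xv 0 c d)) ->
  forall x y (c : X n.+1 x y), Q _ _ c.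
Proof.
move=> Qg Qid Qi Qh Qv x y c.
pose R m x y (c : X m x y) := forall E : m = n.+1, Q _ _ (ecast m (X m x y) E c).
suff H : R _ _ _ c by exact: (H erefl).
apply: hcell_ind c; rewrite /R.
- by move=> m x' y' a E; case: (E) => E'; subst m; rewrite eq_axiomK.
- by move=> m x' y' d E; case: (E) => E'; subst m; rewrite eq_axiomK.
- move=> m x' y' d IH E; case: (E) => E'; subst m; rewrite eq_axiomK.
  by apply: Qi; exact: (IH erefl).
- move=> m x' y' z d d' IH IH' E; case: (E) => E'; subst m; rewrite eq_axiomK.
  by apply: Qh; [exact: (IH erefl)|exact: (IH' erefl)].
- move=> m x' y' d d' k IH IH' E; case: (E) => E'; subst m; rewrite eq_axiomK.
  by apply: Qv => //; [exact: (IH erefl)|exact: (IH' erefl)].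
Qed.
End HcellInd.

(** * Brackets *)

Section Brackets.
Variables (N : option nat) (P : polygraph N) (C : category)
  (F : functor (pres P) C).
Local Notation cell := (fcell (@gen P)).
Local Notation X := (@hcell N P).
Local Notation W := (@pres_hom P).
Local Notation v := (Xv 0).
Local Notation s := (Xs Src).
Local Notation t := (Xs Tgt).
Local Notation "u ** w" := (pres_cmp u w) (at level 40, left associativity).

Definition FW x y (w : W x y) :
  hom (F x) (F y) := fmap F (w : @hom (pres P) x y).
Definition AW x y (w : W x y) : fact C := Arrow (FW w).

Lemma FWM x y z (u : W x y) (w : W y z) : FW (u ** w) = FW u \; FW w.
Proof. exact: (@fmapM _ _ F). Qed.

Lemma FW1 x : FW (oneW x) = idm _.
Proof. exact: (@fmap1 _ _ F). Qed.

Section Bi.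
Variable D : natsys C.
Variables (x y : pob P) (w : W x y).

Definition bi x' y' (u : W x' x) (b : D (AW w)) (r : W y y') (w' : W x' y') :
  D (AW w') := biact b (AW w') (FW u) (FW r).

Lemma biD x' y' (u : W x' x) (a b : D (AW w)) (r : W y y') w' :
  bi u (a + b) r w' = bi u a r w' + bi u b r w'.
Proof. exact: biactD. Qed.

Lemma biN x' y' (u : W x' x) (a : D (AW w)) (r : W y y') w' :
  bi u (- a) r w' = - bi u a r w'.
Proof. exact: biactN. Qed.

Lemma biB x' y' (u : W x' x) (a b : D (AW w)) (r : W y y') w' :
  bi u (a - b) r w' = bi u a r w' - bi u b r w'.
Proof. by rewrite biD biN. Qed.

Lemma bi0 x' y' (u : W x' x) (r : W y y') w' : bi u 0 r w' = 0.
Proof. exact: biact0. Qed.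

Lemma bi1 (b : D (AW w)) : bi (oneW x) b (oneW y) w = b.
Proof.
have E : FW (oneW x) \; amap (AW w) \; FW (oneW y) = amap (AW w).
  by rewrite !FW1 cmp1m cmpm1.
rewrite /bi (@biactE C D (AW w) b (AW w) _ _ E) -[RHS](@nact1 _ D);
  congr (nact D _ b).
by apply: fact_homP; rewrite /= ?FW1.
Qed.
End Bi.

Lemma bi_bi (D : natsys C) x y (w : W x y) (b : D (AW w)) x' y' (u : W x' x)
    (r : W y y') w' x2 y2 (u' : W x2 x') (r' : W y' y2) w2 :
  u ** w ** r = w' ->
  bi u' (bi u b r w') r' w2 = bi (u' ** u) b (r ** r') w2.
Proof.
move=> <-; rewrite /bi biact_comp; first by rewrite !FWM.
by rewrite /= !FWM cmpA.
Qed.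

Lemma nmor_bi (D E : natsys C) (f : nmor D E) x y (w : W x y) (b : D (AW w))
    x' y' (u : W x' x) (r : W y y') w' :
  f _ (bi u b r w') = bi u (f _ b) r w'.
Proof.
rewrite /bi /biact; case: pselect => E0; last exact: raddf0.
exact: nmap_nat.
Qed.

(** [w] stands for [cls c] but is kept free, so that the brackets of parallel cells share one
    type. *)
Definition br n x y (c : X n x y) (w : W x y) : RFSgen F n (AW w) :=
  bracket_at (rep c) (FW w).

Lemma br_mk n x y (f : cell n x y) (vf : valid f) w :
  br (mk vf) w = bracket_at f (FW w).
Proof. exact/bracket_eqc/rep_mk. Qed.

Lemma bar_class1 n x y (f : cell n x y) : bar F f = FW (class1 f).
Proof. by []. Qed.

Lemma br_h n x y z (c : X n x y) (d : X n y z) w w' :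
  cls c = w -> cls d = w' ->
  br (Xh c d) (w ** w') =
  bi (oneW x) (br c w) w' (w ** w') + bi w (br d w') (oneW z) (w ** w').
Proof.
have [f [vf ->]] := hcellP c; have [g [vg ->]] := hcellP d.
rewrite Xh_mk !cls_mk !br_mk => <- <-; rewrite /bi /AW !FW1.
have := bracket_hcomp (bar_class1 f) (bar_class1 g).
by rewrite -FWM => ->.
Qed.

Lemma br_v n x y (c d : X n.+1 x y) w : cls c = w -> t c = s d ->
  br (v c d) w = br c w + br d w.
Proof.
move=> E k; have : cls d = w by rewrite -E /cls -k cls_s.
move: E k; have [f [vf ->]] := hcellP c; have [g [vg ->]] := hcellP d.
rewrite !cls_mk => E /comp0P /comp_mk V E'; have {}V := V (leq0n _).
by rewrite (Xv_mk _ _ V) !br_mk bracket_vcomp // bar_class1 ?E ?E'.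
Qed.

Lemma br_id n x y (c : X n x y) w : br (Xid c) w = 0.
Proof. by have [f [vf ->]] := hcellP c; rewrite Xid_mk br_mk bracket_idc. Qed.

Lemma br_i n x y (c : X n.+1 x y) w : cls c = w -> br (Xi c) w = - br c w.
Proof.
by move=> E; apply/eqP; rewrite -addr_eq0 addrC -br_v ?s_i // v_ir br_id.
Qed.

Lemma br_one x w : br (Xone 0 x) w = 0.
Proof. by rewrite /Xone br_mk (bracket_one 0). Qed.

End Brackets.

Section Brackets.
Variables (N : option nat) (P : polygraph N) (C : category)
  (F : functor (pres P) C).
Local Notation cell := (fcell (@gen P)).
Local Notation X := (@hcell N P).
Local Notation W := (@pres_hom P).
Local Notation v := (Xv 0).
Local Notation s := (Xs Src).
Local Notation t := (Xs Tgt).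
Local Notation "u ** w" := (pres_cmp u w) (at level 40, left associativity).
Local Notation br := (br F).

Lemma br_j n x y (a : X 0 x y) w : br (Xj n.+1 a) w = 0.
Proof. exact: br_id. Qed.

Lemma br_conj n x y (p q c : X n.+1 x y) w :
  cls p = w -> cls q = w -> cls c = w ->
  s c = s p -> t c = s q ->
  br (conj_cell p q c) w = br c w - br p w + br q w.
Proof.
move=> Ep Eq Ec sc tc.
have Ei : cls (Xi p) = w by rewrite /cls s_i cls_s.
rewrite /conj_cell br_v ?t_v ?t_i //; last by rewrite /cls s_v ?t_i ?s_i ?cls_s.
by rewrite br_v ?t_i // br_i // [- _ + _]addrC.
Qed.

Section Loop.
Variables (x y : pob P) (w : W x y).

Definition brl n (l : loop n w) : RFSgen F n.+1 (AW F w) := br (lval l) w.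

Lemma cls_l n (l : loop n w) : cls (lval l) = w.
Proof. by rewrite /cls s_l cls_hat. Qed.

Lemma brlM n (l m : loop n w) : brl (l * m)%g = brl l + brl m.
Proof. by rewrite /brl lvalM br_v ?cls_l ?t_l ?s_l. Qed.

Lemma brl1 n : brl (1%g : loop n w) = 0.
Proof. exact: br_j. Qed.

Lemma brlV n (l : loop n w) : brl (l^-1)%g = - brl l.
Proof. by apply/eqP; rewrite -addr_eq0 -brlM mulVg brl1. Qed.

Lemma brl_id n (l : loop n w) : brl (lid l) = 0.
Proof. exact: br_id. Qed.

Lemma brl_reduced n (l : loop n.+1 w) : brl (reduced l) = brl l.
Proof. by rewrite /reduced brlM brlV brl_id subr0. Qed.
End Loop.

Lemma cls_lift n x y (c : X 1 x y) : cls (Xlift n c) = cls c.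
Proof. by rewrite /cls Xs_lift. Qed.

Lemma cls_nf x0 x y (u : W x0 x) (a : X 0 x y) : cls (nf u a) = u ** cls0 a.
Proof. by rewrite /cls s_nf cls0_h cls_hat. Qed.

Lemma brl_act n x0 x y (u : W x0 x) (l : loop n u) (a : X 0 x y) w :
  u ** cls0 a = w -> brl (act l a w) = bi (oneW x0) (brl l) (cls0 a) w.
Proof.
move=> <-; rewrite /brl lval_act //.
rewrite br_conj ?cls_lift ?cls_nf // ?Xs_h ?Xs_lift ?s_nf ?s_l ?t_l ?Xs_j //;
  last first.
  by rewrite cls_h cls_l /cls Xs_j.
by rewrite subrK (@br_h _ _ _ F _ _ _ _ _ _ u (cls0 a)) ?cls_l // ?br_j ?bi0 ?addr0 // /cls Xs_j.
Qed.

Lemma brl_base n x0 x y (u : W x0 x) (f : X n.+1 x y) c w : cls f = c ->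
  u ** c = w -> brl (base u f w) = bi u (br f c) (oneW y) w -
    br (Xlift n (nf u (s f))) w + br (Xlift n (nf u (t f))) w.
Proof.
move=> <- <-; rewrite /brl lval_base //.
have cj : cls (Xj n.+1 (hat u)) = u by rewrite /cls Xs_j cls_hat.
rewrite br_conj ?cls_lift ?cls_nf ?cls_s // ?Xs_h ?Xs_lift ?s_nf ?Xs_j //;
  last first.
  by rewrite cls_h cj.
by rewrite (br_h F cj erefl) br_j bi0 add0r.
Qed.

(** In dimension at least 3 the normalising 2-cells and the lifted target are identities, and their
    brackets vanish. *)
Lemma brl_straighten n x0 x y (u : W x0 x) (f : X n.+2 x y) c w : cls f = c ->
  u ** c = w -> brl (straighten u f w) =
  bi u (br f c) (oneW y) w -
  brl (llift1 n (theta u (bd2 Src f) w)) + brl (llift1 n (theta u (bd2 Tgt f) w)).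
Proof.
move=> Ec E; rewrite /straighten /flatten !brlM !brlV (brl_base Ec E).
by rewrite [brl (llift _ _)]brl_id oppr0 addr0 !br_id subr0 addr0 [- _ + _]addrC.
Qed.

Section Iso.
Hypothesis isoF : is_iso F.

Lemma FW_surj x y (h : hom (F x) (F y)) : exists w : W x y, FW F w = h.
Proof. by have [g _ gK] := isoF.2 x y; exists (g h); rewrite /FW gK. Qed.

Definition FWinv x y (h : hom (F x) (F y)) :
  W x y := proj1_sig (cid (FW_surj h)).

Lemma FWinvK x y (h : hom (F x) (F y)) : FW F (FWinv h) = h.
Proof. exact: (proj2_sig (cid (FW_surj h))). Qed.

Lemma FW_inj x y : injective (@FW N P C F x y).
Proof. by apply: bij_inj; exact: (isoF.2 x y). Qed.

Lemma FWK x y (w : W x y) : FWinv (FW F w) = w.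
Proof. by apply: FW_inj; rewrite FWinvK. Qed.

Lemma AW_surj (a : fact C) : exists x y (w : W x y), a = AW F w.
Proof.
case: a => p q h; have [g _ gK] := isoF.1.
move: h; rewrite -(gK p) -(gK q) => h; exists (g p), (g q), (FWinv h).
by rewrite /AW FWinvK.
Qed.

Definition tcls n (a : tgen P n) : W (tsrc a) (ttgt a) := class1 (Gen (tval a)).

Definition brg n (a : tgen P n) :
  RFSgen F n (AW F (tcls a)) := br (Xgen (tval a)) (tcls a).

Lemma brgE n (a : tgen P n) x y (u : W x _) (r : W _ y) (w : W x y)
    (E : FW F u \; bar F (Gen (tval a)) \; FW F r = FW F w) :
  bi u (brg a) r w =
  fgen (existT (fun a : tgen P n => hom (obar F (Gen (tval a))) (AW F w)) a
    (@FactHom C (obar F (Gen (tval a))) (AW F w) (FW F u) (FW F r) E)).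
Proof.
rewrite /brg br_mk /bracket_at /bi biact_comp; last by rewrite /= cmp1m cmpm1.
have E' : (FW F u \; idm _) \; bar F (Gen (tval a)) \;
  (idm _ \; FW F r) = FW F w.
  by rewrite cmpm1 cmp1m.
rewrite (@biactE C _ (obar F _) _ (AW F w) _ _ E').
case: a u r E E' => p q a u r E E' /=.
rewrite flift_gen; congr fgen; congr existT.
by apply: fact_homP; rewrite /= ?cmpm1 ?cmp1m.
Qed.

Lemma rfs_ind n x y (w : W x y) (Q : RFSgen F n (AW F w) -> Prop) :
  Q 0 -> (forall a b, Q a -> Q b -> Q (a - b)) ->
  (forall (a : tgen P n) u r, u ** tcls a ** r = w ->
     Q (bi u (brg a) r w)) -> forall b, Q b.
Proof.
move=> Q0 QB Qg; apply: freeab_ind => // -[a m].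
have [u Eu] := FW_surj (fleft m); have [r Er] := FW_surj (fright m).
have E : FW F u \; bar F (Gen (tval a)) \; FW F r = FW F w.
  by rewrite Eu Er; exact: (factE m).
have := Qg a u r; rewrite (brgE E).
suff -> : (@FactHom C (obar F (Gen (tval a))) (AW F w) (FW F u) (FW F r) E) = m.
  by apply; apply: FW_inj; rewrite !FWM -E cmpA.
exact: fact_homP.
Qed.

Definition lin n x y (w : W x y) (A : zmodType)
    (g : forall a : tgen P n, W x (tsrc a) -> W (ttgt a) y -> A) :
    {additive RFSgen F n (AW F w) -> A} :=
  flift (fun p : {a : tgen P n & @hom (fact C) (obar F (Gen (tval a))) (AW F w)} =>
    g (projT1 p) (FWinv (y := tsrc (projT1 p)) (fleft (projT2 p)))
      (FWinv (x := ttgt (projT1 p)) (fright (projT2 p)))).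

Lemma linE n x y (w : W x y) (A : zmodType) g (a : tgen P n) u r :
  u ** tcls a ** r = w ->
  @lin n x y w A g (bi u (brg a) r w) = g a u r.
Proof.
move=> Ew; have E : FW F u \; bar F (Gen (tval a)) \; FW F r = FW F w.
  by rewrite -Ew !FWM cmpA.
by rewrite (brgE E) /lin /= flift_gen /= !FWK.
Qed.

End Iso.
End Brackets.

(** * Boundaries of brackets, and linear extension from generators *)

Section Delta.
Variables (N : option nat) (P : polygraph N) (C : category)
  (F : functor (pres P) C).
Local Notation cell := (fcell (@gen P)).
Local Notation X := (@hcell N P).
Local Notation W := (@pres_hom P).
Local Notation v := (Xv 0).
Local Notation s := (Xs Src).
Local Notation t := (Xs Tgt).
Local Notation "u ** w" := (pres_cmp u w) (at level 40, left associativity).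
Local Notation br := (br F).
Local Notation brl := (brl F).
Local Notation brg := (brg F).
Hypothesis isoF : is_iso F.

Lemma cls_gent n (a : tgen P n) : cls (Xgen (tval a)) = tcls a.
Proof. exact: cls_mk. Qed.

Lemma fam_nmor_gen (I : Type) (a : I -> fact C) (E : natsys C) (e : forall i, E (a i)) i :
  fam_nmor e (a i) (fam_gen a i) = e i.
Proof. by rewrite /= flift_gen /= (@nact1 _ E). Qed.

Lemma bi_one n x y (w : W x y) (b : RFSgen F n (AW F w)) :
  biact b (AW F w) (idm _) (idm _) = b.
Proof. by rewrite -[RHS]bi1 /bi !FW1. Qed.

Lemma brg_gen n (a : tgen P n) :
  brg a = fam_gen (fun a : tgen P n => obar F (Gen (tval a))) a.
Proof.
rewrite /brg br_mk /bracket_at.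
by case: a => p q a; exact: (bi_one (w := class1 (Gen a)) (bracket F (Gen a))).
Qed.

Lemma delta_brg n (a : tgen P n.+1) : delta F n.+1 (AW F (tcls a)) (brg a) =
  br (Xbd Src (Xgen (tval a))) (tcls a) - br (Xbd Tgt (Xgen (tval a))) (tcls a).
Proof.
rewrite brg_gen [LHS]fam_nmor_gen /delta_gen !Xbd_mk !br_mk.
by [].
Qed.

(** The formula on generators propagates because sources and targets respect [Xh] and, above
    dimension 2, also [v]; for 2-cells composed by [v], the middle 1-cell telescopes. *)
Lemma delta_br n x y (c : X n.+1 x y) w : cls c = w ->
  delta F n.+1 (AW F w) (br c w) = br (Xbd Src c) w - br (Xbd Tgt c) w.
Proof.
move: x y c w; apply: hcell_ind_at.
- move=> x y a w <-; have := delta_brg (TGen a); rewrite /brg -cls_gent.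
  exact.
- by move=> x y c w _; rewrite br_id raddf0 !Xbd_id subrr.
- move=> x y c IH w E; have Ec : cls c = w by rewrite -E /cls s_i !cls_s.
  rewrite br_i // raddfN IH //.
  (* On 2-cells [Xi] exchanges source and target; in higher dimensions it inverts each of them in
     place. Either way the difference of brackets changes sign. *)
  case: n c {IH} E Ec => [|n] c E Ec.
    have -> : Xbd Src (Xi c) = Xbd Tgt c by exact: (s_i c).
    have -> : Xbd Tgt (Xi c) = Xbd Src c by exact: (t_i c).
    by rewrite opprB.
  by rewrite !bd_i !br_i ?cls_bd // opprB opprK addrC.
- move=> x y z c d IH IH' w; rewrite cls_h => <-.
  rewrite !(br_h F) ?cls_bd // raddfD !nmor_bi.
  have Ec : cls (Xh c d) = cls c ** cls d by rewrite cls_h.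
  rewrite !Xbd_h !(br_h F) ?cls_bd // IH // IH' // !biB.
  by rewrite opprD addrACA.
- move=> x y c d k IH IH' w E; have Ec : cls c = w by rewrite -E /cls s_v.
  have Ed : cls d = w by rewrite -Ec /cls -k cls_s.
  rewrite br_v // raddfD IH // IH' //.
  case: n c d {IH IH' E} k Ec Ed => [|n] c d k Ec Ed.
    have -> : Xbd Src (v c d) = Xbd Src c by exact: (s_v k).
    have -> : Xbd Tgt (v c d) = Xbd Tgt d by exact: (t_v k).
    have -> : Xbd Tgt c = Xbd Src d by exact: k.
    by rewrite addrA subrK.
  by rewrite !bd_v // !br_v ?cls_bd ?Xs_bd // opprD addrACA.
Qed.

Lemma hcell0_ind (Q : forall x y, X 0 x y -> Prop) :
  (forall x y (a : @gen P 0 x y), Q _ _ (Xgen a)) ->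
  (forall x, Q _ _ (Xone 0 x)) ->
  (forall x y z (c : X 0 x y) (d : X 0 y z), Q _ _ c -> Q _ _ d -> Q _ _ (Xh c d)) ->
  forall x y (c : X 0 x y), Q _ _ c.
Proof.
move=> Qg Q1 Qh x y c; have [f [vf ->]] := hcellP c.
have -> : mk vf = mk0 f by apply/mkP/eqc_refl.
pose R m x y : cell m x y -> Prop :=
  if m is 0 then fun f => Q _ _ (mk0 f) else fun=> True.
suff H m x' y' (h : cell m x' y') : R m x' y' h by exact: (H 0%N x y f).
elim: m x' y' / h => // {x y c f vf}.
- move=> [|m] x y a //; have := Qg _ _ a; rewrite /Xgen.
  by have -> : mk (valid_gen a) = mk0 (Gen a) by apply/mkP/eqc_refl/valid1.
- move=> x; have := Q1 x; rewrite /Xone.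
  by have -> : mk (valid_one_iter 0 x) = mk0 (One x) by apply/mkP/eqc_refl/valid1.
- by move=> [|m] x y z c IH d IH' //; rewrite /R mk0_hcomp; apply: Qh.
Qed.

Section Lin.
Variables (A : zmodType).

(** Universal property of Fox calculus: a function of a 1-cell in a context [u], [r] that vanishes
    on units and obeys the derivation rule is the linear extension of its values on generators,
    evaluated on brackets. *)
Lemma lin_br0 x y (w : W x y)
    (g : forall a : tgen P 0, W x (tsrc a) -> W (ttgt a) y -> A)
    (G : forall x' y', X 0 x' y' -> W x x' -> W y' y -> A) :
  (forall a u r, u ** tcls a ** r = w -> G _ _ (Xgen (tval a)) u r = g a u r) ->
  (forall z u r, u ** r = w -> G _ _ (Xone 0 z) u r = 0) ->
  (forall x1 x2 x3 (c : X 0 x1 x2) (d : X 0 x2 x3) u r,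
    u ** cls c ** cls d ** r = w ->
    G _ _ (Xh c d) u r = G _ _ c u (cls d ** r) + G _ _ d (u ** cls c) r) ->
  forall x' y' (c : X 0 x' y') u r w', cls c = w' -> u ** w' ** r = w ->
    lin isoF w g (bi u (br c w') r w) = G _ _ c u r.
Proof.
move=> Gg G1 Gh x' y' c u r w' <- {w'}; move: x' y' c u r; apply: hcell0_ind.
- move=> x' y' a u r; rewrite (cls_gent (TGen a)) => E.
  by rewrite (linE isoF g (a := TGen a) E) -Gg.
- move=> z u r; rewrite /cls cls0_one mulW1 => E.
  by rewrite br_one bi0 raddf0 G1.
- move=> x1 x2 x3 c d IH IH' u r; rewrite cls_h -mulWA => E.
  rewrite (br_h F (erefl (cls c)) (erefl (cls d))) biD raddfD.
  rewrite !bi_bi ?mulW1 ?mul1W // ?IH ?IH' //; last by rewrite -mulWA.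
  by rewrite Gh.
Qed.

(** The same in higher dimensions. The rule for [Xi] follows from those for [v] and for identities,
    because [v c (Xi c)] is an identity. *)
Lemma lin_brS n x y (w : W x y)
    (g : forall a : tgen P n.+1, W x (tsrc a) -> W (ttgt a) y -> A)
    (G : forall x' y', X n.+1 x' y' -> W x x' -> W y' y -> A) :
  (forall a u r, u ** tcls a ** r = w -> G _ _ (Xgen (tval a)) u r = g a u r) ->
  (forall x1 x2 (c : X n x1 x2) u r, u ** cls c ** r = w -> G _ _ (Xid c) u r = 0) ->
  (forall x1 x2 (c d : X n.+1 x1 x2) u r, u ** cls c ** r = w -> t c = s d ->
    G _ _ (v c d) u r = G _ _ c u r + G _ _ d u r) ->
  (forall x1 x2 x3 (c : X n.+1 x1 x2) (d : X n.+1 x2 x3) u r,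
    u ** cls c ** cls d ** r = w ->
    G _ _ (Xh c d) u r = G _ _ c u (cls d ** r) + G _ _ d (u ** cls c) r) ->
  forall x' y' (c : X n.+1 x' y') u r w', cls c = w' -> u ** w' ** r = w ->
    lin isoF w g (bi u (br c w') r w) = G _ _ c u r.
Proof.
move=> Gg Gid Gv Gh x' y' c u r w' <- {w'}; move: x' y' c u r;
  apply: hcell_ind_at.
- move=> x' y' a u r; rewrite (cls_gent (TGen a)) => E.
  by rewrite (linE isoF g (a := TGen a) E) -Gg.
- move=> x' y' c u r; rewrite -(cls_bd Src) Xbd_id => E.
  by rewrite br_id bi0 raddf0 Gid.
- move=> x1 x2 c IH u r; have Ec : cls (Xi c) = cls c by rewrite /cls s_i cls_s.
  rewrite Ec => E; rewrite br_i // biN raddfN IH //; apply/eqP.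
  rewrite eq_sym -addr_eq0 addrC -Gv ?s_i // v_ir Gid //.
  by rewrite /cls Xs_j.
- move=> x1 x2 x3 c d IH IH' u r; rewrite cls_h -mulWA => E.
  rewrite (br_h F (erefl (cls c)) (erefl (cls d))) biD raddfD.
  rewrite !bi_bi ?mulW1 ?mul1W // ?IH ?IH' //; last by rewrite -mulWA.
  by rewrite Gh.
- move=> x1 x2 c d k IH IH' u r.
  have Ev : cls (v c d) = cls c by rewrite /cls s_v.
  have Ed : cls d = cls c by rewrite /cls -k cls_s.
  rewrite Ev => E; rewrite br_v // biD raddfD IH // Gv //; congr (_ + _).
  by rewrite -Ed IH' // Ed.
Qed.
End Lin.
End Delta.

(** * Exactness *)

Section Low.
Variables (N : option nat) (P : polygraph N) (C : category)
  (F : functor (pres P) C).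
Local Notation X := (@hcell N P).
Local Notation W := (@pres_hom P).
Local Notation v := (Xv 0).
Local Notation s := (Xs Src).
Local Notation t := (Xs Tgt).
Local Notation "u ** w" := (pres_cmp u w) (at level 40, left associativity).
Local Notation br := (br F).
Local Notation brl := (brl F).
Local Notation brg := (brg F).
Hypothesis isoF : is_iso F.

Definition pr x y z (u : W x z) (r : W z y) (w : W x y) : RFS0 C (AW F w) :=
  if pselect (FW F u \; FW F r = FW F w) is left E
  then fgen (@FactPair C (AW F w) (F z) (FW F u) (FW F r) E) else 0.

Lemma prE x y z (u : W x z) (r : W z y) (w : W x y)
  (E : FW F u \; FW F r = FW F w) :
  pr u r w = fgen (@FactPair C (AW F w) (F z) (FW F u) (FW F r) E).
Proof.
rewrite /pr; case: pselect => // E'; congr fgen; exact: fact_pairP.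
Qed.

Lemma FW_factor x y z (u : W x z) (r : W z y) (w : W x y) : u ** r = w ->
  FW F u \; FW F r = FW F w.
Proof. by move=> <-; rewrite FWM. Qed.

Lemma bi_pr x y z (u : W x z) (r : W z y) (w : W x y) x' y' (u' : W x' x)
    (r' : W y y') w' : u ** r = w -> u' ** w ** r' = w' ->
  bi u' (pr u r w) r' w' = pr (u' ** u) (r ** r') w'.
Proof.
move=> E E'; rewrite (prE (FW_factor E)).
have Ef : u' ** u ** (r ** r') = w' by rewrite -E' -E !mulWA.
rewrite (prE (FW_factor Ef)) /bi.
have Eb : FW F u' \; amap (AW F w) \; FW F r' = amap (AW F w').
  by rewrite /= -E' !FWM cmpA.
rewrite (@biactE C _ (AW F w) _ (AW F w') _ _ Eb) /= flift_gen; congr fgen.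
by apply: fact_pairP; rewrite FWM.
Qed.

Lemma rfs0_ind x y (w : W x y) (Q : RFS0 C (AW F w) -> Prop) :
  Q 0 -> (forall a b, Q a -> Q b -> Q (a - b)) ->
  (forall z (u : W x z) r, u ** r = w -> Q (pr u r w)) -> forall b, Q b.
Proof.
move=> Q0 QB Qg; apply: freeab_ind => // -[p h k E].
have [g _ gK] := isoF.1; move: h k E; rewrite -(gK p) => h k E.
have [u Eu] := FW_surj isoF h; have [r Er] := FW_surj isoF k.
move: E; rewrite -Eu -Er => E; have := Qg _ u r; rewrite (prE E); apply.
by apply: (FW_inj isoF); rewrite FWM E.
Qed.

Lemma F_surj (p : C) : exists z : pob P, F z = p.
Proof. by have [g _ gK] := isoF.1; exists (g p). Qed.

Lemma F_inj (z z' : pob P) : F z = F z' -> z = z'.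
Proof. by have /bij_inj inj := isoF.1; exact: inj. Qed.

(** The middle object of a pair lies in [C]; a preimage under [F] is chosen, and the arrows are cast
    along the chosen equality before being pulled back to classes. *)
Definition lin0 x y (w : W x y) (A : zmodType)
    (g : forall z, W x z -> W z y -> A) : {additive RFS0 C (AW F w) -> A} :=
  flift (fun p : fact_pair (AW F w) =>
    let zE := cid (F_surj (pmid p)) in
    g (proj1_sig zE)
      (FWinv isoF (ecast q (hom (F x) q) (esym (proj2_sig zE)) (pleft p)))
      (FWinv isoF (ecast q (hom q (F y)) (esym (proj2_sig zE)) (pright p)))).

Lemma lin0E x y (w : W x y) (A : zmodType) g z (u : W x z) (r : W z y) :
  u ** r = w -> @lin0 x y w A g (pr u r w) = g z u r.
Proof.
move=> E; rewrite (prE (FW_factor E)) /= flift_gen /=.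
case: cid => z' /= Ez; have := F_inj Ez => zz; subst z'.
by rewrite (Prop_irrelevance Ez erefl) /= !FWK.
Qed.

Lemma aug_pr x y z (u : W x z) (r : W z y) (w : W x y) : u ** r = w ->
  augmentation C (AW F w) (pr u r w) = 1.
Proof. by move=> E; rewrite (prE (FW_factor E)) /= flift_gen. Qed.

Lemma delta0_brg (a : tgen P 0) : delta F 0 (AW F (tcls a)) (brg a) =
  pr (tcls a) (oneW _) (tcls a) - pr (oneW _) (tcls a) (tcls a).
Proof.
rewrite brg_gen [LHS]fam_nmor_gen /delta1_gen.
rewrite (prE (FW_factor (mulW1 (tcls a)))) (prE (FW_factor (mul1W (tcls a)))).
by congr (fgen _ - fgen _); apply: fact_pairP; rewrite ?FW1.
Qed.

Lemma delta0_br x y (w : W x y) x' y' (c : X 0 x' y') (u : W x x') (r : W y' y) w' :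
  cls c = w' -> u ** w' ** r = w ->
  delta F 0 (AW F w) (bi u (br c w') r w) = pr (u ** w') r w - pr u (w' ** r) w.
Proof.
move=> <- {w'}; move: x' y' c u r; apply: hcell0_ind.
- move=> x' y' a u r; rewrite nmor_bi (cls_gent (TGen a)) => E.
  have H := delta0_brg (TGen a).
  rewrite H biB !bi_pr ?mulW1 ?mul1W //.
- move=> z u r; rewrite /cls cls0_one mulW1 mul1W => E.
  by rewrite br_one bi0 raddf0 subrr.
- move=> x1 x2 x3 c d IH IH' u r; rewrite cls_h -mulWA => E.
  rewrite (br_h F (erefl (cls c)) (erefl (cls d))) biD raddfD.
  rewrite !bi_bi ?mulW1 ?mul1W // ?IH ?IH' //; last by rewrite -mulWA.
  by rewrite !mulWA addrC addrA subrK.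
Qed.

(** Modulo boundaries each pair [(u, r)] equals [(1, w)], their difference being the boundary of
    [[hat u]r]. *)
Lemma exact_aug x y (w : W x y) (b : RFS0 C (AW F w)) :
  augmentation C (AW F w) b = 0 -> exists a, delta F 0 (AW F w) a = b.
Proof.
suff [a Ea] : exists a, delta F 0 (AW F w) a =
    b - pr (oneW x) w w *~ augmentation C (AW F w) b.
  by move=> E; exists a; rewrite Ea E mulr0z subr0.
move: b; apply: rfs0_ind.
- by exists 0; rewrite !raddf0 addr0.
- move=> b c [a Ea] [a' Ea']; exists (a - a').
  by rewrite !raddfB Ea Ea' !opprD !opprK addrACA.
- move=> z u r E; exists (bi (oneW x) (br (hat u) u) r w).
  by rewrite (delta0_br (w := w) (cls_hat u)) ?mul1W // (aug_pr E) mulr1z E.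
Qed.

Lemma aug_delta0 x y (w : W x y) (a : RFSgen F 0 (AW F w)) :
  augmentation C (AW F w) (delta F 0 (AW F w) a) = 0.
Proof.
move: a; apply: (rfs_ind isoF).
- by rewrite !raddf0.
- by move=> a b Ea Eb; rewrite !raddfB Ea Eb subrr.
- move=> a u r E; rewrite (delta0_br (w := w)) ?cls_gent // raddfB !aug_pr ?subrr //.
  by rewrite -mulWA.
Qed.

Lemma delta0_delta x y (w : W x y) (a : RFSgen F 1 (AW F w)) :
  delta F 0 (AW F w) (delta F 1 (AW F w) a) = 0.
Proof.
move: a; apply: (rfs_ind isoF).
- by rewrite !raddf0.
- by move=> a b Ea Eb; rewrite !raddfB Ea Eb subrr.
- move=> a u r E; rewrite nmor_bi delta_brg biB raddfB.
  by rewrite !(delta0_br (w := w)) ?cls_bd ?cls_gent // subrr.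
Qed.

Lemma delta_delta n x y (w : W x y) (a : RFSgen F n.+2 (AW F w)) :
  delta F n.+1 (AW F w) (delta F n.+2 (AW F w) a) = 0.
Proof.
move: a; apply: (rfs_ind isoF).
- by rewrite !raddf0.
- by move=> a b Ea Eb; rewrite !raddfB Ea Eb subrr.
- move=> a u r E; rewrite nmor_bi delta_brg nmor_bi raddfB.
  rewrite !delta_br ?cls_bd ?cls_gent // (Xbd2 _ Tgt) (Xbd2 Tgt Tgt).
  by rewrite subrr bi0.
Qed.

Hypothesis acP : acyclic P.

(** Contracting homotopy: [h] sends [(u, r)] to [[hat u]r]. The boundary of [[nf u a]r] is [[hat u]]
    times the class of [ar], plus [u[a]r], minus [[hat (ua)]r], that is, [u[a]r] minus [h] of its
    boundary. *)
Lemma exact1 x y (w : W x y) (b : RFSgen F 0 (AW F w)) :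
  delta F 0 (AW F w) b = 0 -> exists a, delta F 1 (AW F w) a = b.
Proof.
pose h := lin0 w (fun z (u : W x z) r => bi (oneW x) (br (hat u) u) r w).
suff [a Ea] : exists a, delta F 1 (AW F w) a = b - h (delta F 0 (AW F w) b).
  by move=> E; exists a; rewrite Ea E raddf0 subr0.
move: b; apply: (rfs_ind isoF).
- by exists 0; rewrite !raddf0 addr0.
- move=> b c [a Ea] [a' Ea']; exists (a - a').
  by rewrite !raddfB Ea Ea' !opprD !opprK addrACA.
- move=> a u r E; pose c := Xgen (tval a).
  exists (bi (oneW x) (br (nf u c) (u ** tcls a)) r w).
  have Ec : cls (nf u c) = u ** tcls a by rewrite cls_nf -cls_gent.
  rewrite nmor_bi delta_br //.
  have -> : Xbd Src (nf u c) = Xh (hat u) c by exact: s_nf.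
  have -> : Xbd Tgt (nf u c) = hat (u ** cls0 c) by exact: t_nf.
  rewrite (br_h F (cls_hat u : cls (hat u) = u) (cls_gent a)).
  rewrite (delta0_br (w := w)) ?cls_gent // raddfB !lin0E -?mulWA //.
  rewrite biB biD !bi_bi ?mul1W ?mulW1 // -[cls0 c]/(cls c) cls_gent.
  rewrite opprB addrA; congr (_ - _); exact: addrC.
Qed.
End Low.

(** * The additive groups of flat loops *)

Section FlatLoop.
Variables (N : option nat) (P : polygraph N).

Record flat_loop n x y (w : @pres_hom P x y) : Type := FlatLoop {
  fval : loop n.+1 w;
  fvalP : flat fval }.

Lemma fval_inj n x y w : injective (@fval n x y w).
Proof.
case=> c pc [d pd] /= E; rewrite E in pc *; congr FlatLoop;
  exact: Prop_irrelevance.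
Qed.

Variables (n : nat) (x y : pob P) (w : @pres_hom P x y).
Local Notation Z := (flat_loop n w).

Definition flat_zero : Z := FlatLoop (flat1 w n).
Definition flat_add (l m : Z) : Z := FlatLoop (flatM (fvalP l) (fvalP m)).
Definition flat_opp (l : Z) : Z := FlatLoop (flatV (fvalP l)).

Lemma flat_addA : associative flat_add.
Proof. by move=> l m k; apply: fval_inj; exact: mulgA. Qed.
Lemma flat_addC : commutative flat_add.
Proof. by move=> l m; apply: fval_inj; apply: flatC; exact: fvalP. Qed.
Lemma flat_add0 : left_id flat_zero flat_add.
Proof. by move=> l; apply: fval_inj; exact: mul1g. Qed.
Lemma flat_addN : left_inverse flat_zero flat_opp flat_add.
Proof. by move=> l; apply: fval_inj; exact: mulVg. Qed.

HB.instance Definition _ := gen_eqMixin Z.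
HB.instance Definition _ := gen_choiceMixin Z.
HB.instance Definition _ :=
  GRing.isZmodule.Build Z flat_addA flat_addC flat_add0 flat_addN.

Definition to_flat (l : loop n.+1 w) : Z :=
  if pselect (flat l) is left h then FlatLoop h else 0.

Lemma to_flatK (l : loop n.+1 w) : flat l -> fval (to_flat l) = l.
Proof. by rewrite /to_flat; case: pselect. Qed.

Lemma fvalD (l m : Z) : fval (l + m) = (fval l * fval m)%g. Proof. by []. Qed.
Lemma fval0 : fval (0 : Z) = 1%g. Proof. by []. Qed.
Lemma fvalN (l : Z) : fval (- l) = ((fval l)^-1)%g. Proof. by []. Qed.
End FlatLoop.

(** * Homotopies in degrees 1 and 2, and the map from chains to flat loops *)

Section High.
Variables (N : option nat) (P : polygraph N) (C : category)
  (F : functor (pres P) C).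
Local Notation X := (@hcell N P).
Local Notation W := (@pres_hom P).
Local Notation v := (Xv 0).
Local Notation s := (Xs Src).
Local Notation t := (Xs Tgt).
Local Notation "u ** w" := (pres_cmp u w) (at level 40, left associativity).
Local Notation br := (br F).
Local Notation brl := (brl F).
Local Notation brg := (brg F).
Hypotheses (isoF : is_iso F) (acP : acyclic P).

Lemma delta_brl n x y (w : W x y) (l : loop n.+1 w) :
  delta F n.+2 (AW F w) (brl l) = brl (lbd Src l) - brl (lbd Tgt l).
Proof. by rewrite delta_br ?cls_l. Qed.

Lemma nf_one x y (u : W x y) : nf u (Xone 0 y) = Xid (hat u).
Proof. by rewrite nf_mk. Qed.

Section Fixed.
Variables (x y : pob P) (w : W x y).

Definition h1 : {additive RFSgen F 0 (AW F w) -> RFSgen F 1 (AW F w)} :=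
  lin isoF w (fun a u r => bi (oneW x) (br (nf u (Xgen (tval a))) (u ** tcls a)) r w).

Lemma h1_br x' y' (c : X 0 x' y') u r w' : cls c = w' -> u ** w' ** r = w ->
  h1 (bi u (br c w') r w) = bi (oneW x) (br (nf u c) (u ** w')) r w.
Proof.
move=> <- {w'} E; pose G x' y' (c : X 0 x' y') u r :=
  bi (oneW x) (br (nf u c) (u ** cls c)) r w.
apply: (lin_br0 isoF (G := G)) => // {x' y' c u r E}; rewrite /G.
- by move=> a u r _; rewrite cls_gent.
- by move=> z u r _; rewrite nf_one br_id bi0.
- move=> x1 x2 x3 c d u r E; rewrite nf_h cls_h -mulWA.
  have En : cls (nf u c) = u ** cls c by rewrite cls_nf.
  have Ei : cls (Xid d) = cls d by rewrite -(cls_bd Src) Xbd_id.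
  rewrite br_v ?cls_h ?En ?Ei //; last first.
    by rewrite Xs_h Xs_id t_nf s_nf.
  rewrite (br_h F En Ei) br_id bi0 addr0 biD !bi_bi ?mul1W //.
Qed.

(** Only existence is claimed: loops of dimension 2 need not commute, so the loop depends on the
    order of the summands, but its bracket does not. *)
Lemma base_fill (b : RFSgen F 1 (AW F w)) :
  exists l : loop 0 w, brl l = b - h1 (delta F 1 (AW F w) b).
Proof.
move: b; apply: (rfs_ind isoF).
- by exists 1%g; rewrite brl1 !raddf0 addr0.
- move=> b c [l El] [m Em]; exists (l * m^-1)%g.
  by rewrite brlM brlV El Em !raddfB ?opprD !opprK addrACA.
- move=> a u r E; pose c := Xgen (tval a);
  have Ec : cls c = tcls a by exact: cls_gent.
  exists (act (base u c (u ** tcls a)) (hat r) w).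
  rewrite brl_act ?cls_hat // (brl_base F Ec erefl) nmor_bi delta_brg biB raddfB.
  rewrite !h1_br ?cls_bd ?Ec // biD biB !bi_bi ?mul1W ?mulW1 //.
  by rewrite opprB addrAC addrA.
Qed.

Lemma exact2 (b : RFSgen F 1 (AW F w)) : dim_le 3 N ->
  delta F 1 (AW F w) b = 0 -> exists a, delta F 2 (AW F w) a = b.
Proof.
move=> N3 E; have [l El] := base_fill b.
have [L [sL tL]] := fill_loop0 acP l 1%g N3.
by exists (brl L); rewrite delta_brl sL tL brl1 subr0 El E raddf0 subr0.
Qed.

Section Dim3.
Hypothesis N3 : dim_le 3 N.

Definition h2 : {additive RFSgen F 1 (AW F w) -> RFSgen F 2 (AW F w)} :=
  lin isoF w (fun a u r =>
    bi (oneW x) (brl (theta u (Xgen (tval a)) (u ** tcls a))) r w).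

Lemma h2_br x' y' (c : X 1 x' y') u r w' : cls c = w' -> u ** w' ** r = w ->
  h2 (bi u (br c w') r w) = bi (oneW x) (brl (theta u c (u ** w'))) r w.
Proof.
move=> <- {w'} E; pose G x' y' (c : X 1 x' y') u r :=
  bi (oneW x) (brl (theta u c (u ** cls c))) r w.
apply: (lin_brS isoF (G := G)) => // {x' y' c u r E}; rewrite /G.
- by move=> a u r _; rewrite cls_gent.
- move=> x1 x2 c u r _; rewrite (theta_id acP N3) ?brl1 ?bi0 //.
  by rewrite -(cls_bd Src) Xbd_id.
- move=> x1 x2 c d u r E k.
  have Ev : cls (v c d) = cls c by rewrite /cls s_v.
  have Ed : cls d = cls c by rewrite /cls -k cls_s.
  by rewrite Ev Ed (theta_v acP N3) // brlM biD.
- move=> x1 x2 x3 c d u r E.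
  rewrite (theta_h acP N3 erefl (w' := u ** cls (Xh c d))) ?cls_h ?mulWA //.
  rewrite brlM brl_act ?cls_s ?mulWA // biD bi_bi ?mul1W //.
by rewrite mulWA.
Qed.

(** Sends generators of dimension n + 3 to flat loops of the same dimension. [reduced] is there for
    the rule on identities in [lin_brS], as [straighten] sends identities to identities that need
    not be trivial. *)
Definition phi_gen n (a : tgen P n.+2) (u : W x (tsrc a)) (r : W (ttgt a) y) :
    flat_loop n w :=
  to_flat (act (reduced (straighten u (Xgen (tval a)) (u ** tcls a))) (hat r) w).

Definition phi n : {additive RFSgen F n.+2 (AW F w) -> flat_loop n w} :=
  lin isoF w (@phi_gen n).

Lemma straighten_idW n x1 x2 (c : X n.+1 x1 x2) (u : W x x1) w' :
  u ** cls c = w' -> reduced (straighten u (Xid c) w') = 1%g.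
Proof.
case: n c => [|n] c E.
  by rewrite (straighten_id0 E) /reduced lbd_one lid_one invg1 mulg1.
by rewrite (straighten_id E) reduced_lid.
Qed.

Lemma phi_br n x' y' (c : X n.+2 x' y') u r w' :
  cls c = w' -> u ** w' ** r = w ->
  fval (phi n (bi u (br c w') r w)) =
  act (reduced (straighten u c (u ** w'))) (hat r) w.
Proof.
move=> <- {w'} E; pose G x' y' (c : X n.+2 x' y') u r : flat_loop n w :=
  to_flat (act (reduced (straighten u c (u ** cls c))) (hat r) w).
have fl x1 x2 (d : X n.+2 x1 x2) u1 r1 : u1 ** cls d ** r1 = w ->
    flat (act (reduced (straighten u1 d (u1 ** cls d))) (hat r1) w).
  move=> E1; apply: act_flat; first by rewrite cls_hat.
  exact/flat_reduced/(straighten_flat acP N3).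
have EG : phi n (bi u (br c (cls c)) r w) = G _ _ c u r; last first.
  by rewrite EG /G to_flatK //; apply: fl.
apply: (lin_brS isoF (G := G)) => // {x' y' c u r E}; rewrite /G.
- by move=> a u r _; rewrite cls_gent.
- move=> x1 x2 c u r E; apply: fval_inj;
  rewrite straighten_idW ?act1 ?to_flatK //.
    exact: flat1.
  by rewrite -[in RHS](cls_bd Src) Xbd_id.
- move=> x1 x2 c d u r E k.
  have Ev : cls (v c d) = cls c by rewrite /cls s_v.
  have Ed : cls d = cls c by rewrite /cls -k cls_s.
  have Ed' : u ** cls d ** r = w by rewrite Ed.
  have Ev' : u ** cls (v c d) ** r = w by rewrite Ev.
  apply: fval_inj; rewrite [LHS](to_flatK (fl _ _ _ _ _ Ev')) [RHS]fvalD.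
  rewrite [X in (X * _)%g](to_flatK (fl _ _ c _ _ E)).
  rewrite [X in (_ * X)%g](to_flatK (fl _ _ d _ _ Ed')).
  rewrite Ev Ed (straighten_v acP N3) //.
  have fc : flat (straighten u c (u ** cls c)) by apply: (straighten_flat acP N3).
  have fd : flat (straighten u d (u ** cls c)).
    by apply: (straighten_flat acP N3); rewrite Ed.
  by rewrite (reducedM fc fd) actM.
- move=> x1 x2 x3 c d u r E.
  have Eh : u ** cls (Xh c d) ** r = w by rewrite cls_h -mulWA.
  have Ec' : u ** cls c ** (cls d ** r) = w by rewrite -mulWA.
  apply: fval_inj; rewrite [LHS](to_flatK (fl _ _ _ _ _ Eh)) [RHS]fvalD.
  rewrite (to_flatK (fl _ _ _ _ _ Ec')) (to_flatK (fl _ _ _ _ _ E)).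
  set p := u ** cls c in Ec' *; set q := p ** cls d in E *.
  have -> : u ** cls (Xh c d) = q by rewrite cls_h /q /p mulWA.
  rewrite (straighten_h acP N3 (erefl p) (erefl q)).
  have fa : flat (straighten u c p) by apply: (straighten_flat acP N3).
  have fb : flat (straighten p d q) by apply: (straighten_flat acP N3).
  have Ep : p ** cls0 (s d) = q by [].
  have Eq : q ** cls0 (hat r) = w by rewrite cls_hat.
  have fc := act_flat Ep fa.
  rewrite (reducedM fc fb) -(act_reduced _ Ep) actM (act_act _ Ep Eq).
  (* One side acts on the first factor by [s d] followed by [hat r], the other by the normal form of
     the composite; a flat loop does not distinguish them. *)
  congr (_ * _)%g; apply: (act_flat_cls acP N3); last exact: flat_reduced.
    by rewrite cls0_h cls_hat.
  by rewrite cls0_h !cls_hat.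
Qed.
End Dim3.
End Fixed.
End High.

(** * Exactness from degree 3 on *)

Section High.
Variables (N : option nat) (P : polygraph N) (C : category)
  (F : functor (pres P) C).
Local Notation X := (@hcell N P).
Local Notation W := (@pres_hom P).
Local Notation "u ** w" := (pres_cmp u w) (at level 40, left associativity).
Local Notation br := (br F).
Local Notation brl := (brl F).
Local Notation brg := (brg F).
Hypotheses (isoF : is_iso F) (acP : acyclic P) (N3 : dim_le 3 N).

Section Fixed.
Variables (x y : pob P) (w : W x y).
Local Notation phi := (phi isoF w).
Local Notation h2 := (h2 isoF w).

(** The two contraction terms of [brl_straighten] add up to [h2] of the boundary of the generator,
    with a minus sign. *)
Lemma brl_phi0 (b : RFSgen F 2 (AW F w)) :
  brl (fval (phi 0 b)) = b - h2 (delta F 2 (AW F w) b).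
Proof.
move: b; apply: (rfs_ind isoF).
- by rewrite raddf0 fval0 brl1 !raddf0 addr0.
- move=> b c Eb Ec; rewrite raddfB fvalD fvalN brlM brlV Eb Ec.
  by rewrite !raddfB ?opprD !opprK addrACA.
- move=> a u r E; pose c := Xgen (tval a);
  have Ec : cls c = tcls a by exact: cls_gent.
  rewrite (phi_br isoF acP N3 Ec E) brl_act ?cls_hat // brl_reduced.
  rewrite (brl_straighten F Ec erefl) nmor_bi delta_brg biB raddfB.
  rewrite !(h2_br isoF acP N3) ?cls_bd ?Ec // biD biB !bi_bi ?mul1W ?mulW1 //.
  by rewrite opprB addrAC addrA.
Qed.

(** From degree 4 on the contracting 3-cells enter only through identities, whose brackets vanish,
    so no homotopy term is left. *)
Lemma brl_phi n (b : RFSgen F n.+3 (AW F w)) : brl (fval (phi n.+1 b)) = b.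
Proof.
move: b; apply: (rfs_ind isoF).
- by rewrite raddf0 fval0 brl1.
- by move=> b c Eb Ec; rewrite raddfB fvalD fvalN brlM brlV Eb Ec.
- move=> a u r E; pose c := Xgen (tval a);
  have Ec : cls c = tcls a by exact: cls_gent.
  rewrite (phi_br isoF acP N3 Ec E) brl_act ?cls_hat // brl_reduced.
  rewrite (brl_straighten F Ec erefl) !brl_id subr0 addr0.
  by rewrite bi_bi ?mul1W ?mulW1.
Qed.

(** The compatibility with boundaries comes from [lbd_reduced_src]. For a cycle it makes the source
    trivial as well as the target, so that the loop can be filled. *)
Lemma lbd_phi n (b : RFSgen F n.+3 (AW F w)) :
  lbd Src (fval (phi n.+1 b)) = fval (phi n (delta F n.+3 (AW F w) b)) /\
  lbd Tgt (fval (phi n.+1 b)) = 1%g.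
Proof.
move: b; apply: (rfs_ind isoF).
- by rewrite !raddf0 !fval0 !lbd_one.
- move=> b c [sb tb] [sc tc]; rewrite !raddfB !fvalD !fvalN !lbdM !lbd_inv.
  by rewrite sb sc tb tc mulgV.
- move=> a u r E; pose c := Xgen (tval a);
  have Ec : cls c = tcls a by exact: cls_gent.
  have Er : (u ** tcls a) ** cls0 (hat r) = w by rewrite cls_hat.
  have Eu : u ** cls c = u ** tcls a by rewrite Ec.
  rewrite (phi_br isoF acP N3 Ec E) !(lbd_act _ _ Er) lbd_reduced act1;
    split=> //.
  rewrite lbd_reduced_src ?(lbd_straighten _ Eu);
    last exact: (straighten_flat acP N3).
  rewrite actM actV nmor_bi delta_brg biB raddfB fvalD fvalN.
  by rewrite !(phi_br isoF acP N3 _ E) ?cls_bd.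
Qed.

Lemma exact3 (b : RFSgen F 2 (AW F w)) : dim_le 4 N ->
  delta F 2 (AW F w) b = 0 -> exists a, delta F 3 (AW F w) a = b.
Proof.
move=> N4 E; have El := brl_phi0 b; set l := fval (phi 0 b) in El.
have [sl tl] : flat l := fvalP _.
(* In dimension 3, flatness says precisely that source and target are trivial. *)
have [|L [sL tL]] := fill_loop acP (l := l) (m := 1%g) N4.
  by case; rewrite lbd_one; [exact: sl|exact: tl].
by exists (brl L); rewrite delta_brl sL tL brl1 subr0 El E raddf0 subr0.
Qed.

Lemma exact_high n (b : RFSgen F n.+3 (AW F w)) : dim_le n.+4.+1 N ->
  delta F n.+3 (AW F w) b = 0 -> exists a, delta F n.+4 (AW F w) a = b.
Proof.
move=> Nn E; have El := brl_phi b; have [sl tl] := lbd_phi b.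
rewrite E raddf0 fval0 in sl.
have [|L [sL tL]] := fill_loop acP (l := fval (phi n.+1 b)) (m := 1%g) Nn.
  by case; rewrite lbd_one.
by exists (brl L); rewrite delta_brl sL tL brl1 subr0.
Qed.
End Fixed.
End High.

(** * Freeness, and assembly of the resolution *)

Definition repr_set (C : category) (w : fact C) : setsys C :=
  @SetSys C (fun w' => hom w w') (fun _ _ m s => s \; m)
    (fun _ s => cmpm1 s) (fun _ _ _ m m' s => esym (cmpA s m m')).

(** [e] and [d] exhibit [S] as a disjoint union of representable functors, and the free abelian
    group turns this union into a coproduct. *)
Lemma free_sys_is_free (C : category) (S : setsys C) (I : Type) (a : I -> fact C)
    (e : forall i w, hom (a i) w -> S w) (d : forall w, S w -> {i & hom (a i) w}) :
  (forall i w w' (m : hom (a i) w) (m' : hom w w'),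
    e i w' (m \; m') = sact m' (e i w m)) ->
  (forall w p, e _ w (projT2 (d w p)) = p) ->
  (forall i w m, d w (e i w m) = existT _ i m) ->
  is_free (free_sys S).
Proof.
move=> eN eK dK.
have iN i w w' (m : hom w w') (k : repr_set (a i) w) :
    fgen (e i w' (sact m k)) = nact (free_sys S) m (fgen (e i w k)).
  by rewrite /= flift_gen -eN.
pose inj i : nmor (repr_sys (a i)) (free_sys S) :=
  @free_nmor C (repr_set (a i)) (free_sys S) (fun w m => fgen (e i w m)) (iN i).
exists I, a, inj => E f.
pose g0 w p : E w := f (projT1 (d w p)) w (fgen (projT2 (d w p))).
have gN w w' (m : hom w w') p : g0 w' (sact m p) = nact E m (g0 w p).
  rewrite /g0; have := eK w p; case: (d w p) => i k /= <-; rewrite -eN dK.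
  apply: etrans (nmap_nat (f i) m (fgen (k : repr_set (a i) w))).
  by congr (f _ _ _); rewrite /= flift_gen.
exists (free_nmor gN); split=> [i w b|g' g'f w b].
  apply: (freeab_ext (f := (free_nmor gN w \o inj i w)) (g := f i w)) => m.
  by rewrite /= !flift_gen /g0 dK.
apply: (freeab_ext (f := g' w) (g := free_nmor gN w)) => p.
rewrite /= flift_gen /g0 -g'f /= flift_gen.
by rewrite eK.
Qed.

Lemma fam_is_free (C : category) (I : Type) (a : I -> fact C) :
  is_free (free_sys (fam_sys a)).
Proof.
apply: (@free_sys_is_free C (fam_sys a) I a (fun i w m => existT _ i m) (fun w p => p)) => //.
by move=> w [].
Qed.

(** A factorisation of [w] through [z] is the same as a morphism from the identity of [z] to [w] in
    [fact C], so the generators sit at identities. *)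
Lemma pair_is_free (C : category) : is_free (free_sys (pair_sys C)).
Proof.
have E1 (z : C) (w : fact C) (m : @hom (fact C) (Arrow (idm z)) w) :
    fleft m \; fright m = amap w.
  by rewrite -(factE m) /= cmp1m.
have E2 (w : fact C) (p : fact_pair w) :
    pleft p \; amap (Arrow (idm (pmid p))) \; pright p = amap w.
  by rewrite /= cmp1m pairE.
apply: (@free_sys_is_free C (pair_sys C) C (fun z => Arrow (idm z))
  (fun z w m => @FactPair C w z (fleft m) (fright m) (E1 z w m))
  (fun w p => existT (fun z : C => @hom (fact C) (Arrow (idm z)) w) (pmid p)
    (@FactHom C (Arrow (idm (pmid p))) w (pleft p) (pright p) (E2 w p)))).
- by move=> z w w' m m'; apply: fact_pairP.
- by move=> w [z u v E]; apply: fact_pairP.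
- by move=> z w m; congr existT; apply: fact_homP.
Qed.

Lemma res_free_resolution N (C : category) (Sigma : poly_resolution N C) :
  @free_resolution N C (const_int C) (RFS (res_functor Sigma))
    (@delta _ _ (res_functor Sigma)) (augmentation C).
Proof.
have isoF := res_iso Sigma; have acP := @res_acyclic _ _ Sigma.
have le m k : (m <= k)%N -> dim_le k N -> dim_le m N.
  by case: (N) => //= n' mk kn; apply: leq_trans kn.
split.
- by case=> [|k] _; [exact: pair_is_free|exact: fam_is_free].
(* As [F] is an isomorphism, every arrow of [C] has the form [AW F w]; exactness is tested at
   these. *)
- move=> a b; have [x [y [w Ea]]] := AW_surj isoF a; subst a.
  exists (pr _ (oneW x) w w *~ b).
  by rewrite raddfMz aug_pr ?mul1W // intz.
- move=> _ a b; have [x [y [w Ea]]] := AW_surj isoF a; subst a; split.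
    exact: exact_aug.
  by move=> [c <-]; apply: (aug_delta0 isoF).
- move=> [|[|[|k]]] Nk a b; have [x [y [w Ea]]] := AW_surj isoF a; subst a;
  split.
  + exact: exact1.
  + by move=> [c <-]; apply: (delta0_delta isoF).
  + exact: exact2.
  + by move=> [c <-]; apply: (delta_delta isoF).
  + by apply: exact3 => //; apply: le Nk.
  + by move=> [c <-]; apply: (delta_delta isoF).
  + by apply: exact_high => //; apply: le Nk.
  + by move=> [c <-]; apply: (delta_delta isoF).
Qed.

Theorem theorem5p4p3 (C : category) :
  (forall Sigma : poly_resolution None C,
     @free_resolution None C (const_int C)
       (RFS (res_functor Sigma)) (@delta _ _ (res_functor Sigma))
       (augmentation C)) /\
  (forall n : nat, (2 <= n)%N -> forall Sigma : poly_resolution (Some n) C,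
     @free_resolution (Some n) C (const_int C)
       (RFS (res_functor Sigma)) (@delta _ _ (res_functor Sigma))
       (augmentation C)).
Proof. by split=> [|n _] Sigma; apply: res_free_resolution. Qed.
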